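(* Let $f:(\mathbb{R}^2,\mathbf{0})\to(\mathbb{R}^3,\mathbf{0})$ be a $C^\infty$ map-germ such that $\mathbf{0}$ is a corank one singular point of $f$, i.e. $\operatorname{rank} df_{\mathbf{0}}=1$. Let $\xi,\eta$ be vector fields near the origin of $\mathbb{R}^2$ such that $df_{\mathbf{0}}(\eta_{\mathbf{0}})=\mathbf{0}$ and $\xi_{\mathbf{0}},\eta_{\mathbf{0}}\in T_{\mathbf{0}}\mathbb{R}^2$ are linearly independent, and put $$\varphi=\det(\xi f,\ \eta f,\ \eta\eta f).$$ Then: (1) $f$ at $\mathbf{0}$ is $\mathcal{A}$-equivalent to the Chen Matumoto Mond $-$ singularity $(x,y)\mapsto(x,y^2,y(x^2-y^2))$ at the origin if and only if $\varphi$ has a critical point at $\mathbf{0}$ and $\det\operatorname{Hess}\varphi(\mathbf{0})>0$. (2) $f$ at $\mathbf{0}$ is $\mathcal{A}$-equivalent to the Chen Matumoto Mond $+$ singularity $(x,y)\mapsto(x,y^2,y(x^2+y^2))$ at the origin if and only if $\varphi$ has a critical point at $\mathbf{0}$, $\det\operatorname{Hess}\varphi(\mathbf{0})<0$, and the two vectors $\xi f(\mathbf{0})$ and $\eta\eta f(\mathbf{0})$ are linearly independent.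
   Context: All maps and vector fields are of class $C^\infty$. For a vector field $\zeta$ on $\mathbb{R}^2$ near $\mathbf{0}$ and a vector-valued function $g$, $\zeta g$ denotes the directional derivative of $g$ by $\zeta$; $\eta\eta f=\eta(\eta f)$. Note that $\eta$ is only required to lie in the kernel of $df$ at the origin. Two map-germs $f_1,f_2:(\mathbb{R}^2,\mathbf{0})\to(\mathbb{R}^3,\mathbf{0})$ are $\mathcal{A}$-equivalent if there exist germs of $C^\infty$-diffeomorphisms $d_s:(\mathbb{R}^2,\mathbf{0})\to(\mathbb{R}^2,\mathbf{0})$ and $d_t:(\mathbb{R}^3,\mathbf{0})\to(\mathbb{R}^3,\mathbf{0})$ such that $d_t\circ f_1=f_2\circ d_s$. $\operatorname{Hess}\varphi(\mathbf{0})$ is the $2\times2$ Hessian matrix of $\varphi$ at $\mathbf{0}$; ''$\varphi$ has a critical point at $\mathbf{0}$'' means $d\varphi(\mathbf{0})=\mathbf{0}$. *)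

(* Defs.v *)
From HB Require Import structures.
From mathcomp Require Import all_boot all_order all_algebra.
From mathcomp Require Import all_classical all_reals all_analysis.
Set Implicit Arguments.
Unset Strict Implicit.
Unset Printing Implicit Defensive.
Import Order.TTheory GRing.Theory Num.Theory.
Import numFieldNormedType.Exports.
Local Open Scope classical_set_scope.
Local Open Scope ring_scope.

(* Points and tangent vectors of R^n are row vectors 'rV[R]_n.  A map-germ at
   the origin is given by a representative 'rV[R]_m -> 'rV[R]_n, total but
   constrained only near 0; all the notions below depend on its germ only. *)

(* [U] is meant to be open. *)
Fixpoint Ck (R : realType) (m n : nat) (k : nat) (U : set 'rV[R]_m)
    (f : 'rV[R]_m -> 'rV[R]_n) : Prop :=
  if k is k'.+1 then
    (forall x, U x -> differentiable f x) /\ (forall v, Ck k' U ('D_v f))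
  else forall x, U x -> {for x, continuous f}.

(* The neighbourhood does not depend on the order k. *)
Definition smooth_near0 (R : realType) (m n : nat)
    (f : 'rV[R]_m -> 'rV[R]_n) : Prop :=
  exists2 U : set 'rV[R]_m, open_nbhs (0 : 'rV[R]_m) U & forall k, Ck k U f.

Definition map_germ (R : realType) (m n : nat)
    (f : 'rV[R]_m -> 'rV[R]_n) : Prop :=
  smooth_near0 f /\ f 0 = 0.

Definition diffeo_germ (R : realType) (n : nat)
    (d : 'rV[R]_n -> 'rV[R]_n) : Prop :=
  map_germ d /\
  exists e : 'rV[R]_n -> 'rV[R]_n,
    [/\ map_germ e, \forall x \near (0 : 'rV[R]_n), e (d x) = x
      & \forall y \near (0 : 'rV[R]_n), d (e y) = y].

Definition A_equivalent (R : realType) (m n : nat)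
    (f1 f2 : 'rV[R]_m -> 'rV[R]_n) : Prop :=
  exists (ds : 'rV[R]_m -> 'rV[R]_m) (dt : 'rV[R]_n -> 'rV[R]_n),
    [/\ diffeo_germ ds, diffeo_germ dt
      & \forall x \near (0 : 'rV[R]_m), dt (f1 x) = f2 (ds x)].

(* The directional derivative zeta g of g by the vector field zeta. *)
Definition vf_derive (R : realType) (m n : nat) (zeta : 'rV[R]_m -> 'rV[R]_m)
    (g : 'rV[R]_m -> 'rV[R]_n) : 'rV[R]_m -> 'rV[R]_n :=
  fun x => 'D_(zeta x) g x.

Definition det3 (R : realType) (u v w : 'rV[R]_3) : R :=
  \det (\matrix_(i < 3) [:: u; v; w]`_i).

Definition critical_at0 (R : realType) (m : nat) (phi : 'rV[R]_m -> R) : Prop :=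
  forall v : 'rV[R]_m, 'd phi (0 : 'rV[R]_m) v = 0.

Definition Hess (R : realType) (m : nat) (phi : 'rV[R]_m -> R)
    (x : 'rV[R]_m) : 'M[R]_m :=
  \matrix_(i < m, j < m)
    'D_(delta_mx 0 i : 'rV[R]_m) ('D_(delta_mx 0 j : 'rV[R]_m) phi) x.

Definition CMM_minus (R : realType) (p : 'rV[R]_2) : 'rV[R]_3 :=
  let x := p 0 0 in let y := p 0 1 in
  \row_(j < 3) [:: x; y ^+ 2; y * (x ^+ 2 - y ^+ 2)]`_j.

Definition CMM_plus (R : realType) (p : 'rV[R]_2) : 'rV[R]_3 :=
  let x := p 0 0 in let y := p 0 1 in
  \row_(j < 3) [:: x; y ^+ 2; y * (x ^+ 2 + y ^+ 2)]`_j.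

(* Main.v *)
Require Import Defs.
From HB Require Import structures.
From mathcomp Require Import all_boot all_order all_algebra.
From mathcomp Require Import all_classical all_reals all_analysis.
From mathcomp Require Import ring lra.
Import Order.TTheory GRing.Theory Num.Theory.
Import numFieldNormedType.Exports.
Local Open Scope classical_set_scope.
Local Open Scope ring_scope.

Set Implicit Arguments.
Unset Strict Implicit.
Unset Printing Implicit Defensive.

(* Let h = det(f_u, f_w, f_ww) for constant fields u, w with df_0(w) = 0.
   Replacing (u, w) by other fields, f by f o d, or f by d o f only multiplies h by
   a unit, up to o(2) terms, as soon as h = O(2): the mixed terms carry
   det(f_u, f_w, f_uw), whose 1-jet is a multiple of the coefficient
   det(f_u, f_uw, f_ww) of the 1-jet of h. So the sign of the determinant of the
   2-jet of h, and the independence of f_u and f_ww, are invariants of the A-class.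

   Conversely, if f_u and f_ww are independent, then taking as source coordinates
   a component of f and the Jacobian determinant of two of them puts two components
   of f in the form (x, c(x) + y^2 u). Hence f is A-equivalent to
   (x, y^2, y b(x, y^2)) by Whitney's theorem on even functions. There
   h = -2 b + 8 y^2 b_z + 8 y^4 b_zz, so that h = O(2) means
   b = x^2 b_1 + z b_2, the sign in question is that of -b_1(0) b_2(0), and
   rescaling x and the last component gives the models. In the minus case
   independence is automatic: otherwise h vanishes to third order along w, which a
   definite form does not allow. *)

(** * Calculus *)

Section Calculus.
Context {R : realType}.

(** The function phi depends on the fields and on both coordinate systems. What is transported is
    not its Hessian but the existence of a second-order expansion whose determinant has a given
    sign: this survives a unit factor, an o(2) error and a change of coordinates. Freezing xi and
    eta at the origin is such a change. That eta lies in the kernel only at the origin does no harm: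
    the term of eta eta f with derivatives of eta is a value of df, and three values of df are
    dependent, the source being a plane. A parameter s = 1 or -1 serves both signs.

    The analytic obstacle is that a in e(x, y) = a(x, y^2) is needed on both sides of z = 0, because
    the diffeomorphism that removes the even part acts on a neighbourhood in R^3. For z >= 0 one has
    e(x, sqrt z); for z < 0 a series of such values is used, with Seeley's weights, whose moments at
    the nodes -4^k are all 1, so that all derivatives match. Higher derivatives at z = 0 are never
    computed: a family of functions continuous across a hyperplane, whose partial derivatives off it
    are combinations of the family, is smooth. *)

Definition dot m (c v : 'rV[R]_m) : R := \sum_i c 0 i * v 0 i.

Lemma dot_is_linear m (c : 'rV[R]_m) : linear (dot c).
Proof.
move=> a u v; rewrite /dot scaler_sumr -big_split /=.
by apply: eq_bigr => i _; rewrite !mxE mulrDr mulrCA.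
Qed.

HB.instance Definition _ m (c : 'rV[R]_m) :=
  GRing.isLinear.Build R 'rV[R]_m R _ (dot c) (dot_is_linear c).

Lemma coord_le_norm m (v : 'rV[R]_m) i : `|v 0 i| <= `|v|.
Proof.
rewrite [leRHS]/Num.Def.normr /= mx_normrE.
exact: (le_bigmax _ (fun ij => `|v ij.1 ij.2|) (0, i)).
Qed.

Lemma norm_rV_le m (v : 'rV[R]_m) (r : R) :
  0 <= r -> (forall i, `|v 0 i| <= r) -> `|v| <= r.
Proof.
move=> r0 vr; rewrite [leLHS]/Num.Def.normr /= mx_normrE.
by apply: bigmax_le => // -[i j] _ /=; rewrite ord1.
Qed.

Lemma dot_continuous m (c : 'rV[R]_m) : continuous (dot c).
Proof.
have -> : dot c = \sum_i (fun v : 'rV[R]_m => c 0 i *: (v 0 i : R^o)).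
  by apply/funext => v; rewrite /dot fct_sumE.
move=> v; apply: (differentiable_continuous (f := _ : _ -> R^o)).
apply: differentiable_sum => i; apply: differentiableZ.
exact: differentiable_coord.
Qed.

Lemma diff_of_bound m (f : 'rV[R]_m -> R) (x c : 'rV[R]_m) :
  (forall e : R, 0 < e -> \forall v \near (0 : 'rV[R]_m),
     `|f (v + x) - f x - dot c v| <= e * `|v|) ->
  differentiable f x /\ forall v, 'D_v f x = dot c v.
Proof.
move=> H.
have E : f \o shift x = cst (f x) + dot c +o_ (0 : 'rV[R]_m) id.
  apply/eqaddoP => e /H; apply: filterS => v /=.
  by rewrite opprD addrA.
have D := diff_unique (@dot_continuous m c) E.
have df : differentiable f x.
  by apply/diff_locallyP; rewrite D; split => //; exact: dot_continuous.
by split => // v; rewrite deriveE // D.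
Qed.

Lemma diff_bound m (f : 'rV[R]_m -> R) (x : 'rV[R]_m) : differentiable f x ->
  forall e : R, 0 < e -> \forall v \near (0 : 'rV[R]_m),
     `|f (v + x) - f x - 'D_v f x| <= e * `|v|.
Proof.
move=> df e e0; have /diff_locallyP[_ /eqaddoP H] := df.
by have := H e e0; apply: filterS => v /=; rewrite deriveE // opprD addrA.
Qed.

Lemma derive_add m (f : 'rV[R]_m -> R) x u v : differentiable f x ->
  'D_(u + v) f x = 'D_u f x + 'D_v f x.
Proof. by move=> df; rewrite !deriveE // linearD. Qed.

Lemma derive_scale m (f : 'rV[R]_m -> R) x a v : differentiable f x ->
  'D_(a *: v) f x = a * 'D_v f x.
Proof. by move=> df; rewrite !deriveE // linearZ. Qed.

Lemma derive_basis m (f : 'rV[R]_m -> R) x v : differentiable f x ->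
  'D_v f x = \sum_i v 0 i * 'D_(delta_mx 0 i) f x.
Proof.
move=> df; rewrite deriveE // {1}[v]row_sum_delta linear_sum.
by apply: eq_bigr => i _; rewrite linearZ deriveE.
Qed.

Lemma differentiable_rV m n (F : 'rV[R]_m -> 'rV[R]_n) x :
  (forall j, differentiable (fun y => F y 0 j) x) -> differentiable F x.
Proof.
move=> H; have -> : F = \sum_j (fun y => F y 0 j *: delta_mx 0 j).
  by apply/funext => y; rewrite fct_sumE [LHS]row_sum_delta.
by apply: differentiable_sum => j; exact: differentiableZl.
Qed.

Lemma differentiable_comp_coord m n (F : 'rV[R]_m -> 'rV[R]_n) x j :
  differentiable F x -> differentiable (fun y => F y 0 j) x.
Proof.
move=> dF; apply: (differentiable_comp (g := fun M : 'rV[R]_n => M 0 j : R^o)) => //.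
exact: differentiable_coord.
Qed.

Lemma derive_coord m n (F : 'rV[R]_m -> 'rV[R]_n) x v j : differentiable F x ->
  ('D_v F x) 0 j = 'D_v (fun y => F y 0 j) x.
Proof. by move=> dF; rewrite derive_mx ?mxE //; exact: diff_derivable. Qed.

Lemma derive_chain m n (g : 'rV[R]_n -> R) (F : 'rV[R]_m -> 'rV[R]_n) x v :
  differentiable F x -> differentiable g (F x) ->
  'D_v (g \o F) x = 'D_('D_v F x) g (F x).
Proof.
move=> dF dg; rewrite deriveE; last exact: differentiable_comp.
by rewrite diff_comp // /comp !deriveE.
Qed.

Lemma differentiable_near_eq m (f g : 'rV[R]_m -> R) x : (\near x, f x = g x) ->
  differentiable f x -> differentiable g x.
Proof.
move=> fg df; suff [] : differentiable g x /\ forall v, 'D_v g x =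
   dot (\row_i 'D_(delta_mx 0 i) f x) v by [].
have gfx := nbhs_singleton fg.
apply: diff_of_bound => e e0.
have : \forall v \near (0 : 'rV[R]_m), f (v + x) = g (v + x).
  by have := fg; rewrite (near_shift 0 x) subr0.
apply: filter_app.
have := diff_bound df e0; apply: filterS => v H fgv.
rewrite -fgv -gfx; suff -> : dot (\row_i 'D_(delta_mx 0 i) f x) v = 'D_v f x by [].
by rewrite derive_basis // /dot; apply: eq_bigr => i _; rewrite mxE mulrC.
Qed.

Lemma derive_line m (f : 'rV[R]_m -> R) (x v : 'rV[R]_m) (t : R) :
  differentiable f (x + t *: v) ->
  is_derive t 1 (fun s : R => f (x + s *: v) : R^o) ('D_v f (x + t *: v)).
Proof.
move=> df.
have dl : is_diff t (fun s : R => x + s *: v) ( *:%R^~ v).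
  by apply: is_diff_eq; rewrite add0r.
have d2 : differentiable (f \o (fun s : R => x + s *: v)) t.
  apply: differentiable_comp => //.
split; first exact: diff_derivable.
by rewrite deriveE // diff_comp //= diff_val scale1r deriveE.
Qed.

(** Differentiability is asked only at interior points of the segment, so that an end point may lie
    on a hyperplane across which only continuity is known. *)
Lemma MVT_line m (f : 'rV[R]_m -> R) (x v : 'rV[R]_m) :
  (forall t, 0 < t < 1 -> differentiable f (x + t *: v)) ->
  (forall t, 0 <= t <= 1 -> {for x + t *: v, continuous f}) ->
  exists2 t, 0 < t < 1 & f (x + v) - f x = 'D_v f (x + t *: v).
Proof.
move=> df cf.
have [t||t tI] := @MVT R (fun s : R => f (x + s *: v))
  (fun t => 'D_v f (x + t *: v)) 0 1 ltr01.
- by rewrite in_itv /= => /df; exact: derive_line.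
- apply: continuous_in_subspaceT => t; rewrite inE /= in_itv /= => tI.
  apply: (@continuous_comp _ _ _ (fun s : R => x + s *: v) f); last exact: cf.
  apply: (differentiable_continuous (f := fun s : R => x + s *: v)) => //.
- rewrite scale1r scale0r addr0 subr0 mulr1 => E; by exists t.
Qed.

Lemma continuous_dist_le m (f : 'rV[R]_m -> R) x :
  (forall e : R, 0 < e -> \forall y \near x, `|f x - f y| <= e) ->
  {for x, continuous f}.
Proof.
move=> H; have FF : Filter (nbhs x) by exact: nbhs_filter.
exact: (@cvgrPdist_le R R^o _ (nbhs x) FF f (f x)).2.
Qed.

End Calculus.

(** * Smooth functions *)

Section SmoothFunctions.
Context {R : realType}.

(* The greatest class of functions differentiable on U and stable under
   directional derivatives, up to equality on U: smoothness is proved by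
   exhibiting any such class [P]. *)
Definition smooth_on m (U : set 'rV[R]_m) (f : 'rV[R]_m -> R) : Prop :=
  exists2 P : set ('rV[R]_m -> R), P f & forall g, P g ->
    (forall x, U x -> differentiable g x) /\
    (forall v, exists2 h, P h & forall x, U x -> 'D_v g x = h x).

Definition smooth_map m n (U : set 'rV[R]_m) (F : 'rV[R]_m -> 'rV[R]_n) : Prop :=
  forall j, smooth_on U (fun x => F x 0 j).

Lemma smooth_differentiable m (U : set 'rV[R]_m) f x :
  smooth_on U f -> U x -> differentiable f x.
Proof. by move=> [P Pf HP]; apply: (HP f Pf).1. Qed.

Lemma smooth_continuous m (U : set 'rV[R]_m) f x :
  smooth_on U f -> U x -> {for x, continuous f}.
Proof.
by move=> sf Ux; apply: (differentiable_continuous (f := f : _ -> R^o));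
  exact: smooth_differentiable sf Ux.
Qed.

Lemma open_near m (U : set 'rV[R]_m) x (P : set 'rV[R]_m) :
  open U -> U x -> (forall y, U y -> P y) -> \forall y \near x, P y.
Proof. by move=> oU Ux H; apply: filterS H _; exact: open_nbhs_nbhs. Qed.

Lemma smooth_eq_on m (U : set 'rV[R]_m) f g : open U ->
  (forall x, U x -> f x = g x) -> smooth_on U f -> smooth_on U g.
Proof.
move=> oU fg [P Pf HP].
exists [set g | exists2 f, P f & forall x, U x -> f x = g x]; first by exists f.
move=> {f g fg Pf} g [f Pf fg]; have [df Df] := HP f Pf; split=> [x Ux|v].
  apply: differentiable_near_eq (df x Ux); exact: open_near fg.
have [h Ph hE] := Df v; exists h; first by exists h.
move=> x Ux; rewrite -hE //; apply/esym/near_eq_derive; exact: open_near fg.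
Qed.

Lemma smooth_derive m (U : set 'rV[R]_m) f v : open U ->
  smooth_on U f -> smooth_on U ('D_v f).
Proof.
move=> oU [P Pf HP]; have [h Ph hE] := (HP f Pf).2 v.
by apply: (@smooth_eq_on _ _ h) => // [x /hE|]; last by exists P.
Qed.

Lemma smooth_subset m (U W : set 'rV[R]_m) f : U `<=` W ->
  smooth_on W f -> smooth_on U f.
Proof.
move=> UW [P Pf HP]; exists P => // g /HP[dg Dg]; split=> [x /UW|v]; first exact: dg.
by have [h Ph hE] := Dg v; exists h => // x /UW; exact: hE.
Qed.

(** No single operation is stable under derivatives: a product differentiates to a sum of products,
    a square root to a quotient, a composite to a sum of products of composites. Closing under all
    of them at once yields one class to which [smooth_on] applies, and the closure properties below
    follow from it. *)
Inductive smooth_expr m (U : set 'rV[R]_m) : ('rV[R]_m -> R) -> Prop :=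
| SmoothBase f : smooth_on U f -> smooth_expr U f
| SmoothCst c : smooth_expr U (fun=> c)
| SmoothAdd f g : smooth_expr U f -> smooth_expr U g ->
    smooth_expr U (fun x => f x + g x)
| SmoothMul f g : smooth_expr U f -> smooth_expr U g ->
    smooth_expr U (fun x => f x * g x)
| SmoothInv f : smooth_expr U f -> (forall x, U x -> f x != 0) ->
    smooth_expr U (fun x => (f x)^-1)
| SmoothSqrt f : smooth_expr U f -> (forall x, U x -> 0 < f x) ->
    smooth_expr U (fun x => Num.sqrt (f x))
| SmoothComp p (W : set 'rV[R]_p) g (F : 'rV[R]_m -> 'rV[R]_p) : open W ->
    smooth_on W g -> (forall j, smooth_expr U (fun x => F x 0 j)) ->
    (forall x, U x -> W (F x)) -> smooth_expr U (fun x => g (F x)).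

Lemma smooth_expr_sum m (U : set 'rV[R]_m) (I : Type) (r : seq I) (h : I -> 'rV[R]_m -> R) :
  (forall i, smooth_expr U (h i)) -> smooth_expr U (fun x => \sum_(i <- r) h i x).
Proof.
move=> H; elim: r => [|i r IH].
  by under eq_fun do rewrite big_nil; exact: SmoothCst.
by under eq_fun do rewrite big_cons; exact: SmoothAdd.
Qed.

Lemma smooth_expr_closed m (U : set 'rV[R]_m) f : smooth_expr U f ->
    (forall x, U x -> differentiable f x) /\
    (forall v, exists2 h, smooth_expr U h & forall x, U x -> 'D_v f x = h x).
Proof.
elim=> {f}.
- move=> f [P Pf HP]; have [df Df] := HP f Pf; split=> // v.
  by have [h Ph hE] := Df v; exists h => //; apply: SmoothBase; exists P.
- move=> c; split=> [x _|v]; first exact: differentiable_cst.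
  by exists (fun=> 0); [exact: SmoothCst | move=> x _; rewrite derive_cst].
- move=> f g sf [df Df] sg [dg Dg]; split=> [x Ux|v].
    by apply: (differentiableD (f := f : _ -> R^o)); [exact: df|exact: dg].
  have [h1 s1 E1] := Df v; have [h2 s2 E2] := Dg v.
  exists (fun x => h1 x + h2 x); first exact: SmoothAdd.
  move=> x Ux; rewrite -E1 // -E2 //.
  by rewrite (deriveD (f := f : _ -> R^o)) //; apply: diff_derivable; [exact: df|exact: dg].
- move=> f g sf [df Df] sg [dg Dg]; split=> [x Ux|v].
    by apply: differentiableM; [exact: df|exact: dg].
  have [h1 s1 E1] := Df v; have [h2 s2 E2] := Dg v.
  exists (fun x => f x * h2 x + g x * h1 x).
    by apply: SmoothAdd; apply: SmoothMul.
  move=> x Ux; rewrite -E1 // -E2 //.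
  by rewrite (deriveM (f := f)) //; apply: diff_derivable; [exact: df|exact: dg].
- move=> f sf [df Df] f0; split=> [x Ux|v].
    by apply: differentiableV; [exact: df|exact: f0].
  have [h s E] := Df v; exists (fun x => - 1 * (f x)^-1 * (f x)^-1 * h x).
    by do ! [apply: SmoothMul => //]; [exact: SmoothCst|exact: SmoothInv|exact: SmoothInv].
  move=> x Ux; rewrite -E // (deriveV (f := f)) ?f0 //; last by apply: diff_derivable; exact: df.
  by rewrite /GRing.scale /= mulN1r expr2 invfM mulNr mulNr.
- move=> f sf [df Df] f0.
  have key x : U x -> differentiable (fun y => Num.sqrt (f y)) x /\
      forall v, 'D_v (fun y => Num.sqrt (f y)) x = 'D_v f x / (2 * Num.sqrt (f x)).
    move=> Ux; have fx := f0 x Ux.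
    have sq := is_derive1_sqrt fx.
    have ds : differentiable (Num.sqrt : R -> R^o) (f x).
      by apply/derivable1_diffP; exact: ex_derive.
    split=> [|w].
      by apply: (differentiable_comp (f := f) (g := Num.sqrt : R -> R^o)) ds; exact: df.
    rewrite deriveE; last first.
      by apply: (differentiable_comp (f := f) (g := Num.sqrt : R -> R^o)) ds; exact: df.
    rewrite (diff_comp (f := f) (g := Num.sqrt : R -> R^o)) //=; last exact: df.
    rewrite -(deriveE w (df x Ux)) -[X in 'd _ _ X]mulr1 linearZ /=.
    by rewrite -(deriveE (1 : R^o) ds) derive_val.
  split=> [x /key[]//|v].
  have [h s E] := Df v; exists (fun x => h x * (2 * Num.sqrt (f x))^-1).
    apply: SmoothMul => //; apply: SmoothInv.
      by apply: SmoothMul; [exact: SmoothCst|exact: SmoothSqrt].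
    by move=> x /f0 fx; rewrite mulf_neq0 // gt_eqF // sqrtr_gt0.
  by move=> x Ux; rewrite (key x Ux).2 E.
- move=> p W g F oW sg sF IH FW.
  have dF x : U x -> differentiable F x.
    by move=> Ux; apply: differentiable_rV => j; exact: (IH j).1.
  have dg x : U x -> differentiable g (F x).
    by move=> Ux; apply: smooth_differentiable sg _; exact: FW.
  split=> [x Ux|v].
    by apply: (differentiable_comp (f := F) (g := g)); [exact: dF|exact: dg].
  have {}IH j := (IH j).2 v.
  have {IH}/choice[h hP] : forall j, exists h, smooth_expr U h /\
      forall x, U x -> 'D_v (fun y => F y 0 j) x = h x.
    by move=> j; have [h] := IH j; exists h.
  exists (fun x => \sum_j h j x * 'D_(delta_mx 0 j) g (F x)).
    apply: smooth_expr_sum => j; apply: SmoothMul; first by have [] := hP j.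
    by apply: (@SmoothComp _ _ _ W ('D_(delta_mx 0 j) g) F) => //; exact: smooth_derive.
  move=> x Ux; rewrite (derive_chain (F := F) (g := g)); [|exact: dF|exact: dg].
  rewrite derive_basis; last exact: dg.
  apply: eq_bigr => j _; rewrite derive_coord; last exact: dF.
  by have [_ ->] := hP j.
Qed.

Lemma smooth_exprP m (U : set 'rV[R]_m) f : smooth_expr U f -> smooth_on U f.
Proof. by move=> sf; exists (smooth_expr U) => //; exact: smooth_expr_closed. Qed.

Lemma smooth_cst m (U : set 'rV[R]_m) c : smooth_on U (fun=> c).
Proof. exact/smooth_exprP/SmoothCst. Qed.

Lemma smooth_add m (U : set 'rV[R]_m) f g :
  smooth_on U f -> smooth_on U g -> smooth_on U (fun x => f x + g x).
Proof. by move=> sf sg; apply/smooth_exprP/SmoothAdd; exact: SmoothBase. Qed.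

Lemma smooth_mul m (U : set 'rV[R]_m) f g :
  smooth_on U f -> smooth_on U g -> smooth_on U (fun x => f x * g x).
Proof. by move=> sf sg; apply/smooth_exprP/SmoothMul; exact: SmoothBase. Qed.

Lemma smooth_opp m (U : set 'rV[R]_m) f :
  smooth_on U f -> smooth_on U (fun x => - f x).
Proof.
by move=> sf; under eq_fun do rewrite -mulN1r; apply: smooth_mul => //; exact: smooth_cst.
Qed.

Lemma smooth_sub m (U : set 'rV[R]_m) f g :
  smooth_on U f -> smooth_on U g -> smooth_on U (fun x => f x - g x).
Proof. by move=> sf sg; apply: smooth_add => //; exact: smooth_opp. Qed.

Lemma smooth_exp m (U : set 'rV[R]_m) f n :
  smooth_on U f -> smooth_on U (fun x => f x ^+ n).
Proof.
move=> sf; elim: n => [|n IH]; first exact: smooth_cst.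
by under eq_fun do rewrite exprS; exact: smooth_mul.
Qed.

Lemma smooth_inv m (U : set 'rV[R]_m) f : smooth_on U f ->
  (forall x, U x -> f x != 0) -> smooth_on U (fun x => (f x)^-1).
Proof. by move=> sf f0; apply/smooth_exprP/SmoothInv => //; exact: SmoothBase. Qed.

Lemma smooth_sqrt m (U : set 'rV[R]_m) f : smooth_on U f ->
  (forall x, U x -> 0 < f x) -> smooth_on U (fun x => Num.sqrt (f x)).
Proof. by move=> sf f0; apply/smooth_exprP/SmoothSqrt => //; exact: SmoothBase. Qed.

Lemma smooth_comp m p (U : set 'rV[R]_m) (W : set 'rV[R]_p) g F : open W ->
  smooth_on W g -> smooth_map U F -> (forall x, U x -> W (F x)) ->
  smooth_on U (fun x => g (F x)).
Proof.
move=> oW sg sF FW; apply/smooth_exprP/(SmoothComp oW sg) => // j.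
exact: SmoothBase.
Qed.

Lemma smooth_sum m (U : set 'rV[R]_m) (I : Type) (r : seq I) (P : pred I)
    (h : I -> 'rV[R]_m -> R) :
  (forall i, smooth_on U (h i)) -> smooth_on U (fun x => \sum_(i <- r | P i) h i x).
Proof.
move=> H; elim: r => [|i r IH].
  by under eq_fun do rewrite big_nil; exact: smooth_cst.
by under eq_fun do rewrite big_cons; case: (P i) => //; exact: smooth_add.
Qed.

Lemma smooth_prod m (U : set 'rV[R]_m) (I : Type) (r : seq I) (P : pred I)
    (h : I -> 'rV[R]_m -> R) :
  (forall i, smooth_on U (h i)) -> smooth_on U (fun x => \prod_(i <- r | P i) h i x).
Proof.
move=> H; elim: r => [|i r IH].
  by under eq_fun do rewrite big_nil; exact: smooth_cst.
by under eq_fun do rewrite big_cons; case: (P i) => //; exact: smooth_mul.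
Qed.

Lemma smooth_coord m (U : set 'rV[R]_m) i : smooth_on U (fun x => x 0 i).
Proof.
exists [set f | smooth_expr U f \/ f = (fun x => x 0 i)]; first by right.
move=> g [/smooth_expr_closed[df Df]|->].
  by split=> // v; have [h sh hE] := Df v; exists h => //; left.
split=> [x _|v]; first exact: differentiable_coord.
exists (fun=> v 0 i); first by left; exact: SmoothCst.
move=> x _; rewrite -(derive_coord (F := id)) ?derive_id //.
Qed.

Lemma smooth_det m (U : set 'rV[R]_m) n (A : 'rV[R]_m -> 'M[R]_n) :
  (forall i j, smooth_on U (fun x => A x i j)) -> smooth_on U (fun x => \det (A x)).
Proof.
move=> sA; rewrite /determinant; apply: smooth_sum => s.
apply: smooth_mul; first exact: smooth_cst.
exact: smooth_prod.
Qed.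

(** The components of maps that are [Ck] for every k on U form a class stable under directional
    derivatives, since U does not shrink with k. Conversely, [smooth_derive] feeds an induction on
    k. *)
Lemma Ck_smooth m n (U : set 'rV[R]_m) (F : 'rV[R]_m -> 'rV[R]_n) : open U ->
  (forall k, Ck k U F) <-> smooth_map U F.
Proof.
move=> oU; split=> [CF j|sF k].
  exists [set g | exists2 F : 'rV[R]_m -> 'rV[R]_n, forall k, Ck k U F
     & g = fun x => F x 0 j]; first by exists F.
  move=> g [{CF}F CF ->]; have dF := (CF 1).1.
  split=> [x Ux|v]; first by apply: differentiable_comp_coord; exact: dF.
  exists (fun x => ('D_v F x) 0 j); last by move=> x /dF dFx; rewrite derive_coord.
  by exists ('D_v F) => // k; exact: (CF k.+1).2.
elim: k F sF => [|k IH] F sF.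
  move=> x Ux; apply: differentiable_continuous; apply: differentiable_rV => j.
  exact: smooth_differentiable (sF j) Ux.
have dF x : U x -> differentiable F x.
  by move=> Ux; apply: differentiable_rV => j; exact: smooth_differentiable (sF j) Ux.
split=> // v; apply: IH => j.
apply: (@smooth_eq_on _ _ ('D_v (fun x => F x 0 j))) => //.
  by move=> x /dF dFx; rewrite derive_coord.
exact: smooth_derive.
Qed.

Lemma derive_translate m (f : 'rV[R]_m -> R) u v x :
  'D_u (f \o (fun y => y + v)) x = 'D_u f (x + v).
Proof.
have E (h : R) : ((f \o (fun y => y + v)) \o shift x) (h *: u) =
    (f \o shift (x + v)) (h *: u) by rewrite /= addrA.
by rewrite /derive; under eq_fun do rewrite E.
Qed.

(** The mean value theorem is used twice: along u for f(y + v) - f(y), then along v for the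
    derivative of f along u. *)
Lemma second_difference m (U : set 'rV[R]_m) f x u v : open U -> smooth_on U f ->
  (forall a b, 0 <= a <= 1 -> 0 <= b <= 1 -> U (x + a *: u + b *: v)) ->
  exists a b, [/\ 0 <= a <= 1, 0 <= b <= 1 &
    f (x + u + v) - f (x + u) - f (x + v) + f x =
      'D_v ('D_u f) (x + a *: u + b *: v)].
Proof.
move=> oU sf box.
have I0 : 0 <= (0 : R) <= 1 by apply/andP; split; [exact: lexx|exact: ler01].
have I1 : 0 <= (1 : R) <= 1 by apply/andP; split; [exact: ler01|exact: lexx].
have df a b : 0 <= a <= 1 -> 0 <= b <= 1 -> differentiable f (x + a *: u + b *: v).
  by move=> ha hb; apply: smooth_differentiable sf _; exact: box.
pose g y := f (y + v) - f y.
have dl a : differentiable (fun y : 'rV[R]_m => y + v) a by [].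
have dg a : 0 <= a <= 1 -> differentiable g (x + a *: u) /\
   'D_u g (x + a *: u) = 'D_u f (x + a *: u + v) - 'D_u f (x + a *: u).
  move=> ha; have d1 := df a 1 ha I1; have d0 := df a 0 ha I0.
  rewrite scale0r addr0 in d0; rewrite scale1r in d1.
  have d2 : differentiable (f \o (fun y : 'rV[R]_m => y + v)) (x + a *: u).
    exact: differentiable_comp.
  split; first by apply: (differentiableB (f := f \o (fun y => y + v) : _ -> R^o)).
  rewrite (deriveB (f := f \o (fun y => y + v) : _ -> R^o)); try exact: diff_derivable.
  by rewrite derive_translate.
have [t|t|t tI E] := @MVT_line _ _ g x u.
- by move=> /andP[t0 t1]; apply: (dg t _).1; rewrite !ltW.
- move=> tI; apply: (differentiable_continuous (f := g : _ -> R^o)).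
  exact: (dg t _).1.
have tI' : 0 <= t <= 1 by case/andP: tI => t0 t1; rewrite !ltW.
move: E; rewrite (dg t tI').2 => E.
have sD := smooth_derive u oU sf.
have [s|s|s sI E2] := @MVT_line _ _ ('D_u f) (x + t *: u) v.
- move=> /andP[s0 s1]; apply: smooth_differentiable sD _.
  by apply: box => //; rewrite !ltW.
- by move=> sI; apply: smooth_continuous sD _; exact: box.
exists t, s; split=> //; first by case/andP: sI => s0 s1; rewrite !ltW.
by rewrite -E2 -E /g opprD opprK addrA.
Qed.

Lemma derive2_scale m (U : set 'rV[R]_m) f x a b u v : open U -> smooth_on U f ->
  U x -> 'D_(a *: u) ('D_(b *: v) f) x = a * b * 'D_u ('D_v f) x.
Proof.
move=> oU sf Ux; have sD := smooth_derive v oU sf.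
have dD := smooth_differentiable sD Ux.
rewrite (near_eq_derive (g := b \*: ('D_v f : _ -> R^o))); last first.
  apply: (open_near oU Ux) => y Uy /=.
  by rewrite derive_scale //; exact: smooth_differentiable sf Uy.
rewrite derive_scale; last exact: (differentiableZ (f := 'D_v f : _ -> R^o)).
rewrite (deriveZ (f := 'D_v f : _ -> R^o)); last exact: diff_derivable.
by rewrite mulrA.
Qed.

(** Schwarz's theorem: the second difference is symmetric in u and v, so one mixed derivative at a
    point p equals the other at a point q, both points being arbitrarily close to x; continuity
    brings both to x. *)
Lemma derive_comm m (U : set 'rV[R]_m) f x u v : open U -> smooth_on U f -> U x ->
  'D_u ('D_v f) x = 'D_v ('D_u f) x.
Proof.
move=> oU sf Ux.
have cvu := smooth_continuous (smooth_derive v oU (smooth_derive u oU sf)) Ux.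
have cuv := smooth_continuous (smooth_derive u oU (smooth_derive v oU sf)) Ux.
have : nbhs x U by exact: open_nbhs_nbhs.
move=> /nbhs_ballP[r0 /= r00 rU].
apply/eqP/negP => /negP ne.
set e := `|'D_u ('D_v f) x - 'D_v ('D_u f) x| / 2.
have e0 : 0 < e by rewrite divr_gt0 // normr_gt0 subr_eq0.
have /cvgrPdist_lt/(_ e e0)/nbhs_ballP[r1 /= r10 H1] := cvu.
have /cvgrPdist_lt/(_ e e0)/nbhs_ballP[r2 /= r20 H2] := cuv.
pose r := Num.min r0 (Num.min r1 r2).
have rpos : 0 < r by rewrite !lt_min r00 r10 r20.
have den : 0 < `|u| + `|v| + 1 by rewrite ltr_wpDl // addr_ge0.
have [s s0 sr] : exists2 s, 0 < s & s * (`|u| + `|v| + 1) < r.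
  exists (r / 2 / (`|u| + `|v| + 1)); first by rewrite !divr_gt0.
  by rewrite divfK ?gt_eqF // ltr_pdivrMr // ltr_pMr // ltr1n.
have small (w1 w2 : 'rV[R]_m) a b : 0 <= a <= 1 -> 0 <= b <= 1 ->
    `|w1| + `|w2| <= `|u| + `|v| -> ball x r (x + a *: (s *: w1) + b *: (s *: w2)).
  move=> /andP[a0 a1] /andP[b0 b1] ww; rewrite -ball_normE /ball_ /=.
  rewrite -addrA opprD addrA subrr add0r normrN.
  apply: le_lt_trans (ler_normD _ _) _; rewrite !normrZ.
  rewrite (ger0_norm a0) (ger0_norm b0) (gtr0_norm s0).
  apply: (@le_lt_trans _ _ (s * `|w1| + s * `|w2|)).
    by apply: lerD; rewrite ler_piMl // mulr_ge0 // ltW.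
  rewrite -mulrDr; apply: (@lt_trans _ _ (s * (`|u| + `|v| + 1))).
    by rewrite ltr_pM2l // (le_lt_trans ww) // ltrDl.
  by [].
have bU y : ball x r y -> [/\ U y, ball x r1 y & ball x r2 y].
  move=> xy; split; [apply: rU| |]; apply: le_ball xy;
  by rewrite /r !ge_min lexx ?orbT.
have vu : `|v| + `|u| <= `|u| + `|v| by rewrite addrC.
have [a [b [ha hb E1]]] := second_difference oU sf
  (fun a b ha hb => let: And3 h _ _ := bU _ (small u v a b ha hb (lexx _)) in h).
have [c [d [hc hd E2]]] := second_difference oU sf
  (fun a b ha hb => let: And3 h _ _ := bU _ (small v u a b ha hb vu) in h).
have [Up p1 _] := bU _ (small u v a b ha hb (lexx _)).
have [Uq _ q2] := bU _ (small v u c d hc hd vu).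
rewrite (derive2_scale _ _ _ _ oU sf Up) in E1.
rewrite (derive2_scale _ _ _ _ oU sf Uq) in E2.
have ss : s * s != 0 by rewrite mulf_neq0 // gt_eqF.
have E : 'D_v ('D_u f) (x + a *: (s *: u) + b *: (s *: v)) =
         'D_u ('D_v f) (x + c *: (s *: v) + d *: (s *: u)).
  apply: (mulfI (x := s * s) ss); apply: etrans (esym E1) _; apply: etrans _ E2.
  rewrite (_ : x + s *: v + s *: u = x + s *: u + s *: v); last exact: addrAC.
  by congr (_ + _); exact: addrAC.
have := H1 _ p1; have := H2 _ q2; rewrite /= -E => h2 h1.
suff : `|'D_u ('D_v f) x - 'D_v ('D_u f) x| < e + e by rewrite -splitr ltxx.
rewrite distrC in h1; apply: le_lt_trans (ltrD h2 h1).
exact: ler_distD.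
Qed.

(** If v leaves the hyperplane through x, the open segment from x to x + v avoids it, and the mean
    value theorem reduces the increment of F to values of the G j, which are continuous at x. This
    is how differentiability is proved for functions given by different formulas on and off a
    hyperplane. *)
Lemma removable_hyperplane m (i : 'I_m) (F : 'rV[R]_m -> R)
    (G : 'I_m -> 'rV[R]_m -> R) (x : 'rV[R]_m) :
  (\forall y \near x, {for y, continuous F}) ->
  (\forall y \near x, (y : 'rV[R]_m) 0 i != x 0 i -> differentiable F y /\
      forall j, 'D_(delta_mx 0 j) F y = G j y) ->
  (forall j, {for x, continuous (G j)}) ->
  differentiable F x /\ forall v, 'D_v F x = \sum_j v 0 j * G j x.
Proof.
move=> cF dF cG.
suff : differentiable F x /\ forall v, 'D_v F x = dot (\row_j G j x) v.
  move=> [? E]; split=> // v; rewrite E /dot; apply: eq_bigr => j _.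
  by rewrite mxE mulrC.
apply: diff_of_bound => e e0.
have e'0 : 0 < e / m.+1%:R by rewrite divr_gt0.
have : \forall y \near x, forall j, `|G j x - G j y| < e / m.+1%:R.
  apply: (filter_forall (F := nbhs x) (f := fun j y => `|G j x - G j y| < e / m.+1%:R)).
  by move=> j; have /cvgrPdist_lt/(_ _ e'0) := cG j.
move=> /(filterI dF)/(filterI cF)/nbhs_ballP[r /= r0 H].
have main (v : 'rV[R]_m) : `|v| < r -> v 0 i != 0 ->
    `|F (v + x) - F x - dot (\row_j G j x) v| <= e * `|v|.
  move=> vr vi0.
  have inb (t : R) : 0 <= t <= 1 -> ball x r (x + t *: v).
    move=> /andP[t0 t1]; rewrite -ball_normE /ball_ /= opprD addrA subrr add0r normrN.
    by rewrite normrZ ger0_norm // (le_lt_trans _ vr) // ler_piMl.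
  have offh (t : R) : 0 < t < 1 -> (x + t *: v) 0 i != x 0 i.
    move=> /andP[t0 _]; rewrite !mxE -subr_eq0 addrAC subrr add0r.
    by rewrite mulf_neq0 // gt_eqF.
  have tI (t : R) : 0 < t < 1 -> 0 <= t <= 1 by move=> /andP[? ?]; rewrite !ltW.
  have [t ht|t ht|t ht E] := @MVT_line _ _ F x v.
  - by have [_ [/(_ (offh t ht))[]]] := H _ (inb t (tI t ht)).
  - by have [] := H _ (inb t ht).
  have [_ [/(_ (offh t ht))[dy Dy] Gy]] := H _ (inb t (tI t ht)).
  rewrite [v + x]addrC E derive_basis // /dot -sumrB.
  apply: le_trans (ler_norm_sum _ _ _) _.
  apply: (@le_trans _ _ (\sum_(j < m) e / m.+1%:R * `|v|)).
    apply: ler_sum => j _; rewrite Dy mxE mulrC -mulrBl normrM.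
    by apply: ler_pM => //; [rewrite distrC ltW | exact: coord_le_norm].
  rewrite -mulr_suml sumr_const card_ord ler_wpM2r // -[leLHS]mulr_natr.
  rewrite -mulrA ler_piMr ?(ltW e0) // ler_pdivrMl // mulr1 ler_nat //.
have near0 : \forall v \near (0 : 'rV[R]_m), `|v| < r by exact: nbhs0_lt.
apply: filterS near0 => v vr.
have [vi0|] := eqVneq (v 0 i) 0; last exact: main.
(* A vector v in the hyperplane is a limit of vectors [w s] that leave it; both sides of the bound
   are continuous in s. *)
pose w (s : R) := v + s *: delta_mx 0 i.
have wc : {for 0, continuous w}.
  by apply: (differentiable_continuous (f := w)).
have w0 : w 0 = v by rewrite /w scale0r addr0.
have Fx : {for v + x, continuous F}.
  have [] := H (v + x) _ => //.
  by rewrite -ball_normE /ball_ /= opprD addrCA subrr addr0 normrN.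
pose h s := `|F (w s + x) - F x - dot (\row_j G j x) (w s)| - e * `|w s|.
have wxc : {for 0, continuous (fun s => w s + x)}.
  by apply: continuousD => //; exact: cst_continuous.
have Fc : {for 0, continuous (fun s => F (w s + x))}.
  by apply: (continuous_comp (f := fun s => w s + x) (g := F)); rewrite ?w0.
have dc : {for 0, continuous (fun s => dot (\row_j G j x) (w s))}.
  by apply: (@continuous_comp _ _ _ w (dot (\row_j G j x))); [exact: wc|exact: dot_continuous].
have nc : {for 0, continuous (fun s => `|w s|)} by exact: (cvg_norm wc).
have hc : h s @[s --> 0] --> h 0.
  apply: cvgB; last by apply: cvgMl_tmp; exact: nc.
  apply: cvg_norm; apply: cvgB; last exact: dc.
  by apply: cvgB; [exact: Fc|exact: cvg_cst].
have : h 0 <= 0.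
  have hc' : h s @[s --> 0^'] --> h 0 by exact/continuous_withinNx.
  apply: (cvgr_to_le hc').
  have : \forall s \near (0 : R), `|w s| < r.
    by have /cvgr_lt := nc; apply; rewrite w0.
  move=> wr; rewrite near_withinE; apply: filterS wr => s wr s0.
  rewrite /h subr_le0 main // /w !mxE vi0 add0r !eqxx mulr1.
  exact: s0.
by rewrite /h w0 subr_le0.
Qed.

End SmoothFunctions.

(** * Hadamard's lemma *)

Section Quotient.
Context {R : realType}.

Inductive span m (B : set ('rV[R]_m -> R)) : ('rV[R]_m -> R) -> Prop :=
| SpanBase f : B f -> span B f
| SpanZero : span B (fun=> 0)
| SpanAdd f g : span B f -> span B g -> span B (fun x => f x + g x)
| SpanScale a f : span B f -> span B (fun x => a * f x).

Lemma span_sum m (B : set ('rV[R]_m -> R)) (I : Type) (r : seq I)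
    (h : I -> 'rV[R]_m -> R) :
  (forall i, span B (h i)) -> span B (fun x => \sum_(i <- r) h i x).
Proof.
move=> H; elim: r => [|i r IH].
  by under eq_fun do rewrite big_nil; exact: SpanZero.
by under eq_fun do rewrite big_cons; exact: SpanAdd.
Qed.

(** The span of B is a class stable under directional derivatives. Partial derivatives of members
    need not be members, only combinations of members, as happens for the Taylor quotients below. *)
Lemma smooth_family m (U : set 'rV[R]_m) (B : set ('rV[R]_m -> R)) :
  (forall b, B b -> (forall x, U x -> differentiable b x) /\
     forall j, exists2 h, span B h & forall x, U x -> 'D_(delta_mx 0 j) b x = h x) ->
  forall b, B b -> smooth_on U b.
Proof.
move=> HB b Bb; exists (span B); first exact: SpanBase.
move=> g; elim=> {g b Bb}.
- move=> b /HB[db Db]; split=> // v.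
  have /choice[h hP] : forall j, exists h, span B h /\
      forall x, U x -> 'D_(delta_mx 0 j) b x = h x.
    by move=> j; have [h] := Db j; exists h.
  exists (fun x => \sum_j v 0 j * h j x).
    by apply: span_sum => j; apply: SpanScale; have [] := hP j.
  move=> x Ux; rewrite derive_basis; last exact: db.
  by apply: eq_bigr => j _; have [_ ->] := hP j.
- split=> [x _|v]; first exact: differentiable_cst.
  by exists (fun=> 0); [exact: SpanZero|move=> x _; rewrite derive_cst].
- move=> f g sf [df Df] sg [dg Dg]; split=> [x Ux|v].
    by apply: (differentiableD (f := f : _ -> R^o)); [exact: df|exact: dg].
  have [h1 s1 E1] := Df v; have [h2 s2 E2] := Dg v.
  exists (fun x => h1 x + h2 x); first exact: SpanAdd.
  move=> x Ux; rewrite -E1 // -E2 //.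
  by rewrite (deriveD (f := f : _ -> R^o)) //; apply: diff_derivable; [exact: df|exact: dg].
- move=> a f sf [df Df]; split=> [x Ux|v].
    by apply: (differentiableZ (f := f : _ -> R^o)); exact: df.
  have [h1 s1 E1] := Df v.
  exists (fun x => a * h1 x); first exact: SpanScale.
  move=> x Ux; rewrite -E1 //.
  by rewrite (deriveZ (f := f : _ -> R^o)) //; apply: diff_derivable; exact: df.
Qed.

Lemma derive_smoothD m (U : set 'rV[R]_m) f g x v : smooth_on U f -> smooth_on U g ->
  U x -> 'D_v (fun y => f y + g y) x = 'D_v f x + 'D_v g x.
Proof.
move=> sf sg Ux; rewrite (deriveD (f := f : _ -> R^o)) //; apply: diff_derivable.
  exact: smooth_differentiable sf Ux.
exact: smooth_differentiable sg Ux.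
Qed.

Lemma derive_smoothM m (U : set 'rV[R]_m) f g x v : smooth_on U f -> smooth_on U g ->
  U x -> 'D_v (fun y => f y * g y) x = f x * 'D_v g x + g x * 'D_v f x.
Proof.
move=> sf sg Ux; rewrite (deriveM (f := f)) //; apply: diff_derivable.
  exact: smooth_differentiable sf Ux.
exact: smooth_differentiable sg Ux.
Qed.

Lemma derive_smoothB m (U : set 'rV[R]_m) f g x v : smooth_on U f -> smooth_on U g ->
  U x -> 'D_v (fun y => f y - g y) x = 'D_v f x - 'D_v g x.
Proof.
move=> sf sg Ux; rewrite (deriveB (f := f : _ -> R^o)) //; apply: diff_derivable.
  exact: smooth_differentiable sf Ux.
exact: smooth_differentiable sg Ux.
Qed.

Lemma derive_smoothZ m (U : set 'rV[R]_m) a f x v : smooth_on U f ->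
  U x -> 'D_v (fun y => a * f y) x = a * 'D_v f x.
Proof.
move=> sf Ux; rewrite (deriveZ (f := f : _ -> R^o)) //; apply: diff_derivable.
exact: smooth_differentiable sf Ux.
Qed.

Lemma derive_cst0 m (c : R) (x v : 'rV[R]_m) : 'D_v (fun=> c) x = 0.
Proof. by rewrite derive_cst. Qed.

Lemma derive_proj m (i : 'I_m) (x v : 'rV[R]_m) : 'D_v (fun y : 'rV[R]_m => y 0 i) x = v 0 i.
Proof. by rewrite -(derive_coord (F := id)) ?derive_id. Qed.

Lemma derive_smoothX m (U : set 'rV[R]_m) f n x v : smooth_on U f ->
  U x -> 'D_v (fun y => f y ^+ n) x = n%:R * f x ^+ n.-1 * 'D_v f x.
Proof.
move=> sf Ux; elim: n => [|n IH].
  by under eq_fun do rewrite expr0; rewrite derive_cst0 !mul0r.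
under eq_fun do rewrite exprS.
rewrite (derive_smoothM v sf (smooth_exp n sf) Ux) IH /=.
case: n {IH} => [|n] /=; first by rewrite expr0 mulr0n mulr1n !mul0r mulr0 add0r !mul1r.
by rewrite exprS -[n.+2%:R]natr1; ring.
Qed.

Lemma eq_derive_on m (U : set 'rV[R]_m) (f g : 'rV[R]_m -> R) x v : open U -> U x ->
  (forall y, U y -> f y = g y) -> 'D_v f x = 'D_v g x.
Proof. by move=> oU Ux fg; apply: near_eq_derive; exact: open_near fg. Qed.

Variables (m : nat) (i : 'I_m) (r : R).
Hypothesis r0 : 0 < r.
Local Notation V := 'rV[R]_m.
Let U : set V := ball (0 : V) r.
Implicit Types (G : V -> R) (x : V).

Let oU : open U. Proof. exact: ball_open. Qed.

Definition flat x : V := x - x 0 i *: delta_mx 0 i.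

Lemma flat_coord x j : flat x 0 j = if j == i then 0 else x 0 j.
Proof.
by rewrite !mxE eqxx /=; case: eqVneq => [->|_]; rewrite ?mulr1 ?subrr ?mulr0 ?subr0.
Qed.

Lemma flat_id x : x 0 i = 0 -> flat x = x.
Proof. by rewrite /flat => ->; rewrite scale0r subr0. Qed.

Lemma norm_flat x : `|flat x| <= `|x|.
Proof.
apply: norm_rV_le => // j; rewrite flat_coord; case: ifP => _; last exact: coord_le_norm.
by rewrite normr0.
Qed.

Lemma ballP x : U x <-> `|x| < r.
Proof. by rewrite /U -ball_normE /ball_ /= sub0r normrN. Qed.

Lemma flat_ball x : U x -> U (flat x).
Proof. by move=> /ballP xr; apply/ballP; exact: le_lt_trans (norm_flat x) xr. Qed.

Lemma smooth_flat j : smooth_on U (fun x => flat x 0 j).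
Proof.
under eq_fun do rewrite flat_coord.
by case: eqP => _; [exact: smooth_cst|exact: smooth_coord].
Qed.

Lemma derive_flat G x j : smooth_on U G -> U x ->
  'D_(delta_mx 0 j) (fun y => G (flat y)) x =
    if j == i then 0 else 'D_(delta_mx 0 j) G (flat x).
Proof.
move=> sG Ux.
have df : differentiable flat x.
  apply: differentiable_rV => k; exact: smooth_differentiable (smooth_flat k) Ux.
rewrite (derive_chain (F := flat)) //; last first.
  by apply: smooth_differentiable sG _; exact: flat_ball.
have -> : 'D_(delta_mx 0 j) flat x = if j == i then 0 else delta_mx 0 j.
  apply/rowP => k; rewrite derive_coord //.
  under eq_fun do rewrite flat_coord.
  case: (eqVneq k i) => [->|ki].
    rewrite derive_cst0; case: (eqVneq j i) => [_|ji]; rewrite !mxE //=.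
    by rewrite eq_sym (negPf ji).
  rewrite derive_proj mxE /=; case: (eqVneq j i) => [->|ji]; rewrite !mxE //=.
  by rewrite (negPf ki).
by case: eqP => // _; rewrite derive0.
Qed.

Local Notation "'di' G" := ('D_(delta_mx 0 i) G) (at level 10, G at level 8).

(** The coefficient of x_i^n in Taylor's formula along the i-th axis, based at the projection
    [flat x]: the inverse factors accumulate to 1/n!. *)
Fixpoint tcoef n G : V -> R :=
  if n is n'.+1 then fun x => n%:R^-1 * tcoef n' (di G) x else fun x => G (flat x).

Definition trem n G x := G x - \sum_(k < n) tcoef k G x * x 0 i ^+ k.

(** All orders are kept because the derivative along the i-th axis of the quotient of order n
    involves the quotient of order n + 1; only the whole family is closed under partial derivatives,
    up to linear combinations. *)
Definition tquot n G x := if x 0 i == 0 then tcoef n G x else trem n G x / x 0 i ^+ n.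

Lemma tcoef_eq_on n G H x : (forall y, U y -> G y = H y) -> U x ->
  tcoef n G x = tcoef n H x.
Proof.
elim: n G H => [|n IH] G H GH Ux /=; first by apply: GH; exact: flat_ball.
by rewrite (IH _ (di H)) // => y Uy; apply: (eq_derive_on _ oU).
Qed.

Lemma smooth_di G j : smooth_on U G -> smooth_on U ('D_(delta_mx 0 j) G).
Proof. exact: smooth_derive. Qed.

Lemma smooth_tcoef n G : smooth_on U G -> smooth_on U (tcoef n G).
Proof.
elim: n G => [|n IH] G sG /=.
  by apply: (smooth_comp oU sG) => [j|x]; [exact: smooth_flat|exact: flat_ball].
by apply: smooth_mul; [exact: smooth_cst|apply: IH; exact: smooth_di].
Qed.

Lemma derive_tcoef n G x j : smooth_on U G -> U x ->
  'D_(delta_mx 0 j) (tcoef n G) x =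
    if j == i then 0 else tcoef n ('D_(delta_mx 0 j) G) x.
Proof.
elim: n G => [|n IH] G sG Ux /=; first exact: derive_flat.
rewrite (derive_smoothZ _ _ (smooth_tcoef n (smooth_di i sG)) Ux).
rewrite IH //; last exact: smooth_di.
case: eqP => _; first by rewrite mulr0.
have E y : U y -> 'D_(delta_mx 0 j) (di G) y = di ('D_(delta_mx 0 j) G) y.
  exact: derive_comm oU sG.
exact: (congr1 (fun z => n.+1%:R^-1 * z) (tcoef_eq_on n E Ux)).
Qed.

Lemma smooth_trem n G : smooth_on U G -> smooth_on U (trem n G).
Proof.
move=> sG; apply: smooth_sub => //; apply: smooth_sum => k.
by apply: smooth_mul; [exact: smooth_tcoef|apply: smooth_exp; exact: smooth_coord].
Qed.

Lemma trem0 G : trem 0 G = G.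
Proof. by apply/funext => x; rewrite /trem big_ord0 subr0. Qed.

Lemma tremS n G x : trem n.+1 G x = trem n G x - tcoef n G x * x 0 i ^+ n.
Proof. by rewrite /trem big_ord_recr /= opprD addrA. Qed.

Lemma derive_trem n G x j : smooth_on U G -> U x ->
  'D_(delta_mx 0 j) (trem n G) x = trem n ('D_(delta_mx 0 j) G) x +
     (if j == i then n%:R * (tcoef n G x * x 0 i ^+ n.-1) else 0).
Proof.
move=> sG Ux; elim: n => [|n IH].
  by rewrite !trem0; case: eqP => _; rewrite ?mul0r addr0.
have -> : trem n.+1 G = fun x => trem n G x - tcoef n G x * x 0 i ^+ n.
  by apply/funext => y; rewrite tremS.
have sX k := smooth_exp k (smooth_coord U i).
rewrite (derive_smoothB _ (smooth_trem n sG) (smooth_mul (smooth_tcoef n sG) (sX n)) Ux).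
rewrite (derive_smoothM _ (smooth_tcoef n sG) (sX n) Ux).
rewrite (derive_smoothX _ _ (smooth_coord U i) Ux) derive_proj IH derive_tcoef // tremS.
case: (eqVneq j i) => [->|ji]; rewrite mxE /=.
  rewrite !eqxx mulr0 mulr1 addr0 [in RHS]mulrA mulVKf ?pnatr_eq0 //.
  by ring.
by rewrite [i == j]eq_sym (negPf ji) mulr0n; ring.
Qed.

Lemma derive_tremS n G x : smooth_on U G -> U x ->
  'D_(delta_mx 0 i) (trem n.+1 G) x = trem n (di G) x.
Proof.
move=> sG Ux; rewrite derive_trem // eqxx tremS /= mulrA mulVKf ?pnatr_eq0 //.
by rewrite subrK.
Qed.

(** Peano's form of the remainder, uniform for base points near x0, by induction on n: along the
    i-th axis the derivative of the remainder of order n + 1 is the remainder of order n of the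
    derivative. Uniformity is what makes the quotient continuous at points of the hyperplane. *)
Lemma trem_bound n G x0 : smooth_on U G -> U x0 -> x0 0 i = 0 ->
  forall e, 0 < e -> exists2 d, 0 < d & forall x, ball x0 d x ->
    `|trem n G x - tcoef n G x0 * x 0 i ^+ n| <= e * `|x 0 i| ^+ n.
Proof.
move=> + Ux0 xi0; elim: n G => [|n IH] G sG e e0.
  have /cvgrPdist_lt/(_ e e0)/nbhs_ballP[d /= d0 H] := smooth_continuous sG Ux0.
  exists d => // x /H /=; rewrite trem0 /= !expr0 !mulr1 flat_id // distrC.
  exact: ltW.
have [d1 d10 H] := IH _ (smooth_di i sG) e e0.
have : nbhs x0 U by exact: open_nbhs_nbhs.
move=> /nbhs_ballP[d2 /= d20 dU].
exists (Num.min d1 d2); first by rewrite lt_min d10.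
move=> x xd.
(* The segment from [flat x] to x stays in any ball around x0 that contains x, as x0 lies on the
   hyperplane and the norm is the maximum of the coordinates. *)
pose y t := flat x + t *: (x 0 i *: delta_mx 0 i).
have yi t : y t 0 i = t * x 0 i by rewrite mxE flat_coord eqxx add0r !mxE !eqxx mulr1.
have nE (a b : V) k : (a - b) 0 k = a 0 k - b 0 k by rewrite !mxE.
have yj t j : j != i -> y t 0 j = x 0 j.
  move=> ji; rewrite mxE flat_coord (negPf ji) !mxE eqxx (negPf ji) /=.
  by rewrite !mulr0 addr0.
have yball (t : R) : 0 <= t <= 1 -> ball x0 (Num.min d1 d2) (y t).
  move=> /andP[t0 t1]; move: xd; rewrite -ball_normE /ball_ /=; apply: le_lt_trans.
  apply: norm_rV_le => // j; apply: le_trans (coord_le_norm _ j).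
  rewrite !nE.
  case: (eqVneq j i) => [->|ji]; last by rewrite yj.
  by rewrite xi0 yi !sub0r !normrN normrM ger0_norm // ler_piMl.
have yU (t : R) : 0 <= t <= 1 -> U (y t).
  move=> tI; apply: dU; apply: le_ball (yball t tI).
  by rewrite ge_min lexx orbT.
pose h z := trem n.+1 G z - tcoef n.+1 G x0 * z 0 i ^+ n.+1.
have sh : smooth_on U h.
  apply: smooth_sub; first exact: smooth_trem.
  by apply: smooth_mul; [exact: smooth_cst|apply: smooth_exp; exact: smooth_coord].
have tI (t : R) : 0 < t < 1 -> 0 <= t <= 1 by move=> /andP[? ?]; rewrite !ltW.
have [t|t|t ht E] := @MVT_line _ _ h (flat x) (x 0 i *: delta_mx 0 i).
- by move=> /tI/yU; exact: smooth_differentiable sh.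
- by move=> /yU; exact: smooth_continuous sh.
have {}ht := tI t ht.
have h0 : h (flat x) = 0.
  rewrite /h /trem flat_coord eqxx expr0n /= mulr0 subr0 big_ord_recl expr0 mulr1 /=.
  rewrite big1 ?addr0; last by move=> k _; rewrite /bump /= exprS mul0r mulr0.
  by rewrite [flat (flat x)]flat_id ?subrr // flat_coord eqxx.
have yx : flat x + x 0 i *: delta_mx 0 i = x by rewrite /flat subrK.
move: E; rewrite yx h0 subr0 derive_scale; last first.
  by apply: smooth_differentiable sh _; exact: yU.
have sX k := smooth_exp k (smooth_coord U i).
rewrite -/(y t) /h => ->.
rewrite (derive_smoothB _ (smooth_trem _ sG) (smooth_mul (smooth_cst U _) (sX _)) (yU t ht)).
rewrite (derive_smoothZ _ _ (sX _) (yU t ht)).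
rewrite (derive_smoothX _ _ (smooth_coord U i) (yU t ht)) derive_proj.
rewrite [delta_mx 0 i 0 i]mxE !eqxx derive_tremS //; last exact: yU.
have -> : x 0 i * (trem n (di G) (y t) -
    tcoef n.+1 G x0 * (n.+1%:R * y t 0 i ^+ n.+1.-1 * 1)) =
  x 0 i * (trem n (di G) (y t) - tcoef n (di G) x0 * y t 0 i ^+ n).
  by rewrite /= mulr1 [_^-1 * _]mulrC -!mulrA mulKf ?pnatr_eq0.
rewrite normrM exprS [leRHS]mulrCA ler_wpM2l //.
apply: (@le_trans _ _ (e * `|y t 0 i| ^+ n)).
  by apply: H; apply: le_ball (yball t ht); rewrite ge_min lexx.
rewrite ler_wpM2l ?(ltW e0) // lerXn2r ?nnegrE // yi normrM.
by case/andP: ht => t0 t1; rewrite ger0_norm // ler_piMl.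
Qed.

Lemma tquot_continuous n G x : smooth_on U G -> U x -> {for x, continuous (tquot n G)}.
Proof.
move=> sG Ux; have [xi0|xi0] := eqVneq (x 0 i) 0; last first.
  have ci : {for x, continuous (fun y : V => y 0 i)} by exact: coord_continuous.
  have near0 : \forall y \near x, (y : V) 0 i != 0.
    by apply: (ci [set z | z != 0]); apply: open_nbhs_nbhs; split => //; exact: open_neq.
  have cq : {for x, continuous (fun y : V => trem n G y / y 0 i ^+ n)}.
    apply: continuousM; first exact: smooth_continuous (smooth_trem n sG) Ux.
    apply: continuousV; first by rewrite expf_neq0.
    exact: smooth_continuous (smooth_exp n (smooth_coord U i)) Ux.
  apply: cvg_trans (_ : tquot n G @ x --> trem n G x / x 0 i ^+ n) _; last first.
    by rewrite /tquot (negPf xi0).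
  have E : \forall y \near x, trem n G y / (y : V) 0 i ^+ n = tquot n G y.
    by apply: filterS near0 => y yi; rewrite /tquot (negPf yi).
  exact: cvg_trans (near_eq_cvg E) cq.
have q0 : tquot n G x = tcoef n G x by rewrite /tquot xi0 eqxx.
apply: continuous_dist_le => e e0; rewrite q0.
have [d d0 H] := trem_bound n sG Ux xi0 e0.
have /cvgrPdist_le/(_ e e0) := smooth_continuous (smooth_tcoef n sG) Ux.
have xd : \forall y \near x, ball x d y by exact: nbhsx_ballx.
apply: filterS2 xd => y /H yd yt; rewrite /tquot; case: eqVneq => [//|yi].
rewrite distrC -(@ler_pM2r _ (`|y 0 i| ^+ n)) ?exprn_gt0 ?normr_gt0 //.
by rewrite -normrX -normrM mulrBl divfK ?expf_neq0 // normrX.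
Qed.

Lemma tquot_near n G x v : smooth_on U G -> U x -> x 0 i != 0 ->
  differentiable (tquot n G) x /\
  'D_v (tquot n G) x = 'D_v (fun y : V => trem n G y / y 0 i ^+ n) x.
Proof.
move=> sG Ux xi0.
have ci : {for x, continuous (fun y : V => y 0 i)} by exact: coord_continuous.
have near0 : \forall y \near x, (y : V) 0 i != 0.
  by apply: (ci [set z | z != 0]); apply: open_nbhs_nbhs; split => //; exact: open_neq.
have E : \forall y \near x, trem n G y / (y : V) 0 i ^+ n = tquot n G y.
  by apply: filterS near0 => y yi; rewrite /tquot (negPf yi).
split; last by apply: near_eq_derive; apply: filterS E => y ->.
apply: (differentiable_near_eq E); apply: differentiableM.
  exact: smooth_differentiable (smooth_trem n sG) Ux.
apply: differentiableV; last by rewrite expf_neq0.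
exact: smooth_differentiable (smooth_exp n (smooth_coord U i)) Ux.
Qed.

Lemma derive_tquot_off n G x j : smooth_on U G -> U x -> x 0 i != 0 ->
  'D_(delta_mx 0 j) (tquot n G) x = tquot n ('D_(delta_mx 0 j) G) x
    + (if j == i then - n%:R * tquot n.+1 G x else 0).
Proof.
move=> sG Ux xi0; rewrite (tquot_near _ _ sG Ux xi0).2 {1}/tquot (negPf xi0).
have sX k := smooth_exp k (smooth_coord U i).
have dX := smooth_differentiable (sX n) Ux.
have dt := smooth_differentiable (smooth_trem n sG) Ux.
rewrite (deriveM (f := trem n G)); [|exact: diff_derivable|]; last first.
  by apply: diff_derivable; apply: differentiableV => //; rewrite expf_neq0.
rewrite (deriveV (f := fun y : V => y 0 i ^+ n)) ?expf_neq0 //; last exact: diff_derivable.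
rewrite (derive_smoothX _ _ (smooth_coord U i) Ux) derive_proj derive_trem //.
rewrite mxE eqxx /= eq_sym /GRing.scale /=.
case: (eqVneq j i) => _; last by rewrite !mulr0 !addr0 add0r mulrC.
rewrite /tquot (negPf xi0) tremS !mulr1.
case: n {dX dt} => [|n]; first by rewrite mulr0n !expr0; field.
have k0 : n.+1%:R != 0 :> R by rewrite pnatr_eq0.
have p0 : x 0 i ^+ n != 0 by rewrite expf_neq0.
rewrite [n.+1.-1]/= !exprS; move: n.+1%:R (x 0 i ^+ n) k0 p0 => k p k0 p0.
by field; rewrite xi0 p0.
Qed.

(** Off the hyperplane the partial derivatives are given by the quotient rule; the resulting
    expressions are continuous everywhere, so the hyperplane is removable. *)
Lemma smooth_tquot n G : smooth_on U G -> smooth_on U (tquot n G).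
Proof.
move=> sG.
apply: (@smooth_family _ U [set f | exists n G, smooth_on U G /\ f = tquot n G]); last first.
  by exists n, G.
move=> _ {n sG G} [n [G [sG ->]]].
pose D j := fun x => tquot n ('D_(delta_mx 0 j) G) x
    + (if j == i then - n%:R * tquot n.+1 G x else 0).
have sD j := smooth_di j sG.
have cD j x : U x -> {for x, continuous (D j)}.
  move=> Ux; apply: continuousD; first exact: tquot_continuous.
  case: eqP => _; last exact: cst_continuous.
  by apply: continuousM; [exact: cst_continuous|exact: tquot_continuous].
have key x : U x -> differentiable (tquot n G) x /\
    forall j, 'D_(delta_mx 0 j) (tquot n G) x = D j x.
  move=> Ux; have [xi0|xi0] := eqVneq (x 0 i) 0; last first.
    split=> [|j]; first exact: (tquot_near n 0 sG Ux xi0).1.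
    exact: derive_tquot_off.
  have nU := open_nbhs_nbhs (conj oU Ux).
  have [||j|df Df] := @removable_hyperplane _ _ i (tquot n G) D x.
  - by apply: filterS nU => y; exact: tquot_continuous.
  - apply: filterS nU => y Uy; rewrite xi0 => yi0.
    split=> [|j]; first exact: (tquot_near n 0 sG Uy yi0).1.
    exact: derive_tquot_off.
  - exact: cD.
  split=> // j; rewrite Df (bigD1 j) //= big1 => [|k kj]; rewrite mxE eqxx /=.
    by rewrite eqxx mul1r addr0.
  by rewrite (negPf kj) mul0r.
split=> [x /key[]//|j]; exists (D j); last by move=> x /key[_].
apply: SpanAdd; first by apply: SpanBase; exists n, ('D_(delta_mx 0 j) G).
case: eqP => _; last exact: SpanZero.
by apply: SpanScale; apply: SpanBase; exists n.+1, G.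
Qed.

(** The quotient is [tquot 1 G]. Its value on the hyperplane is recorded in order to divide a second
    time when the derivative of G vanishes there. *)
Lemma hadamard G : smooth_on U G -> (forall x, U x -> x 0 i = 0 -> G x = 0) ->
  exists2 q, smooth_on U q & forall x, U x -> G x = x 0 i * q x /\
    (x 0 i = 0 -> q x = 'D_(delta_mx 0 i) G x).
Proof.
move=> sG G0; exists (tquot 1 G); first exact: smooth_tquot.
move=> x Ux; rewrite /tquot; split; last first.
  by move=> xi0; rewrite xi0 eqxx /= invr1 mul1r flat_id.
case: eqVneq => [xi0|xi0]; first by rewrite G0 // xi0 mul0r.
rewrite /trem big_ord_recl big_ord0 /= expr0 mulr1 addr0 expr1 mulrC divfK //.
by rewrite [G (flat x)]G0 ?subr0 //; [exact: flat_ball|rewrite flat_coord eqxx].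
Qed.

End Quotient.

(** * The inverse function theorem *)

(* Locked: unfolding iterated derivatives makes unification diverge. *)
HB.lock Definition jac (R : realType) m n (F : 'rV[R]_m -> 'rV[R]_n)
    (x : 'rV[R]_m) : 'M[R]_(m, n) :=
  \matrix_(k, i) 'D_(delta_mx 0 k) (fun y => F y 0 i) x.

Section InverseFunction.
Context {R : realType}.

Lemma jacE m n (F : 'rV[R]_m -> 'rV[R]_n) (x : 'rV[R]_m) k j :
  jac F x k j = 'D_(delta_mx 0 k) (fun y => F y 0 j) x.
Proof. by rewrite jac.unlock mxE. Qed.

Lemma derive_jac m n (U : set 'rV[R]_m) (F : 'rV[R]_m -> 'rV[R]_n) x v i :
  smooth_map U F -> U x -> 'D_v (fun y => F y 0 i) x = (v *m jac F x) 0 i.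
Proof.
move=> sF Ux; rewrite derive_basis; last exact: smooth_differentiable (sF i) Ux.
by rewrite mxE; apply: eq_bigr => k _; rewrite jacE.
Qed.

Lemma smooth_invmx m (U : set 'rV[R]_m) n (A : 'rV[R]_m -> 'M[R]_n) :
  (forall i j, smooth_on U (fun x => A x i j)) ->
  (forall x, U x -> A x \in unitmx) -> open U ->
  forall i j, smooth_on U (fun x => invmx (A x) i j).
Proof.
move=> sA uA oU i j.
apply: (@smooth_eq_on _ _ _ (fun x => (\det (A x))^-1 * cofactor (A x) j i)) => //.
  by move=> x Ux; rewrite /invmx uA // !mxE.
apply: smooth_mul.
  apply: smooth_inv; first exact: smooth_det.
  by move=> x Ux; have := uA x Ux; rewrite unitmxE unitfE.
rewrite /cofactor; apply: smooth_mul; first exact: smooth_cst.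
apply: smooth_det => k l.
by under eq_fun do rewrite !mxE; exact: sA.
Qed.

Lemma near_forall (I : finType) n (x : 'rV[R]_n) (P : I -> 'rV[R]_n -> Prop) :
  (forall i, \forall y \near x, P i y) -> \forall y \near x, forall i, P i y.
Proof. exact: (filter_forall (F := nbhs x) (f := P)). Qed.

Lemma sub_subACA (V : zmodType) (a b c d : V) : a - b - (c - d) = a - c - (b - d).
Proof. by rewrite !opprB addrACA [RHS]addrACA [- b - c]addrC. Qed.

Lemma coordB n (u v : 'rV[R]_n) k : (u - v) 0 k = u 0 k - v 0 k.
Proof. by rewrite !mxE. Qed.

Lemma mulmx_bound m n (A : 'M[R]_(m, n)) :
  exists2 C, 0 < C & forall v : 'rV[R]_m, `|v *m A| <= C * `|v|.
Proof.
exists (\sum_i \sum_j `|A i j| + 1).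
  by rewrite ltr_wpDl // sumr_ge0 // => i _; rewrite sumr_ge0.
move=> v; apply: norm_rV_le => [|j].
  by rewrite mulr_ge0 // addr_ge0 // sumr_ge0 // => i _; rewrite sumr_ge0.
rewrite mxE (le_trans (ler_norm_sum _ _ _)) // mulrDl mul1r.
rewrite -[leLHS]addr0 lerD // mulr_suml; apply: ler_sum => i _.
rewrite normrM mulrC; apply: ler_pM => //; last exact: coord_le_norm.
by rewrite (bigD1 j) //= lerDl sumr_ge0.
Qed.

Lemma compact_norm_le n (s : R) : compact [set x : 'rV[R]_n | `|x| <= s].
Proof.
apply: bounded_closed_compact.
  by exists s; split; [exact: num_real|move=> M sM x /= xs; apply: le_trans xs (ltW sM)].
apply: (@closed_comp _ _ (fun x : 'rV[R]_n => `|x|) [set z | z <= s]).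
  by move=> x _; exact: norm_continuous.
exact: closed_le.
Qed.

(** A minimum c of |T x - x| exists on the compact ball; since |T (T c) - T c| is at most half of |T
    c - c|, the minimum is 0. *)
Lemma contraction_fixpoint n (T : 'rV[R]_n -> 'rV[R]_n) (s : R) : 0 <= s ->
  (forall x, `|x| <= s -> `|T x| <= s) ->
  (forall x y, `|x| <= s -> `|y| <= s -> `|T x - T y| <= 2^-1 * `|x - y|) ->
  exists2 x, `|x| <= s & T x = x.
Proof.
move=> s0 Ts Tc.
pose g x := `|T x - x|.
have [|||c cs cmin] := @EVT_min_rV R n g [set x | `|x| <= s].
- by exists 0; rewrite /= normr0.
- exact: compact_norm_le.
- apply/subspace_continuousP => x /= xs.
  have FF : Filter (within [set x : 'rV[R]_n | `|x| <= s] (nbhs x)) by exact: within_filter.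
  apply: (@cvgrPdist_le R R^o _ _ FF g (g x)).2 => e e0.
  rewrite near_withinE.
  have e20 : 0 < e / 2 by rewrite divr_gt0.
  have : \forall y \near x, ball x (e / 2) y by exact: nbhsx_ballx.
  apply: filterS => y; rewrite -ball_normE /ball_ /= => xy ys.
  rewrite /g (le_trans (ler_dist_dist _ _)) //.
  rewrite sub_subACA.
  apply: le_trans (ler_normB _ _) _; rewrite [leRHS]splitr lerD ?(ltW xy) //.
  apply: le_trans (Tc x y xs ys) _; apply: le_trans (ltW xy).
  by rewrite ler_piMl // invf_le1 // ler1n.
rewrite inE /= in cs; exists c => //; apply/eqP; rewrite -subr_eq0 -normr_eq0.
have : `|T (T c) - T c| <= 2^-1 * `|T c - c| by apply: Tc => //; exact: Ts.
have := cmin (T c); rewrite inE /= /g => /(_ (Ts _ cs)) h1 h2.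
by have := le_trans h1 h2; rewrite eq_le normr_ge0 andbT; lra.
Qed.

(** With M the inverse of the Jacobian matrix at 0, N x = x - d x M has small derivative near 0 and
    is therefore 1/2-Lipschitz there. Solving d x = y amounts to finding a fixed point of x |-> N x
    + y M. *)
Lemma inverse_function n (d : 'rV[R]_n -> 'rV[R]_n) (W : set 'rV[R]_n) :
  open W -> W 0 -> smooth_map W d -> d 0 = 0 ->
  (forall v, (forall i, 'D_v (fun y => d y 0 i) 0 = 0) -> v = 0) -> diffeo_germ d.
Proof.
move=> oW W0 sd d0 inj0.
pose L := jac d 0.
have uL : L \in unitmx.
  rewrite -row_free_unit -kermx_eq0; apply/rowV0P => v /sub_kermxP vL.
  by apply: inj0 => i; rewrite (derive_jac v i sd W0) -/L vL mxE.
pose M := invmx L.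
pose N x := x - d x *m M.
have NE x j : N x 0 j = x 0 j - \sum_k d x 0 k * M k j by rewrite !mxE.
have sN : smooth_map W N.
  move=> j; under eq_fun do rewrite NE.
  apply: smooth_sub; first exact: smooth_coord.
  by apply: smooth_sum => k; apply: smooth_mul => //; exact: smooth_cst.
have DN x v j : W x -> 'D_v (fun y => N y 0 j) x = (v - v *m jac d x *m M) 0 j.
  move=> Wx.
  have -> : (fun y => N y 0 j) = (fun y => y 0 j - \sum_k d y 0 k * M k j).
    by apply/funext => y; exact: NE.
  have ss : smooth_on W (fun y => \sum_k d y 0 k * M k j).
    by apply: smooth_sum => k; apply: smooth_mul => //; exact: smooth_cst.
  rewrite (derive_smoothB _ (smooth_coord _ j) ss Wx) derive_proj.
  rewrite coordB [(_ *m M) 0 j]mxE; congr (_ - _).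
  have -> : (fun y => \sum_k d y 0 k * M k j) = \sum_k (fun y => M k j *: (d y 0 k : R^o)).
    by apply/funext => y; rewrite fct_sumE; apply: eq_bigr => k _; rewrite mulrC.
  have dd k : derivable (fun y => d y 0 k : R^o) x v.
    by apply: diff_derivable; exact: smooth_differentiable (sd k) Wx.
  rewrite derive_sum; last by move=> k; exact: derivableZ.
  apply: eq_bigr => k _; rewrite deriveZ //.
  by rewrite (derive_jac v k sd Wx) /GRing.scale /= mulrC.
have [rho rho0 [rhoW rhoN]] : exists2 rho, 0 < rho & ball 0 rho `<=` W /\
    forall x v j, ball 0 rho x -> `|'D_v (fun y => N y 0 j) x| <= 2^-1 * `|v|.
  (* Each partial derivative is made at most q, so that the n terms q |v| add up to at most |v| /
     2. *)
  pose q : R := 2^-1 / n.+1%:R.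
  have q0 : 0 < q by rewrite /q divr_gt0 ?invr_gt0.
  have : \forall x \near (0 : 'rV[R]_n), forall k j,
      `|'D_(delta_mx 0 k) (fun y => N y 0 j) x| <= q.
    apply: near_forall => k; apply: near_forall => j.
    have c := smooth_continuous (smooth_derive (delta_mx 0 k) oW (sN j)) W0.
    have /cvgrPdist_le/(_ q q0) := c; apply: filterS => x.
    by rewrite (DN 0) // -/L /M mulmxK // subrr mxE sub0r normrN.
  move=> /(filterI (open_nbhs_nbhs (conj oW W0)))/nbhs_ballP[rho /= rho0 H].
  exists rho => //; split=> [x /H[]//|x v j /H[Wx Hx]].
  rewrite derive_basis; last exact: smooth_differentiable (sN j) Wx.
  apply: le_trans (ler_norm_sum _ _ _) _.
  apply: (@le_trans _ _ (\sum_(k < n) `|v| * q)).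
    by apply: ler_sum => k _; rewrite normrM ler_pM // coord_le_norm.
  rewrite -mulr_sumr sumr_const card_ord mulrC ler_wpM2r // -[leLHS]mulr_natr.
  by rewrite /q mulrAC ler_pdivrMr // ler_wpM2l ?invr_ge0 // ler_nat.
have Nlip x y : ball 0 rho x -> ball 0 rho y -> `|N x - N y| <= 2^-1 * `|x - y|.
  move=> bx by_; apply: norm_rV_le => [|j]; first by rewrite mulr_ge0 ?invr_ge0.
  have seg (t : R) : 0 <= t <= 1 -> ball 0 rho (y + t *: (x - y)).
    move=> /andP[t0 t1]; move: bx by_; rewrite -ball_normE /ball_ /= !sub0r !normrN.
    move=> bx by_.
    have -> : y + t *: (x - y) = (1 - t) *: y + t *: x.
      by rewrite scalerBr scalerBl scale1r addrA addrAC.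
    apply: le_lt_trans (ler_normD _ _) _; rewrite !normrZ !ger0_norm ?subr_ge0 //.
    apply: (@lt_le_trans _ _ ((1 - t) * rho + t * rho)); last by rewrite -mulrDl subrK mul1r.
    have [->|tn0] := eqVneq t 0; first by rewrite subr0 !mul1r !mul0r !addr0.
    apply: ler_ltD; first by rewrite ler_wpM2l ?subr_ge0 // ltW.
    by rewrite ltr_pM2l // lt_neqAle eq_sym tn0.
  have tI (t : R) : 0 < t < 1 -> 0 <= t <= 1 by move=> /andP[? ?]; rewrite !ltW.
  have [t|t|t ht E] := @MVT_line _ _ (fun z => N z 0 j) y (x - y).
  - by move=> /tI/seg/rhoW; exact: smooth_differentiable (sN j).
  - by move=> /seg/rhoW; exact: smooth_continuous (sN j).
  move: E; rewrite [y + _]addrC subrK => E.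
  by rewrite coordB E rhoN //; apply: seg; exact: tI.
have uJ x : ball 0 rho x -> jac d x \in unitmx.
  move=> bx; rewrite -row_free_unit -kermx_eq0; apply/rowV0P => v /sub_kermxP vL.
  apply/eqP; rewrite -normr_eq0 eq_le normr_ge0 andbT.
  suff : `|v| <= 2^-1 * `|v| by have := normr_ge0 v; lra.
  apply: norm_rV_le => [|j]; first by rewrite mulr_ge0 ?invr_ge0.
  have := rhoN x v j bx; rewrite DN; last exact: rhoW.
  by rewrite vL mul0mx subr0.
have dE x : d x *m M = x - N x by rewrite /N opprB addrC subrK.
have b0 : ball 0 rho (0 : 'rV[R]_n) by exact: ballxx.
have N0 : N 0 = 0 by rewrite /N d0 mul0mx subr0.
(* Followed by M, d shrinks distances at most by half; this gives both the injectivity of d and the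
   Lipschitz bound on e. *)
have expand x y : ball 0 rho x -> ball 0 rho y ->
    `|x - y| <= 2 * `|(d x - d y) *m M|.
  move=> bx by_; have := Nlip x y bx by_.
  have : `|x - y| <= `|N x - N y| + `|(d x - d y) *m M|.
    apply: le_trans (ler_normD _ _); rewrite mulmxBl !dE.
    by move: (N x) (N y) => p q; rewrite (sub_subACA x) [p - q + _]addrC subrK.
  by have := normr_ge0 (x - y); lra.
pose s := rho / 2.
have s0 : 0 < s by rewrite divr_gt0.
have sb (x : 'rV[R]_n) : `|x| <= s -> ball 0 rho x.
  move=> xs; rewrite -ball_normE /ball_ /= sub0r normrN (le_lt_trans xs) //.
  by rewrite /s ltr_pdivrMr // ltr_pMr // ltr1n.
have /choice[e eP] : forall y, exists x, `|y *m M| <= s / 2 -> `|x| <= s /\ d x = y.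
  move=> y; have [ys|] := boolP (`|y *m M| <= s / 2); last by exists 0.
  have [|x xs|x z xs zs|x xs Tx] := @contraction_fixpoint _ (fun x => N x + y *m M) s.
  - exact: ltW.
  - apply: le_trans (ler_normD _ _) _; rewrite [leRHS]splitr lerD //.
    have := Nlip x 0 (sb x xs) b0; rewrite N0 !subr0 => h; apply: le_trans h _.
    by rewrite mulrC ler_pM2r // invr_gt0.
  - by rewrite opprD addrACA subrr addr0; apply: Nlip; exact: sb.
  exists x => _; split=> //.
  apply: (can_inj (mulmxK (_ : M \in unitmx))); first by rewrite unitmx_inv.
  by rewrite dE -{1}Tx addrC addKr.
have [C C0 CM] := mulmx_bound M.
pose V : set 'rV[R]_n := ball 0 (s / 2 / C).
have VM y : V y -> `|y *m M| <= s / 2.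
  rewrite /V -ball_normE /ball_ /= sub0r normrN => yV.
  by apply: le_trans (CM y) _; rewrite mulrC -ler_pdivlMr // ltW.
have eV y : V y -> ball 0 rho (e y) /\ d (e y) = y.
  by move=> /VM/eP[es de]; split=> //; exact: sb.
have oV : open V by exact: ball_open.
have V0 : V 0 by apply: ballxx; rewrite !divr_gt0.
have elip y y' : V y -> V y' -> `|e y - e y'| <= 2 * C * `|y - y'|.
  move=> /eV[b1 E1] /eV[b2 E2]; apply: le_trans (expand _ _ b1 b2) _.
  by rewrite E1 E2 -mulrA ler_wpM2l.
have e0 : e 0 = 0.
  have [b1 E1] := eV 0 V0; have := expand _ _ b1 b0.
  by rewrite E1 d0 !subr0 mul0mx normr0 mulr0 normr_le0 => /eqP.
have De y j : V y -> differentiable (fun z => e z 0 j) y /\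
    forall v, 'D_v (fun z => e z 0 j) y = (v *m invmx (jac d (e y))) 0 j.
  move=> Vy; have [bx dx] := eV y Vy.
  have uA := uJ _ bx; set A := jac d (e y) in uA *; pose B := invmx A.
  have Wx := rhoW _ bx.
  have [CB CB0 CBM] := mulmx_bound B.
  suff : differentiable (fun z => e z 0 j) y /\
      forall v, 'D_v (fun z => e z 0 j) y = dot (col j B)^T v.
    move=> [? H]; split=> // v; rewrite H /dot mxE; apply: eq_bigr => i _.
    by rewrite !mxE mulrC.
  apply: diff_of_bound => eps eps0.
  pose eps1 := eps / (CB * (2 * C)).
  have C20 : 0 < 2 * C by rewrite mulr_gt0.
  have eps10 : 0 < eps1 by rewrite divr_gt0 // mulr_gt0.
  have : \forall h \near (0 : 'rV[R]_n), forall i,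
      `|d (h + e y) 0 i - d (e y) 0 i - 'D_h (fun z => d z 0 i) (e y)| <= eps1 * `|h|.
    apply: near_forall => i; apply: diff_bound eps10.
    exact: smooth_differentiable (sd i) Wx.
  move=> /nbhs_ballP[del /= del0 H].
  have nV : \forall k \near (0 : 'rV[R]_n), V (k + y).
    have : \forall z \near y, V z by exact: open_nbhs_nbhs.
    by rewrite (near_shift 0 y) subr0.
  have ndel : \forall k \near (0 : 'rV[R]_n), `|k| < del / (2 * C).
    by apply: nbhs0_lt; rewrite divr_gt0.
  apply: filterS2 nV ndel => k Vky kdel.
  pose h := e (k + y) - e y.
  have hk : `|h| <= 2 * C * `|k|.
    by have := elip _ _ Vky Vy; rewrite addrK.
  have hdel : ball 0 del h.
    rewrite -ball_normE /ball_ /= sub0r normrN (le_lt_trans hk) //.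
    by rewrite mulrC -ltr_pdivlMr.
  have hx : h + e y = e (k + y) by rewrite subrK.
  have rho_le : `|k - h *m A| <= eps1 * `|h|.
    apply: norm_rV_le => [|i]; first by rewrite mulr_ge0 // ltW.
    have := H h hdel i; rewrite hx (eV _ Vky).2 dx (derive_jac h i sd Wx).
    by rewrite [(k + y) 0 i]mxE addrK coordB.
  have -> : e (k + y) 0 j - e y 0 j - dot (col j B)^T k = (h - k *m B) 0 j.
    rewrite /h !coordB; congr (_ - _).
    by rewrite /dot [RHS]mxE; apply: eq_bigr => i _; rewrite !mxE mulrC.
  apply: le_trans (coord_le_norm _ _) _.
  have -> : h - k *m B = - ((k - h *m A) *m B).
    by rewrite mulmxBl mulmxK // opprB.
  rewrite normrN; apply: le_trans (CBM _) _.
  rewrite mulrC -ler_pdivlMr //; apply: le_trans rho_le _.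
  apply: (@le_trans _ _ (eps1 * (2 * C * `|k|))); first by rewrite ler_wpM2l // ltW.
  by rewrite le_eqVlt; apply/orP; left; apply/eqP; rewrite /eps1; field; rewrite !gt_eqF.
have sJ (k i : 'I_n) : smooth_on (ball 0 rho) (fun x => invmx (jac d x) k i).
  apply: smooth_invmx => [{k}i {}j||]; [|exact: uJ|exact: ball_open].
  apply: (@smooth_subset _ _ _ W) => //.
  by under eq_fun do rewrite jacE; exact: smooth_derive.
have se : smooth_map V e.
  (* The derivative of e is [invmx (jac d)] evaluated at e, so the functions F \o e with F smooth on
     the ball form a class stable under derivatives. *)
  move=> j; exists [set f | exists2 F, smooth_on (ball 0 rho) F & f = F \o e].
    by exists (fun x => x 0 j) => //; exact: smooth_coord.
  move=> f [F sF ->].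
  have de y : V y -> differentiable e y.
    by move=> Vy; apply: differentiable_rV => i; exact: (De y i Vy).1.
  have dF y : V y -> differentiable F (e y).
    by move=> /eV[b1 _]; exact: smooth_differentiable sF b1.
  split=> [y Vy|v].
    by apply: differentiable_comp; [exact: de|exact: dF].
  exists ((fun x => \sum_i (\sum_k v 0 k * invmx (jac d x) k i) *
      'D_(delta_mx 0 i) F x) \o e); last first.
    move=> y Vy; rewrite derive_chain; [|exact: de|exact: dF].
    rewrite derive_basis; last exact: dF.
    apply: eq_bigr => i _; rewrite derive_coord; last exact: de.
    by rewrite (De y i Vy).2 mxE.
  exists (fun x => \sum_i (\sum_k v 0 k * invmx (jac d x) k i) *
      'D_(delta_mx 0 i) F x) => //.
  apply: smooth_sum => i; apply: smooth_mul.
    by apply: smooth_sum => k; apply: smooth_mul => //; exact: smooth_cst.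
  by apply: smooth_derive => //; exact: ball_open.
split.
  by split=> //; exists W => //; apply/Ck_smooth.
exists e; split; last 1 first.
- by apply: filterS (open_nbhs_nbhs (conj oV V0)) => y /eV[].
- by split=> //; exists V => //; apply/Ck_smooth.
have dc : {for 0, continuous d}.
  apply: differentiable_continuous; apply: differentiable_rV => i.
  exact: smooth_differentiable (sd i) W0.
have nVd : \forall x \near (0 : 'rV[R]_n), V (d x).
  by apply: dc; rewrite d0; exact: open_nbhs_nbhs.
have nB : \forall x \near (0 : 'rV[R]_n), ball 0 rho x by exact: nbhsx_ballx.
apply: filterS2 nVd nB => x /eV[b1 E1] bx.
apply/eqP; rewrite -subr_eq0 -normr_le0.
by have := expand _ _ b1 bx; rewrite E1 subrr mul0mx normr0 mulr0.
Qed.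

End InverseFunction.

(** * Even functions *)

Section Weights.
Context {R : realType}.

Let q : R := 4^-1.

Lemma q_bounds k : 0 < q ^+ k /\ q ^+ k <= 1.
Proof.
have q0 : 0 < q by rewrite invr_gt0.
by rewrite exprn_gt0 // exprn_ile1 ?(ltW q0) // /q invf_le1 // ler1n.
Qed.

Lemma q_bound k : q ^+ k.+1 <= q.
Proof.
rewrite exprS ler_piMr ?(q_bounds k).2 // ltW // /q invr_gt0 //.
Qed.

Lemma one_sub_q k : 3 / 4 <= 1 - q ^+ k.+1.
Proof. by have := q_bound k; rewrite /q; lra. Qed.

Lemma q4 k : q ^+ k * 4 ^+ k = 1.
Proof. by rewrite -exprMn /q mulVf ?pnatr_eq0 // expr1n. Qed.

(* Coefficients of prod_j (1 - q^j t), whose zeros are the nodes 4^n. *)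
Fixpoint qprod_coef (k : nat) : R :=
  if k is k'.+1 then - (qprod_coef k' * q ^+ k' / (1 - q ^+ k)) else 1.
Local Notation d := qprod_coef.

(** The functional equation P(t) = (1 - t) P(t / 4) of P(t) = prod_j (1 - q^j t), read on
    coefficients. *)
Lemma qprod_rec k : d k.+1 = d k.+1 * q ^+ k.+1 - d k * q ^+ k.
Proof.
rewrite /=; have := one_sub_q k; move: (q ^+ k.+1) => s hs.
by field; apply/eqP; lra.
Qed.

Lemma qprod_abs k : `|d k.+1| = `|d k| * q ^+ k / (1 - q ^+ k.+1).
Proof.
rewrite [d k.+1]/= normrN !normrM normfV.
have /ltW/ger0_norm -> := (q_bounds k).1.
by rewrite (@ger0_norm _ (1 - _)) //; have := one_sub_q k; lra.
Qed.

(** The coefficients decrease like 4^(-k(k-1)/2) and so beat every exponential: for k > n, passing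
    from k to k + 1 multiplies |d k| (2 * 4^n)^k by at most (1/4) 2 / (3/4) = 2/3. *)
Lemma qprod_decay n : exists2 K, 0 <= K & forall k, `|d k| * (4 ^+ k) ^+ n <= K * 2^-1 ^+ k.
Proof.
pose u k := `|d k| * (2 * 4 ^+ n) ^+ k.
have u0 k : 0 <= u k by rewrite mulr_ge0 // exprn_ge0 // mulr_ge0 // exprn_ge0.
have dec k : (n < k)%N -> u k.+1 <= u k.
  move=> nk; rewrite /u; set B := 2 * 4 ^+ n.
  rewrite (_ : B ^+ k.+1 = B * B ^+ k) ?exprS // qprod_abs.
  have h1 := one_sub_q k.
  have h2 : q ^+ k * 4 ^+ n <= 4^-1.
    have -> : q ^+ k * 4 ^+ n = q ^+ (k - n.+1) * q.
      by rewrite -{1}(subnK nk) exprD exprSr -!mulrA [q * _]mulrC [q ^+ n * _]mulrA q4 mul1r.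
    by rewrite ler_piMl ?invr_ge0 // (q_bounds _).2.
  rewrite (_ : _ * _ = `|d k| * B ^+ k * ((q ^+ k * 4 ^+ n) * 2 / (1 - q ^+ k.+1))); last by rewrite /B; ring.
  rewrite ler_piMr ?u0 // ler_pdivrMr; lra.
pose K := \sum_(j < n.+2) u j.
have uK k : u k <= K.
  elim: k => [|k IH]; first by rewrite /K big_ord_recl /= lerDl sumr_ge0.
  have [kn|nk] := leqP k n; last exact: le_trans (dec k nk) IH.
  rewrite /K (bigD1 (Ordinal (kn : (k.+1 < n.+2)%N))) //= lerDl.
  by rewrite sumr_ge0.
exists K; first exact: le_trans (u0 0%N) (uK 0%N).
move=> k; rewrite exprVn ler_pdivlMr ?exprn_gt0 //; apply: le_trans (uK k).
by rewrite /u exprMn -!exprM mulnC -mulrA [X in _ * X]mulrC.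
Qed.

Lemma series_domin (u v : R^nat) (K : R) : 0 <= K ->
  (forall k, `|u k| <= K * 2^-1 ^+ k) -> cvgn (series (fun k => `|u k|)).
Proof.
move=> K0 H; apply: (@series_le_cvg _ _ (geometric K 2^-1)) => // [k|].
  by rewrite /geometric /= mulr_ge0 // exprn_ge0 // invr_ge0.
apply: is_cvg_geometric_series; rewrite ger0_norm ?invr_ge0 //.
by rewrite invf_lt1 // ltr1n.
Qed.

Lemma qprod_cvg n : cvgn (series (fun k => `|d k * (4 ^+ k) ^+ n|)).
Proof.
have [K K0 H] := qprod_decay n; apply: (@series_domin _ (fun=> 0) K) => // k.
by rewrite normrM [X in _ * X]ger0_norm // -exprM exprn_ge0.
Qed.

(** The equation P(4 t) = (1 - 4 t) P(t) at t = 4^n, term by term. *)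
Lemma qprod_step N n : d N.+1 * (4 ^+ N.+1) ^+ n.+1 =
  d N.+1 * (4 ^+ N.+1) ^+ n - 4 ^+ n.+1 * (d N * (4 ^+ N) ^+ n).
Proof.
have e1 : q ^+ N.+1 * (4 ^+ N.+1) ^+ n.+1 = (4 ^+ N.+1) ^+ n.
  by rewrite [(4 ^+ N.+1) ^+ n.+1]exprS mulrA q4 mul1r.
have e2 : q ^+ N * (4 ^+ N.+1) ^+ n.+1 = 4 ^+ n.+1 * (4 ^+ N) ^+ n.
  rewrite [4 ^+ N.+1]exprS exprMn mulrCA; congr (_ * _).
  by rewrite exprS mulrA q4 mul1r.
by rewrite {1}qprod_rec mulrBl -!mulrA e1 e2 mulrCA.
Qed.

(** The series is P(4^n). For n = 0 the partial sums telescope to d_N q^N; then P(4^(n+1)) = (1 -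
    4^(n+1)) P(4^n). *)
Lemma qprod_sum0 n : series (fun k => d k * (4 ^+ k) ^+ n) @ \oo --> (0 : R).
Proof.
elim: n => [|n IH].
  have E N : series (fun k => d k * (4 ^+ k) ^+ 0) N.+1 = d N * q ^+ N.
    rewrite /series /=; elim: N => [|N IH].
      by rewrite big_nat1 !expr0 !mulr1.
    by rewrite big_nat_recr //= IH expr0 mulr1 [X in _ + X]qprod_rec addrC subrK.
  rewrite -cvg_shiftS /=; under eq_fun do rewrite E.
  have [K K0 H] := qprod_decay 0.
  have g0 : geometric K (2^-1 : R) @ \oo --> 0.
    by apply: cvg_geometric; rewrite ger0_norm ?invr_ge0 // invf_lt1 // ltr1n.
  apply: norm_cvg0; apply: (squeeze_cvgr _ _ g0); last exact: cvg_cst.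
  near=> k; rewrite normr_ge0 /= normrM.
  have := H k; rewrite expr0 mulr1; apply: le_trans.
  have [h1 h2] := q_bounds k; rewrite ler_piMr //; first by rewrite ger0_norm // ltW.
pose t : R := 4 ^+ n.+1.
have E N : series (fun k => d k * (4 ^+ k) ^+ n.+1) N.+1 =
    series (fun k => d k * (4 ^+ k) ^+ n) N.+1 - t * series (fun k => d k * (4 ^+ k) ^+ n) N.
  rewrite /series /=; elim: N => [|N IHN].
    by rewrite !big_nat1 big_geq // mulr0 subr0 !expr0 !expr1n.
  have S (w : nat -> R) M : \sum_(0 <= k < M.+1) w k = \sum_(0 <= k < M) w k + w M.
    by rewrite big_nat_recr.
  rewrite [LHS]S IHN !(S (fun k => d k * (4 ^+ k) ^+ n)) qprod_step /t; ring.
rewrite -cvg_shiftS /=; under eq_fun do rewrite E.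
have C : (fun N => series (fun k => d k * (4 ^+ k) ^+ n) N.+1 -
    t * series (fun k => d k * (4 ^+ k) ^+ n) N) @ \oo --> 0 - t * 0.
  apply: cvgB; last exact: cvgMl_tmp.
  by have := IH; rewrite -cvg_shiftS.
by rewrite mulr0 subr0 in C.
Unshelve. all: by end_near. Qed.

Let node (k : nat) : R := 4 ^+ k.

Lemma node_ge1 k : 1 <= node k. Proof. by rewrite exprn_ege1 // ler1n. Qed.

(** Division by 1 + 4^k turns the vanishing moments of d into moments that alternate in sign: those
    of order n and n + 1 add up to P(4^n) = 0. *)
Let v k n := d k / (1 + node k) * node k ^+ n.

Lemma v_abs k n : `|v k n| <= `|d k * (4 ^+ k) ^+ n|.
Proof.
rewrite /v -/(node k) mulrAC normrM ler_piMr // normfV invf_le1.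
  by rewrite ger0_norm; have := node_ge1 k; lra.
by rewrite normr_gt0 gt_eqF //; have := node_ge1 k; lra.
Qed.

Lemma v_cvg n : cvgn (series (fun k => `|v k n|)).
Proof.
apply: (@series_le_cvg _ _ (fun k => `|d k * (4 ^+ k) ^+ n|)) => // [k|].
  exact: v_abs.
exact: qprod_cvg.
Qed.

Lemma v_is_cvg n : cvgn (series (fun k => v k n)).
Proof. by apply: normed_cvg; exact: v_cvg. Qed.

Let mom n : R := limn (series (fun k => v k n)).

Lemma momS n : mom n.+1 = - mom n.
Proof.
have h : series (fun k => d k * (4 ^+ k) ^+ n) @ \oo --> mom n + mom n.+1.
  have -> : series (fun k => d k * (4 ^+ k) ^+ n) =
      series (fun k => v k n) \+ series (fun k => v k n.+1).
    apply/funext => N; rewrite /series /= -big_split /=; apply: eq_bigr => k _.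
    rewrite /v -/(node k) exprS; have := node_ge1 k => h.
    by field; apply/eqP; lra.
  by apply: cvgD; exact: v_is_cvg.
have : mom n + mom n.+1 = 0.
  by apply: (cvg_unique _ h (qprod_sum0 n)) => //; exact: norm_hausdorff.
by move/eqP; rewrite addrC addr_eq0 => /eqP.
Qed.

Lemma qprod_sign k : d k = (-1) ^+ k * `|d k|.
Proof.
elim: k => [|k IH]; first by rewrite expr0 mul1r normr1.
rewrite qprod_abs [LHS]/= {1}IH [(-1) ^+ k.+1]exprS; ring.
Qed.

Let a k := `|d k| / (1 + node k).

Lemma a_dec k : a k.+1 <= a k.
Proof.
rewrite /a qprod_abs; have h1 := one_sub_q k; have h2 := node_ge1 k.
have [h3 h4] := q_bounds k.
have nS : node k.+1 = 4 * node k by rewrite /node exprS.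
rewrite nS ler_pdivrMr; last by lra.
rewrite [leRHS]mulrAC -[leRHS]mulrA -[_ * _ / _ in leLHS]mulrA; apply: ler_wpM2l => //.
rewrite ler_pdivrMr; last by lra.
apply: (le_trans h4); rewrite [leRHS]mulrC mulrA ler_pdivlMr; last by lra.
rewrite mul1r; apply: (@le_trans _ _ (3 / 4 * (1 + 4 * node k))); first by lra.
by rewrite ler_wpM2r //; lra.
Qed.

(** An alternating series with decreasing terms a_k: all its partial sums with at least two terms
    are at least a_0 - a_1 = 1/2 - 4/15 = 7/30. *)
Lemma mom0_neq0 : mom 0 != 0.
Proof.
have E N : series (fun k => v k 0) N = \sum_(k < N) (-1) ^+ k * a k.
  rewrite /series /= big_mkord; apply: eq_bigr => k _.
  by rewrite /v expr0 mulr1 qprod_sign /a mulrA.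
have a0 k : 0 <= a k.
  by rewrite divr_ge0 // addr_ge0 // ltW // (lt_le_trans ltr01) // node_ge1.
have sgn2 j : (-1) ^+ j.*2 = 1 :> R by rewrite -signr_odd odd_double.
have P j : a 0%N - a 1%N <= series (fun k => v k 0) j.+1.*2 /\
           a 0%N - a 1%N <= series (fun k => v k 0) j.+1.*2.+1.
  elim: j => [|j [IH1 IH2]].
    rewrite !E; have -> : (1.*2 = 2)%N by [].
    rewrite !big_ord_recr big_ord0 /= !expr0 !expr1 expr2.
    by have := a0 2%N; split; lra.
  have e1 : series (fun k => v k 0) j.+2.*2 =
      series (fun k => v k 0) j.+1.*2 + (a j.+1.*2 - a j.+1.*2.+1).
    rewrite !E doubleS 2!big_ord_recr /= exprS sgn2; ring.
  have e2 : series (fun k => v k 0) j.+2.*2.+1 =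
      series (fun k => v k 0) j.+2.*2 + a j.+2.*2.
    by rewrite !E big_ord_recr /= sgn2 mul1r.
  have h1 := a_dec j.+1.*2; have h2 := a0 j.+2.*2.
  by rewrite e2 e1; split; lra.
have a01 : 0 < a 0%N - a 1%N.
  rewrite /a qprod_abs [d 0]/= normr1 /node !expr0 !expr1 /q.
  rewrite (_ : _ - _ = 7 / 30) ?divr_gt0 //.
  by field.
have : a 0%N - a 1%N <= mom 0.
  apply: limr_ge; first exact: v_is_cvg.
  exists 2%N => //= N N2; rewrite -[N]odd_double_half.
  have : (0 < N./2)%N by rewrite half_gt0.
  case: (N./2) => // j _; have [] := P j; case: (odd N) => //.
by move=> h; rewrite gt_eqF // (lt_le_trans a01).
Qed.

(** Absolute convergence is claimed for every n, because each differentiation under the sum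
    multiplies the k-th term by -4^k. *)
Lemma alternating_weights : exists c : nat -> R, forall n,
  cvgn (series (fun k => `|c k * (- 4 ^+ k) ^+ n|)) /\
  series (fun k => c k * (- 4 ^+ k) ^+ n) @ \oo --> (1 : R).
Proof.
pose c k := (mom 0)^-1 * (d k / (1 + node k)).
exists c => n.
have E k : c k * (- 4 ^+ k) ^+ n = ((mom 0)^-1 * (-1) ^+ n) * v k n.
  by rewrite /c /v -/(node k) -mulN1r exprMn; ring.
split.
  under eq_fun do rewrite E normrM.
  have -> : series (fun k => `|(mom 0)^-1 * (-1) ^+ n| * `|v k n|) =
      `|(mom 0)^-1 * (-1) ^+ n| *: series (fun k => `|v k n|).
    by apply/funext => N; rewrite /series /= fctE scaler_sumr.
  by apply: is_cvgZr; exact: v_cvg.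
under eq_fun do rewrite E.
have momE : mom n = (-1) ^+ n * mom 0.
  elim: n {E} => [|n IH]; first by rewrite expr0 mul1r.
  by rewrite momS IH exprS mulN1r mulNr.
have -> : series (fun k => (mom 0)^-1 * (-1) ^+ n * v k n) =
    fun N => ((mom 0)^-1 * (-1) ^+ n) * series (fun k => v k n) N.
  by apply/funext => N; rewrite /series /= mulr_sumr.
have one : ((mom 0)^-1 * (-1) ^+ n) * mom n = 1 :> R.
  rewrite momE mulrA -[_^-1 * _ * _]mulrA -expr2 sqrr_sign mulr1.
  by rewrite mulVf ?mom0_neq0.
have C : (fun N => ((mom 0)^-1 * (-1) ^+ n) * series (fun k => v k n) N) @ \oo -->
    ((mom 0)^-1 * (-1) ^+ n) * mom n by apply: cvgMl_tmp; exact: v_is_cvg.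
by rewrite one in C.
Qed.

End Weights.

(** * Whitney's theorem on even functions, by extension to negative z *)

Section EvenFunctions.
Context {R : realType}.

Definition pt (x y : R) : 'rV[R]_2 := \row_j (if j == 0 then x else y).

Lemma pt0 x y : pt x y 0 0 = x. Proof. by rewrite mxE. Qed.
Lemma pt1 x y : pt x y 0 1 = y. Proof. by rewrite mxE. Qed.

Lemma pt_eta (p : 'rV[R]_2) : p = pt (p 0 0) (p 0 1).
Proof.
apply/rowP => j; rewrite mxE; case: eqP => [->//|j0]; congr (p 0 _).
by apply/val_inj; move: j j0 => [[|[|//]] //= h] j0; case: j0; apply/val_inj.
Qed.

Lemma rV2P (p q : 'rV[R]_2) : p 0 0 = q 0 0 -> p 0 1 = q 0 1 -> p = q.
Proof. by move=> h0 h1; rewrite (pt_eta p) (pt_eta q) h0 h1. Qed.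

Lemma forall_I2 (P : 'I_2 -> Prop) : P 0 -> P 1 -> forall j, P j.
Proof.
move=> P0 P1 [[|[|//]] h]; first by rewrite (_ : Ordinal h = 0) //; exact/val_inj.
by rewrite (_ : Ordinal h = 1) //; exact/val_inj.
Qed.

Lemma sum_I2 (F : 'I_2 -> R) : \sum_j F j = F 0 + F 1.
Proof.
by rewrite !big_ord_recl big_ord0 addr0; congr (_ + F _); exact/val_inj.
Qed.

Lemma smooth_pt m (U : set 'rV[R]_m) f g : smooth_on U f -> smooth_on U g ->
  smooth_map U (fun x => pt (f x) (g x)).
Proof.
move=> sf sg; apply: forall_I2.
  by under eq_fun do rewrite pt0.
by under eq_fun do rewrite pt1.
Qed.

Lemma derive_comp2 m (U : set 'rV[R]_m) (W : set 'rV[R]_2) G f g x v :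
  open W -> smooth_on W G -> smooth_on U f -> smooth_on U g -> U x ->
  W (pt (f x) (g x)) ->
  'D_v (fun y => G (pt (f y) (g y))) x =
    'D_v f x * 'D_(delta_mx 0 0) G (pt (f x) (g x)) +
    'D_v g x * 'D_(delta_mx 0 1) G (pt (f x) (g x)).
Proof.
move=> oW sG sf sg Ux Wx.
have dG := smooth_differentiable sG Wx.
have dF : differentiable (fun y => pt (f y) (g y)) x.
  by apply: differentiable_rV => j; exact: smooth_differentiable (smooth_pt sf sg j) Ux.
rewrite (derive_chain (F := fun y => pt (f y) (g y)) (g := G)) //.
rewrite derive_basis // sum_I2; congr (_ * _ + _ * _); rewrite derive_coord //.
  by under eq_fun do rewrite pt0.
by under eq_fun do rewrite pt1.
Qed.

Lemma continuous_rV m n (F : 'rV[R]_m -> 'rV[R]_n) x :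
  (forall j, {for x, continuous (fun y => F y 0 j)}) -> {for x, continuous F}.
Proof.
move=> H; have FF : Filter (nbhs x) by exact: nbhs_filter.
apply: (@cvgrPdist_le R _ _ (nbhs x) FF F (F x)).2 => e e0.
have : \forall y \near x, forall j, `|F x 0 j - F y 0 j| <= e.
  by apply: near_forall => j; have /cvgrPdist_le/(_ e e0) := H j.
apply: filterS => y Hy; apply: norm_rV_le; first exact: ltW.
by move=> j; rewrite coordB.
Qed.

Variables (r : R).
Hypothesis r0 : 0 < r.
Let U : set 'rV[R]_2 := ball 0 r.
Let rho := r / 2.
Let St : set 'rV[R]_2 := [set p | `|p 0 0| < rho].

Let oU : open U. Proof. exact: ball_open. Qed.
Let rho0 : 0 < rho. Proof. by rewrite /rho divr_gt0. Qed.

Let UP p : U p <-> `|p| < r. Proof. exact: ballP. Qed.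

Let oSt : open St.
Proof.
apply: (@open_comp _ _ (fun p : 'rV[R]_2 => `|p 0 0|) [set z | z < rho]).
  move=> p _; apply: (continuous_comp (f := fun p : 'rV[R]_2 => p 0 0)).
    exact: coord_continuous.
  exact: norm_continuous.
exact: open_lt.
Qed.

Definition even_fun (e : 'rV[R]_2 -> R) : Prop :=
  smooth_on U e /\ forall x y, U (pt x y) -> e (pt x (- y)) = e (pt x y).

Lemma U_opp x y : U (pt x y) -> U (pt x (- y)).
Proof.
move=> /UP xy; apply/UP; apply: le_lt_trans xy; apply: norm_rV_le => //.
apply: forall_I2; first by rewrite pt0 -{1}(pt0 x y) coord_le_norm.
by rewrite pt1 normrN -{1}(pt1 x y) coord_le_norm.
Qed.

Lemma derive_reflect e p j : even_fun e -> U p ->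
  'D_(delta_mx 0 j) e p = (if j == 0 then 1 else -1) *
    'D_(delta_mx 0 j) e (pt (p 0 0) (- p 0 1)).
Proof.
move=> [se ev] Up.
have Up' : U (pt (p 0 0) (- p 0 1)) by apply: U_opp; rewrite -pt_eta.
rewrite (eq_derive_on (g := fun q => e (pt (q 0 0) (- q 0 1))) _ oU Up); last first.
  by move=> q Uq; rewrite ev -pt_eta.
rewrite (derive_comp2 _ oU se (smooth_coord U 0) (smooth_opp (smooth_coord U 1)) Up Up').
rewrite (deriveN (f := fun q : 'rV[R]_2 => q 0 1 : R^o)); last first.
  by apply: diff_derivable; exact: differentiable_coord.
rewrite !derive_proj !mxE /=.
move: j; apply: forall_I2; first by rewrite /= oppr0 mul0r addr0.
by rewrite /= mul0r add0r.
Qed.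

Lemma even_dx e : even_fun e -> even_fun ('D_(delta_mx 0 0) e).
Proof.
move=> ee; split=> [|x y Uxy]; first by apply: smooth_derive => //; exact: ee.1.
by rewrite (derive_reflect 0 ee Uxy) /= mul1r pt0 pt1.
Qed.

(** If y depends on z >= 0 through y^2 = z / (1 + z / rho^2), then d(y^2)/dz = (1 - y^2 / rho^2)^2,
    so h is the z-derivative of e(x, y). It is again smooth and even, because the y-derivative of e
    is odd and hence divisible by y. *)
Lemma even_dy e : even_fun e -> exists2 h, even_fun h & forall p, U p ->
  'D_(delta_mx 0 1) e p * (1 - p 0 1 ^+ 2 / rho ^+ 2) ^+ 2 = 2 * p 0 1 * h p.
Proof.
move=> ee; have sy := smooth_derive (delta_mx 0 1) oU ee.1.
have [p Up p1|q sq qE] := hadamard (i := 1) sy.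
  have P : pt (p 0 0) (- p 0 1) = p by rewrite [RHS]pt_eta p1 oppr0.
  by have := derive_reflect 1 ee Up; rewrite P /=; lra.
pose h (p : 'rV[R]_2) := (1 - p 0 1 ^+ 2 / rho ^+ 2) ^+ 2 * (2^-1 * q p).
exists h; last by move=> p Up; rewrite (qE p Up).1 /h; move: (_ ^+ 2) => K; field.
split=> [|x y Uxy].
  apply: smooth_mul; last by apply: smooth_mul => //; exact: smooth_cst.
  apply: smooth_exp; apply: smooth_sub; first exact: smooth_cst.
  by apply: smooth_mul; [apply: smooth_exp; exact: smooth_coord|exact: smooth_cst].
rewrite /h !pt1 sqrrN; congr (_ * (_ * _)).
have [->|y0] := eqVneq y 0; first by rewrite oppr0.
have := derive_reflect 1 ee Uxy; rewrite /= pt0 pt1 (qE _ Uxy).1.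
rewrite (qE _ (U_opp Uxy)).1 !pt1 mulN1r mulNr opprK.
by move=> /(mulfI y0).
Qed.

(* [squash] is bounded and is the square of a smooth function off 0; the change
   of variable it induces near 0 is undone in [even_factor_aux]. *)
Definition squash (s : R) : R := `|s| / (1 + `|s| / rho ^+ 2).
(** For l = 4^k the argument l z leaves every bounded set as k grows; since [squash] is bounded, all
    these samples stay in the domain of e. *)
Definition fold (l : R) (p : 'rV[R]_2) : 'rV[R]_2 := pt (p 0 0) (Num.sqrt (squash (l * p 0 1))).

Let rho2 : 0 < rho ^+ 2. Proof. by rewrite exprn_gt0. Qed.

Lemma squash_den (s : R) : 0 < 1 + `|s| / rho ^+ 2.
Proof. by rewrite ltr_wpDr // divr_ge0 // ltW. Qed.

Lemma squash_bound s : 0 <= squash s /\ Num.sqrt (squash s) <= rho.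
Proof.
split; first by rewrite divr_ge0 // ltW // squash_den.
rewrite -[leRHS]ger0_norm ?(ltW rho0) // -sqrtr_sqr ler_wsqrtr //.
rewrite ler_pdivrMr ?squash_den // mulrDr mulr1 mulrCA mulfV ?gt_eqF // mulr1.
by rewrite lerDr ltW.
Qed.

Lemma fold_norm l p : St p -> `|fold l p| <= rho.
Proof.
move=> Sp; apply: norm_rV_le; first exact: ltW.
apply: forall_I2; first by rewrite pt0 ltW.
by rewrite pt1 ger0_norm ?sqrtr_ge0 // (squash_bound _).2.
Qed.

Lemma fold_U l p : St p -> U (fold l p).
Proof.
move=> Sp; apply/UP; apply: le_lt_trans (fold_norm l Sp) _.
by rewrite /rho ltr_pdivrMr // ltr_pMr // ltr1n.
Qed.

Lemma squash_continuous : continuous squash.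
Proof.
move=> s; apply: continuousM; first exact: norm_continuous.
apply: continuousV; first by rewrite gt_eqF // squash_den.
apply: continuousD; first exact: cst_continuous.
by apply: continuousM; [exact: norm_continuous|exact: cst_continuous].
Qed.

Lemma fold_continuous l p : {for p, continuous (fold l)}.
Proof.
apply: continuous_rV; apply: forall_I2.
  have -> : (fun y => fold l y 0 0) = (fun y => y 0 0).
    by apply/funext => y; rewrite pt0.
  exact: coord_continuous.
have -> : (fun y => fold l y 0 1) = (fun y => Num.sqrt (squash (l * y 0 1))).
  by apply/funext => y; rewrite pt1.
apply: (@continuous_comp _ _ _ (fun q : 'rV[R]_2 => squash (l * q 0 1)) Num.sqrt);
  last exact: sqrt_continuous.
apply: (@continuous_comp _ _ _ (fun q : 'rV[R]_2 => l * q 0 1) squash);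
  last exact: squash_continuous.
apply: (@continuousM R _ (fun=> l)); first exact: cst_continuous.
exact: coord_continuous.
Qed.

Lemma smooth_bounded e : smooth_on U e ->
  exists2 M, 0 <= M & forall p, `|p| <= rho -> `|e p| <= M.
Proof.
move=> se; have [|||c cs cmax] := @EVT_max_rV R 2 (fun p => `|e p|) [set p | `|p| <= rho].
- by exists 0; rewrite /= normr0 ltW.
- exact: compact_norm_le.
- apply: continuous_in_subspaceT => p; rewrite inE /= => pr.
  have Up : U p by apply/UP; rewrite (le_lt_trans pr) // /rho ltr_pdivrMr // ltr_pMr // ltr1n.
  exact: (cvg_norm (smooth_continuous se Up)).
by exists `|e c| => // p pr; apply: cmax; rewrite inE.
Qed.

Lemma fold_e_continuous e l p : smooth_on U e -> St p ->
  {for p, continuous (fun q => e (fold l q))}.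
Proof.
move=> se Sp; apply: (@continuous_comp _ _ _ (fold l) e); first exact: fold_continuous.
by apply: smooth_continuous se _; exact: fold_U.
Qed.

Let half (s : R) : set 'rV[R]_2 := [set p | St p /\ 0 < s * p 0 1].

Let open_half s : open (half s).
Proof.
apply: openI => //.
apply: (@open_comp _ _ (fun p : 'rV[R]_2 => s * p 0 1) [set z | 0 < z]); last exact: open_gt.
move=> p _; apply: (@continuousM R _ (fun=> s)); first exact: cst_continuous.
exact: coord_continuous.
Qed.

(** On the half space s z > 0 the absolute value inside [squash] is a = l s z, and y^2 = T with T =
    a / (1 + a / rho^2). The formula is the derivative of y^2, as 1 - T / rho^2 = (1 + a /
    rho^2)^-1. *)
Lemma smooth_fold_sqrt s l : 0 < l -> `|s| = 1 ->
  smooth_on (half s) (fun p => Num.sqrt (squash (l * p 0 1))) /\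
  forall (p v : 'rV[R]_2), half s p -> let y := Num.sqrt (squash (l * p 0 1)) in
     2 * y * 'D_v (fun p : 'rV[R]_2 => Num.sqrt (squash (l * p 0 1))) p =
     l * s * (1 - y ^+ 2 / rho ^+ 2) ^+ 2 * v 0 1 /\ y != 0.
Proof.
move=> l0 s1.
pose a (p : 'rV[R]_2) := l * s * p 0 1.
have aE p : half s p -> `|l * p 0 1| = a p.
  move=> [_ sp]; rewrite /a normrM (gtr0_norm l0) -mulrA; congr (_ * _).
  by rewrite -(gtr0_norm sp) normrM s1 mul1r.
have a0 p : half s p -> 0 < a p by move=> [_ sp]; rewrite /a -mulrA mulr_gt0.
have den p : half s p -> 0 < 1 + a p / rho ^+ 2.
  by move=> hp; rewrite ltr_pwDl // divr_ge0 // ltW // a0.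
pose T p := a p / (1 + a p / rho ^+ 2).
have TE p : half s p -> squash (l * p 0 1) = T p by move=> hp; rewrite /squash aE.
have T0 p : half s p -> 0 < T p by move=> hp; rewrite divr_gt0 ?a0 ?den.
have sa : smooth_on (half s) a by apply: smooth_mul; [exact: smooth_cst|exact: smooth_coord].
have sd : smooth_on (half s) (fun p => 1 + a p / rho ^+ 2).
  by apply: smooth_add; [exact: smooth_cst|apply: smooth_mul => //; exact: smooth_cst].
have sT : smooth_on (half s) T.
  by apply: smooth_mul => //; apply: smooth_inv => // p hp; rewrite gt_eqF // den.
have sg := smooth_sqrt sT T0.
have sg' : smooth_on (half s) (fun p => Num.sqrt (squash (l * p 0 1))).
  by apply: smooth_eq_on sg => // p hp; rewrite TE.
split=> // p v hp y.
have y0 : 0 < y by rewrite /y TE // sqrtr_gt0 T0.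
have yy : y ^+ 2 = T p by rewrite /y TE // sqr_sqrtr // ltW // T0.
split; last by rewrite gt_eqF.
have e1 : 'D_v T p = y * 'D_v (fun p : 'rV[R]_2 => Num.sqrt (squash (l * p 0 1))) p
                   + y * 'D_v (fun p : 'rV[R]_2 => Num.sqrt (squash (l * p 0 1))) p.
  rewrite -(derive_smoothM v sg' sg' hp); apply: eq_derive_on hp _ => // q hq.
  by rewrite TE // -expr2 sqr_sqrtr // ltW // T0.
have Da : 'D_v a p = l * s * v 0 1.
  by rewrite (derive_smoothZ _ _ (smooth_coord (half s) 1) hp) derive_proj.
have e2 : 'D_v a p = T p * ('D_v a p / rho ^+ 2) + (1 + a p / rho ^+ 2) * 'D_v T p.
  rewrite {1}(eq_derive_on (g := fun q => T q * (1 + a q / rho ^+ 2)) v (@open_half s) hp).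
    rewrite (derive_smoothM v sT sd hp); congr (_ * _ + _).
    have sc : smooth_on (half s) (fun=> (1 : R)) by exact: smooth_cst.
    have sm : smooth_on (half s) (fun q => a q / rho ^+ 2).
      by apply: smooth_mul => //; exact: smooth_cst.
    rewrite (derive_smoothD v sc sm hp) derive_cst0 add0r.
    under eq_fun do rewrite mulrC.
    by rewrite (derive_smoothZ _ v sa hp) mulrC.
  by move=> q hq; rewrite /T divfK // gt_eqF // den.
have dT : 'D_v T p = l * s * (1 - T p / rho ^+ 2) ^+ 2 * v 0 1.
  have e3 : 1 - T p / rho ^+ 2 = (1 + a p / rho ^+ 2)^-1.
    rewrite /T; have := den p hp; have := rho2.
    move: (rho ^+ 2) (a p) => w b w0 h.
    have hb : w + b != 0.
      by rewrite gt_eqF // (_ : w + b = w * (1 + b / w)) ?mulr_gt0 //; field; rewrite gt_eqF.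
    by field; rewrite hb gt_eqF.
  have dn : 1 + a p / rho ^+ 2 != 0 by rewrite gt_eqF // den.
  have e4 : (1 + a p / rho ^+ 2) * 'D_v T p = 'D_v a p * (1 + a p / rho ^+ 2)^-1.
    by rewrite -e3; apply: (addrI (T p * ('D_v a p / rho ^+ 2))); rewrite -e2; ring.
  apply: (mulfI dn); rewrite e4 e3 Da; move: (1 + a p / rho ^+ 2) dn => K K0.
  by field.
by rewrite yy -dT e1; ring.
Qed.

(** The singular factor 1/y of the square root cancels against the factor y in the equation for h,
    so that for fixed l the derivatives stay bounded up to z = 0. *)
Lemma derive_fold s l e h : 0 < l -> `|s| = 1 -> smooth_on U e ->
  (forall p, U p ->
    'D_(delta_mx 0 1) e p * (1 - p 0 1 ^+ 2 / rho ^+ 2) ^+ 2 = 2 * p 0 1 * h p) ->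
  smooth_on (half s) (fun p => e (fold l p)) /\
  forall p v, half s p -> 'D_v (fun p => e (fold l p)) p =
    v 0 0 * 'D_(delta_mx 0 0) e (fold l p) + l * s * v 0 1 * h (fold l p).
Proof.
move=> l0 s1 se eh; have [sg Dg] := smooth_fold_sqrt l0 s1.
split.
  apply: (smooth_comp oU se); first by apply: smooth_pt => //; exact: smooth_coord.
  by move=> p [Sp _]; exact: fold_U.
move=> p v hp; have Ufp : U (fold l p) by apply: fold_U; exact: hp.1.
rewrite (derive_comp2 v oU se (smooth_coord _ 0) sg hp Ufp) derive_proj -/(fold l p).
congr (_ + _); have [Dy y0] := Dg p v hp.
have := eh _ Ufp; rewrite [fold l p 0 1]pt1.
move: Dy y0; set y := Num.sqrt _; set dg := 'D_v _ p; set ey := 'D_(delta_mx 0 1) e _.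
move: ((1 - y ^+ 2 / rho ^+ 2) ^+ 2) => k Dy y0 E.
have y20 : 2 * y != 0 by rewrite mulf_neq0 // pnatr_eq0.
apply: (mulfI y20); rewrite mulrA Dy.
have -> : l * s * k * v 0 1 * ey = l * s * v 0 1 * (ey * k) by ring.
by rewrite E; ring.
Qed.

Variable c : nat -> R.
Let w n k := c k * (- 4 ^+ k) ^+ n.
Hypothesis w_abs : forall n, cvgn (series (fun k => `|w n k|)).
Hypothesis w_sum : forall n, series (w n) @ \oo --> (1 : R).

Let wS n k : w n.+1 k = - 4 ^+ k * w n k.
Proof. by rewrite /w exprS mulrCA. Qed.

Let sumw n (b : nat -> R) : R := limn (series (fun k => w n k * b k)).

Lemma sumw_cvg n b M : (forall k, `|b k| <= M) -> cvgn (series (fun k => w n k * b k)).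
Proof.
move=> bM; have M0 : 0 <= M := le_trans (normr_ge0 _) (bM 0%N).
apply: normed_cvg.
apply: (@series_le_cvg _ _ (fun k => M * `|w n k|)) => [k|k|k|].
- exact: normr_ge0.
- by rewrite mulr_ge0.
- by rewrite /= normrM mulrC ler_wpM2r.
have -> : series (fun k => M * `|w n k|) = fun N => M * series (fun k => `|w n k|) N.
  by apply/funext => N; rewrite /series /= mulr_sumr.
by apply: is_cvgMl_tmp.
Qed.

(** N depends on n and e but not on b: the tail of an absolutely convergent series of weights is
    uniform over bounded sequences, which makes the limits below uniform in the point. *)
Lemma sumw_tail n (e : R) : 0 < e -> exists N, forall b M, (forall k, `|b k| <= M) ->
  `|sumw n b - series (fun k => w n k * b k) N| <= e * M.
Proof.
move=> e0; set W := series (fun k => `|w n k|).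
have /cvgrPdist_le/(_ e e0)[N _ HN] := @w_abs n.
exists N => b M bM; have M0 : 0 <= M := le_trans (normr_ge0 _) (bM 0%N).
have mono m : (N <= m)%N ->
    `|series (fun k => w n k * b k) m - series (fun k => w n k * b k) N| <= e * M.
  move=> Nm; apply: (@le_trans _ _ ((W m - W N) * M)); last first.
    rewrite ler_wpM2r //; apply: le_trans (HN N (leqnn N)); apply: le_trans (ler_norm _).
    rewrite lerD2r; apply: limr_ge; first exact: @w_abs.
    exists m => // k mk; apply: nondecreasing_series => // i _ _.
  rewrite /W !sub_series_geq // mulr_suml; apply: le_trans (ler_norm_sum _ _ _) _.
  by apply: ler_sum => k _; rewrite normrM ler_wpM2l.
have cv : cvgn (series (fun k => w n k * b k)) by exact: sumw_cvg bM.
have cv2 : `|series (fun k => w n k * b k) m - series (fun k => w n k * b k) N|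
   @[m --> \oo] --> `|sumw n b - series (fun k => w n k * b k) N|.
  by apply: cvg_norm; apply: cvgB; [exact: cv|exact: cvg_cst].
by apply: (cvgr_to_le cv2); exists N.
Qed.

Lemma sumw_cst n a : sumw n (fun=> a) = a.
Proof.
apply: cvg_lim => //.
have -> : series (fun k => w n k * a) = fun N => a * series (w n) N.
  by apply/funext => N; rewrite /series /= mulr_sumr; apply: eq_bigr => k _; rewrite mulrC.
have C : (fun N => a * series (w n) N) @ \oo --> a * 1 by apply: cvgMl_tmp.
by rewrite mulr1 in C.
Qed.

Let f (e : 'rV[R]_2 -> R) k (p : 'rV[R]_2) := e (fold (4 ^+ k) p).
Let A n (e : 'rV[R]_2 -> R) p := sumw n (fun k => f e k p).

Lemma A_continuous n e p : smooth_on U e -> St p -> {for p, continuous (A n e)}.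
Proof.
move=> se Sp; have [M M0 HM] := smooth_bounded se.
have fM k q : St q -> `|f e k q| <= M by move=> Sq; apply: HM; exact: fold_norm.
apply: continuous_dist_le => eps eps0.
(* Two tails of at most eps / 4 each leave eps / 2 for the variation of the finite sum. *)
have e1 : 0 < eps / (4 * (M + 1)) by rewrite divr_gt0 // mulr_gt0 // ltr_wpDl.
have [N HN] := @sumw_tail n _ e1.
have cH : {for p, continuous (fun q => series (fun k => w n k * f e k q) N)}.
  rewrite /series /=.
  elim: N {HN} => [|N IH].
    have -> : (fun q => \sum_(0 <= k < 0) w n k * f e k q) = fun=> 0.
      by apply/funext => q; rewrite big_geq.
    exact: cst_continuous.
  have -> : (fun q => \sum_(0 <= k < N.+1) w n k * f e k q) =
      (fun q => \sum_(0 <= k < N) w n k * f e k q + w n N * f e N q).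
    by apply/funext => q; rewrite big_nat_recr.
  apply: continuousD; first exact: IH.
  apply: (@continuousM R _ (fun=> w n N)); first exact: cst_continuous.
  exact: fold_e_continuous.
have e2 : 0 < eps / 2 by rewrite divr_gt0.
have /cvgrPdist_le/(_ _ e2) := cH.
apply: filterS2 (open_nbhs_nbhs (conj oSt Sp)) => q Sq hq.
have t1 := HN _ M (fun k => fM k p Sp); have t2 := HN _ M (fun k => fM k q Sq).
have small : eps / (4 * (M + 1)) * M <= eps / 4.
  rewrite invfM mulrA -mulrA ler_piMr ?divr_ge0 ?(ltW eps0) //.
  by rewrite ler_pdivrMl ?ltr_wpDl // mulr1 lerDl.
move: t1 t2 hq; rewrite -/(A n e p) -/(A n e q).
move: (series _ N) (series _ N) => s1 s2.
rewrite !ler_norml => /andP[h1 h2] /andP[h3 h4] /andP[h5 h6].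
by apply/andP; split; lra.
Qed.

Let half_St s p : half s p -> St p. Proof. by case. Qed.

(** Differentiation under the sum for z < 0. The z-derivative of the k-th sample carries the factor
    -4^k, which passes from [w n] to [w n.+1]. *)
Lemma A_derive n e h p : smooth_on U e -> smooth_on U h ->
  (forall p, U p ->
    'D_(delta_mx 0 1) e p * (1 - p 0 1 ^+ 2 / rho ^+ 2) ^+ 2 = 2 * p 0 1 * h p) ->
  half (-1) p ->
  differentiable (A n e) p /\ forall v, 'D_v (A n e) p =
    v 0 0 * A n ('D_(delta_mx 0 0) e) p + v 0 1 * A n.+1 h p.
Proof.
move=> se sh eh hp; have Sp := half_St hp; set g := 'D_(delta_mx 0 0) e.
have sg : smooth_on U g by exact: smooth_derive.
have n1 : `|-1 : R| = 1 by rewrite normrN1.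
have l0 k : 0 < 4 ^+ k :> R by rewrite exprn_gt0.
have l1 k : 1 <= 4 ^+ k :> R by rewrite exprn_ege1 // ler1n.
have sf k : smooth_on (half (-1)) (f e k) by exact: (derive_fold (l0 k) n1 se eh).1.
have Df k q v : half (-1) q -> 'D_v (f e k) q = v 0 0 * f g k q - 4 ^+ k * (v 0 1 * f h k q).
  move=> hq; rewrite /f (derive_fold (l0 k) n1 se eh).2 //; congr (_ + _); ring.
have [Me Me0 He] := smooth_bounded se.
have [Mg Mg0 Hg] := smooth_bounded sg.
have [Mh Mh0 Hh] := smooth_bounded sh.
have fe k q : St q -> `|f e k q| <= Me by move=> Sq; apply: He; exact: fold_norm.
have fg k q : St q -> `|f g k q| <= Mg by move=> Sq; apply: Hg; exact: fold_norm.
have fh k q : St q -> `|f h k q| <= Mh by move=> Sq; apply: Hh; exact: fold_norm.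
pose M := Mg + Mh.
have M0 : 0 <= M by rewrite addr_ge0.
suff : differentiable (A n e) p /\ forall v, 'D_v (A n e) p = dot (pt (A n g p) (A n.+1 h p)) v.
  move=> [? H]; split=> // v; rewrite H /dot sum_I2 pt0 pt1.
  by rewrite mulrC [A n.+1 h p * _]mulrC.
apply: diff_of_bound => eps eps0.
(* The tail will be at most e1 (2 M |v|) and the finite part at most W e2 |v|; each is at most (eps
   / 2) |v|. *)
pose e1 := eps / (2 * (2 * M + 1)).
have M1 : 0 < 2 * M + 1 by lra.
have e10 : 0 < e1 by rewrite divr_gt0 // mulr_gt0.
have [N HN] := @sumw_tail n.+1 _ e10.
pose W := \sum_(k < N) `|w n.+1 k|.
have W0 : 0 <= W by rewrite sumr_ge0.
pose e2 := eps / (2 * (W + 1)).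
have e20 : 0 < e2 by rewrite divr_gt0 // mulr_gt0 //; lra.
have near1 : \forall v \near (0 : 'rV[R]_2), forall k : 'I_N,
    `|f e k (v + p) - f e k p - 'D_v (f e k) p| <= e2 * `|v|.
  by apply: near_forall => k; apply: diff_bound e20; exact: smooth_differentiable (sf k) hp.
have : nbhs p (half (-1)) by exact: open_nbhs_nbhs.
move=> /nbhs_ballP[d /= d0 dhalf].
have near2 : \forall v \near (0 : 'rV[R]_2), `|v| < d by exact: nbhs0_lt.
apply: filterS2 near1 near2 => v Hv vd.
have seg (t : R) : 0 <= t <= 1 -> half (-1) (p + t *: v).
  move=> /andP[t0 t1]; apply: dhalf; rewrite -ball_normE /ball_ /= opprD addrA subrr add0r.
  by rewrite normrN normrZ ger0_norm // (le_lt_trans _ vd) // ler_piMl.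
have hvp : half (-1) (v + p).
  by have := seg 1; rewrite scale1r addrC; apply; rewrite ler01 lexx.
pose B k := f e k (v + p) - f e k p - 'D_v (f e k) p.
have Dbound k q : half (-1) q -> `|'D_v (f e k) q| <= 4 ^+ k * (M * `|v|).
  move=> hq; rewrite Df //; apply: le_trans (ler_normB _ _) _.
  rewrite /M mulrDl mulrDr lerD //.
    rewrite normrM mulrC; apply: (@le_trans _ _ (Mg * `|v|)).
      by apply: ler_pM => //; [exact: fg (half_St hq)|exact: coord_le_norm].
    by rewrite ler_peMl // mulr_ge0.
  rewrite normrM gtr0_norm // ler_wpM2l ?(ltW (l0 k)) // normrM mulrC.
  by apply: ler_pM => //; [exact: fh (half_St hq)|exact: coord_le_norm].
have Bbound k : `|B k| <= 4 ^+ k * (2 * M * `|v|).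
  have tI (t : R) : 0 < t < 1 -> 0 <= t <= 1 by move=> /andP[? ?]; rewrite !ltW.
  have [t|t|t ht E] := @MVT_line _ _ (f e k) p v.
  - by move=> /tI/seg; exact: smooth_differentiable (sf k).
  - by move=> /seg; exact: smooth_continuous (sf k).
  rewrite /B [v + p]addrC E; apply: le_trans (ler_normB _ _) _.
  have := Dbound k _ (seg t (tI t ht)); have := Dbound k p hp.
  have -> : 4 ^+ k * (2 * M * `|v|) = 4 ^+ k * (M * `|v|) + 4 ^+ k * (M * `|v|) by ring.
  by move=> h1 h2; exact: lerD.
(* The first-order remainder B k is O(4^k |v|) by the mean value theorem. Divided by -4^k it is
   bounded uniformly in k, so the weights of order n + 1 make the tail small, while the finitely
   many first terms are small by differentiability. *)
pose b k := - (B k / 4 ^+ k).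
have bM k : `|b k| <= 2 * M * `|v|.
  by rewrite normrN normrM normfV [`|4 ^+ k|]gtr0_norm // ler_pdivrMr // mulrC.
have E : A n e (v + p) - A n e p - dot (pt (A n g p) (A n.+1 h p)) v = sumw n.+1 b.
  apply/esym; apply: cvg_lim => //.
  rewrite /dot sum_I2 pt0 pt1.
  have -> : series (fun k => w n.+1 k * b k) = fun m =>
      series (fun k => w n k * f e k (v + p)) m - series (fun k => w n k * f e k p) m
      - (series (fun k => w n k * f g k p) m * v 0 0
         + series (fun k => w n.+1 k * f h k p) m * v 0 1).
    apply/funext => m; rewrite /series /= !mulr_suml -!sumrB -big_split /= -sumrB.
    apply: eq_bigr => k _; rewrite /b /B wS Df //; have := l0 k.
    by move: (4 ^+ k) => l hl; field; rewrite gt_eqF.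
  have C1 : series (fun k => w n k * f e k (v + p)) @ \oo --> A n e (v + p).
    exact: (@sumw_cvg n (fun k => f e k (v + p)) Me (fun k => fe k _ (half_St hvp))).
  have C2 : series (fun k => w n k * f e k p) @ \oo --> A n e p.
    exact: (@sumw_cvg n (fun k => f e k p) Me (fun k => fe k _ Sp)).
  have C3 : series (fun k => w n k * f g k p) @ \oo --> A n g p.
    exact: (@sumw_cvg n (fun k => f g k p) Mg (fun k => fg k _ Sp)).
  have C4 : series (fun k => w n.+1 k * f h k p) @ \oo --> A n.+1 h p.
    exact: (@sumw_cvg n.+1 (fun k => f h k p) Mh (fun k => fh k _ Sp)).
  apply: cvgB; first by apply: cvgB.
  by apply: cvgD; apply: cvgMr_tmp.
have T := HN _ _ bM.
have Hd : `|series (fun k => w n.+1 k * b k) N| <= W * (e2 * `|v|).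
  rewrite /series /= big_mkord /W mulr_suml; apply: le_trans (ler_norm_sum _ _ _) _.
  apply: ler_sum => k _; rewrite normrM ler_wpM2l //.
  rewrite normrN normrM normfV [`|4 ^+ k|]gtr0_norm // ler_pdivrMr //.
  by apply: le_trans (Hv k) _; rewrite ler_peMr // mulr_ge0 // ltW.
have s1 : e1 * (2 * M * `|v|) <= eps / 2 * `|v|.
  rewrite mulrA ler_wpM2r // /e1 mulrAC ler_pdivrMr ?mulr_gt0 //.
  have -> : eps / 2 * (2 * (2 * M + 1)) = eps * (2 * M + 1) by field.
  by rewrite ler_wpM2l ?(ltW eps0) // lerDl.
have s2 : W * (e2 * `|v|) <= eps / 2 * `|v|.
  rewrite mulrA ler_wpM2r // /e2 mulrA ler_pdivrMr ?mulr_gt0 ?ltr_wpDl //.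
  have -> : eps / 2 * (2 * (W + 1)) = (W + 1) * eps by field.
  by rewrite ler_wpM2r ?(ltW eps0) // lerDl.
rewrite E; move: T Hd; move: (sumw _ b) (series _ N) => X Y.
rewrite !ler_norml => /andP[h1 h2] /andP[h3 h4].
by apply/andP; split; lra.
Qed.

(* For [n = 0] this extends [e (x, sqrt z)] from [z >= 0] to [z < 0] by
   [sum_k c_k e (x, sqrt (- 4^k z))], up to [squash]; each z-derivative raises [n]
   by one and the moment conditions on [c] make all of them match at [z = 0]. *)
Let Ext n e (p : 'rV[R]_2) := if 0 <= p 0 1 then f e 0 p else A n e p.

(** At z = 0 all samples take the value e(x, 0), and the weights of each order sum to 1: this is
    where the moment conditions enter. *)
Lemma A_flat n e (p : 'rV[R]_2) : p 0 1 = 0 -> A n e p = f e 0 p.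
Proof.
move=> p1; rewrite -[RHS](@sumw_cst n); congr (sumw n _); apply/funext => k.
by rewrite /f /fold p1 !mulr0.
Qed.

Lemma continuous_near_eq m (F G : 'rV[R]_m -> R) x : (\forall y \near x, F y = G y) ->
  {for x, continuous F} -> {for x, continuous G}.
Proof.
move=> FG cF; have E := nbhs_singleton FG; apply: continuous_dist_le => e e0.
have /cvgrPdist_le/(_ _ e0) := cF; apply: filterS2 FG => y Ey.
by rewrite E Ey.
Qed.

Let near_pos (p : 'rV[R]_2) : 0 < p 0 1 -> \forall q \near p, 0 < (q : 'rV[R]_2) 0 1.
Proof.
move=> p0; have ci : {for p, continuous (fun q : 'rV[R]_2 => q 0 1)} by exact: coord_continuous.
by apply: (ci [set z | 0 < z]); apply: open_nbhs_nbhs; split => //; exact: open_gt.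
Qed.

Let near_neg (p : 'rV[R]_2) : p 0 1 < 0 -> \forall q \near p, (q : 'rV[R]_2) 0 1 < 0.
Proof.
move=> p0; have ci : {for p, continuous (fun q : 'rV[R]_2 => q 0 1)} by exact: coord_continuous.
by apply: (ci [set z | z < 0]); apply: open_nbhs_nbhs; split => //; exact: open_lt.
Qed.

Lemma Ext_pos n e (p : 'rV[R]_2) : 0 < p 0 1 -> \forall q \near p, f e 0 q = Ext n e q.
Proof. by move/near_pos; apply: filterS => q q0; rewrite /Ext ltW. Qed.

Lemma Ext_neg n e (p : 'rV[R]_2) : p 0 1 < 0 -> \forall q \near p, A n e q = Ext n e q.
Proof. by move/near_neg; apply: filterS => q q0; rewrite /Ext leNgt q0. Qed.

Lemma Ext_continuous n e p : smooth_on U e -> St p -> {for p, continuous (Ext n e)}.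
Proof.
move=> se Sp; have cf := fold_e_continuous (l := 4 ^+ 0) se Sp.
have cA := @A_continuous n e p se Sp.
have [p0|p0|p0] := ltgtP (p 0 1) 0.
- exact: continuous_near_eq (@Ext_neg n e _ p0) cA.
- exact: continuous_near_eq (@Ext_pos n e _ p0) cf.
apply: continuous_dist_le => eps eps0.
have /cvgrPdist_le/(_ _ eps0) := cA; have /cvgrPdist_le/(_ _ eps0) := cf.
apply: filterS2 => q hf hA; rewrite /Ext p0 lexx; case: ifP => // _.
by rewrite -(@A_flat n e p p0).
Qed.

(** On z > 0 only the sample l = 1 is used, on z < 0 the whole sum. On both sides the partial
    derivatives are extensions of the same kind, and these are continuous across z = 0. *)
Lemma Ext_derive n e h p : smooth_on U e -> smooth_on U h ->
  (forall p, U p ->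
    'D_(delta_mx 0 1) e p * (1 - p 0 1 ^+ 2 / rho ^+ 2) ^+ 2 = 2 * p 0 1 * h p) ->
  St p -> differentiable (Ext n e) p /\ forall j, 'D_(delta_mx 0 j) (Ext n e) p =
    if j == 0 then Ext n ('D_(delta_mx 0 0) e) p else Ext n.+1 h p.
Proof.
move=> se sh eh; set g := 'D_(delta_mx 0 0) e.
have sg : smooth_on U g by exact: smooth_derive.
have off q : St q -> q 0 1 != 0 -> differentiable (Ext n e) q /\
    forall j, 'D_(delta_mx 0 j) (Ext n e) q = if j == 0 then Ext n g q else Ext n.+1 h q.
  move=> Sq; rewrite neq_lt => /orP[q0|q0].
    have hq : half (-1) q by split=> //; rewrite mulN1r oppr_gt0.
    have [dA DA] := @A_derive n e h q se sh eh hq.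
    split; first exact: differentiable_near_eq (@Ext_neg n e _ q0) dA.
    move=> j; rewrite -(near_eq_derive _ (@Ext_neg n e _ q0)) DA /Ext leNgt q0 /=.
    rewrite !mxE !eqxx /=; move: j; apply: forall_I2; first by rewrite /= mul1r mul0r addr0.
    by rewrite /= mul1r mul0r add0r.
  have hq : half 1 q by split=> //; rewrite mul1r.
  have [sf Df] := derive_fold (l := 4 ^+ 0) (s := 1) ltr01 (normr1 _) se eh.
  split; first exact: differentiable_near_eq (@Ext_pos n e _ q0) (smooth_differentiable sf hq).
  move=> j; rewrite -(near_eq_derive _ (@Ext_pos n e _ q0)) Df // /Ext (ltW q0).
  rewrite !mxE !eqxx /= !mul1r; move: j; apply: forall_I2.
    by rewrite /= mul1r mul0r addr0.
  by rewrite /= mul1r mul0r add0r.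
move=> Sp; have [p0|] := eqVneq (p 0 1) 0; last exact: off.
have nS := open_nbhs_nbhs (conj oSt Sp).
pose G j := fun q => if j == 0 :> 'I_2 then Ext n g q else Ext n.+1 h q.
have [||j|df Df] := @removable_hyperplane _ _ 1 (Ext n e) G p.
- by apply: filterS nS => q; exact: Ext_continuous.
- by apply: filterS nS => q Sq; rewrite p0; exact: off.
- by rewrite /G; case: eqP => _; exact: Ext_continuous.
split=> // j; rewrite Df sum_I2 !mxE !eqxx /= /G /=.
by move: j; apply: forall_I2; rewrite /= ?mul1r ?mul0r ?addr0 ?add0r.
Qed.

Lemma smooth_Ext e : even_fun e -> smooth_on St (Ext 0 e).
Proof.
move=> ee.
apply: (@smooth_family _ _ St [set F | exists n e, even_fun e /\ F = Ext n e]); last first.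
  by exists 0%N, e.
move=> _ {e ee} [n [e [ee ->]]]; have [h eh hE] := even_dy ee.
have key p : St p -> _ := @Ext_derive n e h p ee.1 eh.1 hE.
split=> [p /key[]//|j].
exists (if j == 0 then Ext n ('D_(delta_mx 0 0) e) else Ext n.+1 h).
  apply: SpanBase; case: eqP => _; last by exists n.+1, h.
  by exists n, ('D_(delta_mx 0 0) e); split=> //; exact: even_dx.
by move=> p /key[_ ->]; case: eqP.
Qed.

Lemma even_factor_aux e : even_fun e -> exists2 d, 0 < d & exists2 a,
  smooth_on (ball 0 d) a &
  \forall p \near (0 : 'rV[R]_2), e p = a (pt (p 0 0) (p 0 1 ^+ 2)).
Proof.
move=> ee; pose d := Num.min rho (rho ^+ 2).
have d0 : 0 < d by rewrite lt_min rho0 rho2.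
have db p : ball 0 d p -> St p /\ 0 < 1 - p 0 1 / rho ^+ 2.
  rewrite -ball_normE /ball_ /= sub0r normrN /d lt_min => /andP[h1 h2]; split.
    by apply: le_lt_trans h1; exact: coord_le_norm.
  rewrite subr_gt0 ltr_pdivrMr // mul1r; apply: le_lt_trans h2.
  by apply: le_trans (coord_le_norm _ _); exact: ler_norm.
exists d => //.
(* The map z |-> z / (1 - z / rho^2) is the inverse of [squash] for 0 <= z < rho^2. *)
exists (fun p => Ext 0 e (pt (p 0 0) (p 0 1 / (1 - p 0 1 / rho ^+ 2)))).
  apply: (smooth_comp oSt (smooth_Ext ee)).
    apply: smooth_pt; first exact: smooth_coord.
    apply: smooth_mul; first exact: smooth_coord.
    apply: smooth_inv.
      apply: smooth_sub; first exact: smooth_cst.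
      by apply: smooth_mul; [exact: smooth_coord|exact: smooth_cst].
    by move=> p /db[_ h]; rewrite gt_eqF.
  by move=> p /db[h _]; rewrite /St /= pt0.
have : \forall p \near (0 : 'rV[R]_2), ball 0 rho p by exact: nbhsx_ballx.
apply: filterS => p; rewrite -ball_normE /ball_ /= sub0r normrN => pr.
rewrite !pt0 !pt1; set y := p 0 1.
have yr : `|y| < rho by apply: le_lt_trans pr; exact: coord_le_norm.
have y2 : y ^+ 2 < rho ^+ 2 by rewrite -real_normK ?num_real // ltrXn2r ?nnegrE // ltW.
have den : 0 < 1 - y ^+ 2 / rho ^+ 2 by rewrite subr_gt0 ltr_pdivrMr // mul1r.
have s0 : 0 <= y ^+ 2 / (1 - y ^+ 2 / rho ^+ 2) by rewrite divr_ge0 ?sqr_ge0 // ltW.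
rewrite /Ext pt1 s0 /f /fold pt0 pt1 expr0 mul1r.
have -> : squash (y ^+ 2 / (1 - y ^+ 2 / rho ^+ 2)) = y ^+ 2.
  rewrite /squash ger0_norm //; have h := rho2; move: den; move: (rho ^+ 2) h y2 => k k0.
  move: (y ^+ 2) => z zk den.
  have kz : k - z != 0 by rewrite subr_eq0 gt_eqF.
  by field; rewrite kz gt_eqF //=; apply/eqP; lra.
have Up : U (pt (p 0 0) y).
  by rewrite -pt_eta; apply/UP; rewrite (lt_trans pr) // /rho ltr_pdivrMr // ltr_pMr // ltr1n.
rewrite sqrtr_sqr {1}(pt_eta p) -/y; case: (ger0P y) => // _.
by rewrite ee.2.
Qed.

End EvenFunctions.

Lemma even_factor (R : realType) (r : R) (e : 'rV[R]_2 -> R) : 0 < r ->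
  even_fun r e -> exists2 d, 0 < d & exists2 a,
  smooth_on (ball (0 : 'rV[R]_2) d) a &
  \forall p \near (0 : 'rV[R]_2), e p = a (pt (p 0 0) (p 0 1 ^+ 2)).
Proof.
move=> r0 ee; have [c Hc] := @alternating_weights R.
apply: (even_factor_aux r0 (c := c)) => // n; by have [] := Hc n.
Qed.

(** * Asymptotics and quadratic forms at the origin *)

Section Asymptotics.
Context {R : realType}.
Implicit Types (m n : nat).

Definition is_bigO m n (h : 'rV[R]_m -> R) : Prop :=
  exists2 C, 0 <= C & \forall p \near (0 : 'rV[R]_m), `|h p| <= C * `|p| ^+ n.

Definition is_littleo m n (h : 'rV[R]_m -> R) : Prop :=
  forall e : R, 0 < e -> \forall p \near (0 : 'rV[R]_m), `|h p| <= e * `|p| ^+ n.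

Lemma is_littleo_near m n (g h : 'rV[R]_m -> R) :
  (\forall p \near (0 : 'rV[R]_m), g p = h p) -> is_littleo n g -> is_littleo n h.
Proof.
by move=> gh og e e0; have := og e e0; apply: filterS2 gh => p ->.
Qed.

Lemma is_littleo_is_bigO m n (h : 'rV[R]_m -> R) : is_littleo n h -> is_bigO n h.
Proof. by move=> oh; exists 1 => //; exact: oh. Qed.

Lemma is_bigO_lt m n (h : 'rV[R]_m -> R) : is_bigO n.+1 h -> is_littleo n h.
Proof.
move=> [C C0 HC] e e0; have C1 : 0 < C + 1 by rewrite ltr_wpDl.
have small : \forall p \near (0 : 'rV[R]_m), `|p| < e / (C + 1).
  by apply: nbhs0_lt; rewrite divr_gt0.
apply: filterS2 HC small => p h1 h2; apply: (le_trans h1).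
rewrite exprSr mulrA mulrAC ler_wpM2r ?exprn_ge0 //.
have : `|p| * (C + 1) <= e by rewrite -ler_pdivlMr // ltW.
by apply: le_trans; rewrite mulrDr mulr1 mulrC lerDl.
Qed.

Lemma is_bigO_le m k n (h : 'rV[R]_m -> R) : (k <= n)%N -> is_bigO n h -> is_bigO k h.
Proof.
move=> kn [C C0 HC]; exists C => //.
have small : \forall p \near (0 : 'rV[R]_m), `|p| < 1 by exact: nbhs0_lt.
apply: filterS2 HC small => p h1 p1; apply: (le_trans h1).
by rewrite ler_wpM2l // ler_wiXn2l // ltW.
Qed.

Lemma is_littleo_add m n (g h : 'rV[R]_m -> R) :
  is_littleo n g -> is_littleo n h -> is_littleo n (fun p => g p + h p).
Proof.
move=> og oh e e0; have e20 : 0 < e / 2 by rewrite divr_gt0.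
apply: filterS2 (og _ e20) (oh _ e20) => p h1 h2.
by apply: le_trans (ler_normD _ _) _; rewrite [e in leRHS]splitr mulrDl lerD.
Qed.

Lemma is_bigO_add m n (g h : 'rV[R]_m -> R) :
  is_bigO n g -> is_bigO n h -> is_bigO n (fun p => g p + h p).
Proof.
move=> [C C0 HC] [D D0 HD]; exists (C + D); first exact: addr_ge0.
apply: filterS2 HC HD => p h1 h2.
by apply: le_trans (ler_normD _ _) _; rewrite mulrDl lerD.
Qed.

Lemma is_bigO_mul m k n (g h : 'rV[R]_m -> R) :
  is_bigO k g -> is_bigO n h -> is_bigO (k + n) (fun p => g p * h p).
Proof.
move=> [C C0 HC] [D D0 HD]; exists (C * D); first exact: mulr_ge0.
apply: filterS2 HC HD => p h1 h2.
by rewrite normrM exprD mulrACA ler_pM.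
Qed.

Lemma is_littleo_mul m k n (g h : 'rV[R]_m -> R) :
  is_bigO k g -> is_littleo n h -> is_littleo (k + n) (fun p => g p * h p).
Proof.
move=> [C C0 HC] oh e e0; have C1 : 0 < C + 1 by rewrite ltr_wpDl.
have e1 : 0 < e / (C + 1) by rewrite divr_gt0.
apply: filterS2 HC (oh _ e1) => p h1 h2.
rewrite normrM exprD; apply: (@le_trans _ _ (C * `|p| ^+ k * (e / (C + 1) * `|p| ^+ n))).
  by rewrite ler_pM.
rewrite mulrACA ler_wpM2r ?mulr_ge0 ?exprn_ge0 //.
by rewrite mulrA ler_pdivrMr // mulrC ler_wpM2l ?(ltW e0) // lerDl.
Qed.

Lemma is_littleo_mulr m k n (g h : 'rV[R]_m -> R) :
  is_littleo k g -> is_bigO n h -> is_littleo (k + n) (fun p => g p * h p).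
Proof.
by move=> og oh; rewrite addnC; under eq_fun do rewrite mulrC; exact: is_littleo_mul.
Qed.

Lemma is_bigO_cst m (c : R) : @is_bigO m 0 (fun=> c).
Proof. by exists `|c| => //; near=> p; rewrite expr0 mulr1.
Unshelve. all: by end_near. Qed.

Lemma is_littleo_opp m n (h : 'rV[R]_m -> R) : is_littleo n h -> is_littleo n (fun p => - h p).
Proof. by move=> oh e e0; apply: filterS (oh e e0) => p; rewrite normrN. Qed.

Lemma is_littleo_sub m n (g h : 'rV[R]_m -> R) :
  is_littleo n g -> is_littleo n h -> is_littleo n (fun p => g p - h p).
Proof. by move=> og oh; apply: is_littleo_add => //; exact: is_littleo_opp. Qed.

Lemma is_bigO_sub m n (g h : 'rV[R]_m -> R) :
  is_bigO n g -> is_bigO n h -> is_bigO n (fun p => g p - h p).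
Proof.
move=> og [C C0 HC]; apply: is_bigO_add => //; exists C => //.
by apply: filterS HC => p; rewrite normrN.
Qed.

Lemma is_bigO_sum m n (I : Type) (r : seq I) (h : I -> 'rV[R]_m -> R) :
  (forall i, is_bigO n (h i)) -> is_bigO n (fun p => \sum_(i <- r) h i p).
Proof.
move=> H; elim: r => [|i r IH].
  exists 0 => //; near=> p; rewrite big_nil normr0 mul0r //.
under eq_fun do rewrite big_cons; exact: is_bigO_add.
Unshelve. all: by end_near. Qed.

Lemma cvg0_is_littleo m (h : 'rV[R]_m -> R) : {for 0, continuous h} -> h 0 = 0 -> is_littleo 0 h.
Proof.
move=> hc h0 e e0; have /cvgrPdist_le/(_ e e0) := hc.
by apply: filterS => p; rewrite h0 sub0r normrN expr0 mulr1.
Qed.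

Lemma continuous_is_bigO m (h : 'rV[R]_m -> R) : {for 0, continuous h} -> is_bigO 0 h.
Proof.
move=> hc; exists (`|h 0| + 1); first by rewrite addr_ge0.
have /cvgrPdist_le/(_ 1 ltr01) := hc; apply: filterS => p hp.
rewrite expr0 mulr1 -[h p](subrK (h 0)) addrC; apply: le_trans (ler_normD _ _) _.
by rewrite lerD2l distrC.
Qed.

Lemma coord_is_bigO m i : is_bigO 1 (fun p : 'rV[R]_m => p 0 i).
Proof. by exists 1 => //; near=> p; rewrite mul1r expr1 coord_le_norm.
Unshelve. all: by end_near. Qed.

Lemma diff_is_littleo m (h : 'rV[R]_m -> R) : differentiable h 0 ->
  is_littleo 1 (fun p => h p - h 0 - 'D_p h 0).
Proof.
move=> dh e e0; have := diff_bound dh e0; apply: filterS => p.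
by rewrite addr0 expr1.
Qed.

Lemma derive_is_bigO m (h : 'rV[R]_m -> R) : differentiable h 0 -> is_bigO 1 (fun p => 'D_p h 0).
Proof.
move=> dh; under eq_fun do rewrite derive_basis //.
apply: is_bigO_sum => i; apply: (@is_bigO_mul _ 1 0); [exact: coord_is_bigO|exact: is_bigO_cst].
Qed.

Lemma diff_is_bigO m (h : 'rV[R]_m -> R) : differentiable h 0 -> h 0 = 0 -> is_bigO 1 h.
Proof.
move=> dh h0; have E : h = fun p => (h p - h 0 - 'D_p h 0) + 'D_p h 0.
  by apply/funext => p; rewrite h0 subr0 subrK.
by rewrite E; apply: is_bigO_add; [exact/is_littleo_is_bigO/diff_is_littleo|exact: derive_is_bigO].
Qed.

Lemma prod_lin m (k b : 'rV[R]_m -> R) : differentiable k 0 -> differentiable b 0 ->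
  b 0 = 0 -> is_littleo 1 (fun p => k p * b p - k 0 * 'D_p b 0).
Proof.
move=> dk db b0.
have E : (fun p => k p * b p - k 0 * 'D_p b 0) =
  fun p => k p * (b p - b 0 - 'D_p b 0) + (k p - k 0) * 'D_p b 0.
  by apply/funext => p; rewrite b0; ring.
rewrite E; apply: is_littleo_add.
  by apply: (@is_littleo_mul _ 0 1); [apply/continuous_is_bigO/differentiable_continuous|exact: diff_is_littleo].
apply: is_bigO_lt; apply: (@is_bigO_mul _ 1 1); last exact: derive_is_bigO.
apply: diff_is_bigO; last by rewrite subrr.
exact: (differentiableB (f := k : _ -> R^o)).
Qed.

Lemma ray_near m (P : 'rV[R]_m -> Prop) (u : 'rV[R]_m) :
  (\forall p \near (0 : 'rV[R]_m), P p) -> exists2 d, 0 < d & forall s : R, `|s| < d -> P (s *: u).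
Proof.
move=> /nbhs_ballP[d /= d0 H]; have u1 : 0 < `|u| + 1 by rewrite ltr_wpDl.
exists (d / (`|u| + 1)); first by rewrite divr_gt0.
move=> s sd; apply: H; rewrite -ball_normE /ball_ /= sub0r normrN normrZ.
have : `|s| * (`|u| + 1) < d by rewrite -ltr_pdivlMr.
by apply: le_lt_trans; rewrite ler_wpM2l // lerDl.
Qed.

Lemma le_eps_eq0 (x C : R) : (forall e, 0 < e -> `|x| <= e * C) -> x = 0.
Proof.
move=> H; have C0 : 0 <= C by have := le_trans (normr_ge0 _) (H 1 ltr01); rewrite mul1r.
apply/eqP; rewrite -normr_le0; apply/ler_addgt0Pr => e e0; rewrite add0r.
have C1 : 0 < C + 1 by rewrite ltr_wpDl.
have e1 : 0 < e / (C + 1) by rewrite divr_gt0.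
apply: le_trans (H _ e1) _.
by rewrite mulrAC ler_pdivrMr // ler_wpM2l ?(ltW e0) // lerDl.
Qed.

Lemma is_littleo1_linear0 m (l : 'rV[R]_m -> R) (u : 'rV[R]_m) :
  (forall s, l (s *: u) = s * l u) -> is_littleo 1 l -> l u = 0.
Proof.
move=> lZ ol; apply: (@le_eps_eq0 _ `|u|) => e e0.
have [d d0 H] := ray_near u (ol e e0).
have [s s0 sd] : exists2 s : R, 0 < s & `|s| < d.
  exists (d / 2); first by rewrite divr_gt0.
  by rewrite gtr0_norm ?divr_gt0 // ltr_pdivrMr // ltr_pMr // ltr1n.
have := H _ sd; rewrite lZ expr1 normrM normrZ (gtr0_norm s0) mulrCA.
by rewrite ler_pM2l.
Qed.

(** The value at 0 gives k; comparing s with -s separates the linear term from the quadratic one. *)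
Lemma is_littleo2_poly0 m (h : 'rV[R]_m -> R) (u : 'rV[R]_m) (k l q : R) :
  (forall s : R, h (s *: u) = k + s * l + s ^+ 2 * q) -> is_littleo 2 h -> [/\ k = 0, l = 0 & q = 0].
Proof.
move=> hE oh.
have k0 : k = 0.
  apply: (@le_eps_eq0 _ 0) => e e0; have [d d0 H] := ray_near u (oh e e0).
  by have := H 0; rewrite normr0 => /(_ d0); rewrite hE scale0r normr0 !mul0r !addr0 expr0n /= mul0r addr0.
have key e : 0 < e -> exists2 s : R, 0 < s /\ s < e & `|l| <= s * `|u| ^+ 2 * e /\ `|q| <= e * `|u| ^+ 2.
  move=> e0; have [d d0 H] := ray_near u (oh e e0).
  pose s := Num.min (d / 2) (e / 2).
  have s0 : 0 < s by rewrite lt_min !divr_gt0.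
  have half (x : R) : 0 < x -> x / 2 < x by move=> x0; rewrite ltr_pdivrMr // ltr_pMr // ltr1n.
  have sd : s < d by rewrite (le_lt_trans _ (half _ d0)) // ge_min lexx.
  have se : s < e by rewrite (le_lt_trans _ (half _ e0)) // ge_min lexx orbT.
  exists s => //.
  have h1 := H s; have h2 := H (- s); rewrite normrN gtr0_norm // in h1 h2.
  have {}h1 := h1 sd; have {}h2 := h2 sd.
  move: h1 h2; rewrite !hE k0 !add0r !normrZ normrN (gtr0_norm s0) sqrrN exprMn.
  move: (`|u| ^+ 2) (sqr_ge0 `|u|) => U U0.
  rewrite !ler_norml => /andP[a1 a2] /andP[b1 b2].
  have s20 : 0 < s ^+ 2 by rewrite exprn_gt0.
  split.
    by apply/andP; split; rewrite -(ler_pM2l s0); rewrite expr2 in a1 a2 b1 b2; lra.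
  by apply/andP; split; rewrite -(ler_pM2l s20); lra.
split=> //.
  apply: (@le_eps_eq0 _ (`|u| ^+ 2)) => e e0.
  have e10 : 0 < Num.min e 1 by rewrite lt_min e0 ltr01.
  have [s [s0 se] [hl _]] := key _ e10; apply: (le_trans hl).
  rewrite mulrAC ler_wpM2r ?sqr_ge0 //.
  move: se; rewrite lt_min => /andP[se s1].
  by rewrite -[leRHS]mul1r ler_pM ?(ltW s0) ?(ltW s1) ?ge_min ?lexx // ltW.
apply: (@le_eps_eq0 _ (`|u| ^+ 2)) => e e0.
by have [s _ []] := key e e0.
Qed.

End Asymptotics.

(** * Second-order expansions and the sign of their determinant *)

Section QuadraticForms.
Context {R : realType}.
Local Notation e0 := (delta_mx 0 0 : 'rV[R]_2).
Local Notation e1 := (delta_mx 0 1 : 'rV[R]_2).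

(* Gives opaque names to terms that unification should not compare. *)
Lemma ex_eq (T : Type) (x : T) : exists y, y = x.
Proof. by exists x. Qed.

Lemma det_mx2 (A : 'M[R]_2) : \det A = A 0 0 * A 1 1 - A 0 1 * A 1 0.
Proof.
rewrite (expand_det_row A 0) sum_I2 /cofactor !det_mx11 !mxE /=.
rewrite (_ : lift 0 0 = 1 :> 'I_2); last exact/val_inj.
rewrite (_ : lift 1 0 = 0 :> 'I_2); last exact/val_inj.
by rewrite expr0 mul1r expr1 mulN1r mulrN.
Qed.

Definition quad (a b c : R) (p : 'rV[R]_2) : R :=
  a * p 0 0 ^+ 2 + 2 * b * (p 0 0 * p 0 1) + c * p 0 1 ^+ 2.

Definition qform (h : 'rV[R]_2 -> R) (a b c : R) : Prop :=
  is_littleo 2 (fun p => h p - quad a b c p).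

(** For s = 1 or -1 this says that h has neither constant nor linear term and that the determinant
    of its quadratic part has the sign of s. Stated by an expansion and not by derivatives, it
    applies to products and composites with factors that are only continuous or differentiable at
    0. *)
Definition qform_sign (s : R) (h : 'rV[R]_2 -> R) : Prop :=
  exists a b c, qform h a b c /\ 0 < s * (a * c - b ^+ 2).

Lemma quad_is_bigO a b c : is_bigO 2 (quad a b c).
Proof.
have x i j : is_bigO 2 (fun p : 'rV[R]_2 => p 0 i * p 0 j).
  by apply: (@is_bigO_mul _ _ 1 1); exact: coord_is_bigO.
rewrite /quad; under eq_fun do rewrite !expr2.
have t k i j : is_bigO 2 (fun p : 'rV[R]_2 => k * (p 0 i * p 0 j)).
  by apply: (@is_bigO_mul _ _ 0 2); [exact: is_bigO_cst|exact: x].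
by apply: is_bigO_add; [apply: is_bigO_add|]; exact: t.
Qed.

Lemma quad_unique (k l0 l1 a b c : R) :
  is_littleo 2 (fun p => k + (l0 * p 0 0 + l1 * p 0 1) + quad a b c p) ->
  [/\ k = 0, l0 = 0 & l1 = 0] /\ [/\ a = 0, b = 0 & c = 0].
Proof.
set h := (fun p => _) => oh.
have hE (x y s : R) : h (s *: pt x y) =
    k + s * (l0 * x + l1 * y) + s ^+ 2 * (a * x ^+ 2 + 2 * b * (x * y) + c * y ^+ 2).
  by rewrite /h /quad !mxE /=; ring.
have [h1 h2 h3] := is_littleo2_poly0 (hE 1 0) oh.
have [h4 h5 h6] := is_littleo2_poly0 (hE 0 1) oh.
have [h7 h8 h9] := is_littleo2_poly0 (hE 1 1) oh.
by split; split; lra.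
Qed.

Lemma qform_sign_near s (g h : 'rV[R]_2 -> R) :
  (\forall p \near (0 : 'rV[R]_2), g p = h p) -> qform_sign s g -> qform_sign s h.
Proof.
move=> gh [a [b [c [q d]]]]; exists a, b, c; split=> //.
by apply: is_littleo_near q; apply: filterS gh => p ->.
Qed.

Lemma qform_sign_add s (g h : 'rV[R]_2 -> R) : is_littleo 2 g -> qform_sign s h ->
  qform_sign s (fun p => h p + g p).
Proof.
move=> og [a [b [c [q d]]]]; exists a, b, c; split=> //.
have E : (fun p => h p + g p - quad a b c p) = fun p => (h p - quad a b c p) + g p.
  by apply/funext => p; rewrite addrAC.
by rewrite /qform E; exact: is_littleo_add.
Qed.

Lemma qform_sign_is_bigO s h : qform_sign s h -> is_bigO 2 h.
Proof.
move=> [a [b [c [q _]]]]; have E : h = fun p => (h p - quad a b c p) + quad a b c p.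
  by apply/funext => p; rewrite subrK.
by rewrite E; apply: is_bigO_add; [exact: is_littleo_is_bigO|exact: quad_is_bigO].
Qed.

(** The quadratic part is multiplied by k(0), hence its determinant by k(0)^2, and the sign of k(0)
    does not matter. *)
Lemma qform_sign_mul s (k h : 'rV[R]_2 -> R) : {for 0, continuous k} -> k 0 != 0 ->
  qform_sign s h -> qform_sign s (fun p => k p * h p).
Proof.
move=> kc k0 [a [b [c [q d]]]]; exists (k 0 * a), (k 0 * b), (k 0 * c); split.
  have E : (fun p => k p * h p - quad (k 0 * a) (k 0 * b) (k 0 * c) p) =
      fun p => k p * (h p - quad a b c p) + (k p - k 0) * quad a b c p.
    by apply/funext => p; rewrite /quad; ring.
  rewrite /qform E; apply: is_littleo_add.
    by apply: (@is_littleo_mul _ _ 0 2) => //; exact: continuous_is_bigO.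
  apply: (@is_littleo_mulr _ _ 0 2); last exact: quad_is_bigO.
  apply: cvg0_is_littleo; last by rewrite subrr.
  by apply: continuousB => //; exact: cst_continuous.
rewrite (_ : _ * _ = k 0 ^+ 2 * (s * (a * c - b ^+ 2))); last by ring.
by rewrite mulr_gt0 // exprn_even_gt0.
Qed.

Lemma norm_is_bigO m n (F : 'rV[R]_m -> 'rV[R]_n) : differentiable F 0 -> F 0 = 0 ->
  is_bigO 1 (fun p => `|F p|).
Proof.
move=> dF F0.
have FO j : is_bigO 1 (fun p => F p 0 j).
  by apply: diff_is_bigO; [exact: differentiable_comp_coord|rewrite F0 mxE].
have [C C0 HC] : is_bigO 1 (fun p => \sum_j `|F p 0 j|).
  by apply: is_bigO_sum => j; have [C C0 HC] := FO j; exists C => //; apply: filterS HC => p;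
    rewrite normr_id.
exists C => //; apply: filterS HC => p; rewrite normr_id; apply: le_trans.
rewrite ger0_norm ?sumr_ge0 //; apply: norm_rV_le; first exact: sumr_ge0.
by move=> j; rewrite (bigD1 j) //= lerDl sumr_ge0.
Qed.

Lemma is_littleo_comp m n k (h : 'rV[R]_n -> R) (F : 'rV[R]_m -> 'rV[R]_n) :
  differentiable F 0 -> F 0 = 0 -> is_littleo k h -> is_littleo k (fun p => h (F p)).
Proof.
move=> dF F0 oh; have [C C0 HC] := norm_is_bigO dF F0.
move=> e e0; have C1 : 0 < C ^+ k + 1 by rewrite ltr_wpDl // exprn_ge0.
have e10 : 0 < e / (C ^+ k + 1) by rewrite divr_gt0.
have cF : {for 0, continuous F} by exact: differentiable_continuous.
have nF : \forall p \near (0 : 'rV[R]_m), `|h (F p)| <= e / (C ^+ k + 1) * `|F p| ^+ k.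
  by move: (cF); rewrite /prop_for /continuous_at F0 => /(_ _ (oh _ e10)).
apply: filterS2 nF HC => p h1; rewrite normr_id expr1 => h2.
apply: (le_trans h1); apply: (@le_trans _ _ (e / (C ^+ k + 1) * (C * `|p|) ^+ k)).
  by rewrite ler_wpM2l ?(ltW e10) // lerXn2r ?nnegrE // mulr_ge0.
rewrite exprMn mulrA ler_wpM2r ?exprn_ge0 // mulrAC ler_pdivrMr //.
by rewrite ler_wpM2l ?(ltW e0) // lerDl.
Qed.

(** Since h has no linear part, only the first-order part of F enters at second order; the symmetric
    matrix S of the form becomes J S J^T, with J = [jac F 0]. *)
Lemma qform_sign_comp s (h : 'rV[R]_2 -> R) (F : 'rV[R]_2 -> 'rV[R]_2) :
  differentiable F 0 -> F 0 = 0 -> \det (jac F 0) != 0 ->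
  qform_sign s h -> qform_sign s (fun p => h (F p)).
Proof.
move=> dF F0 dJ [a [b [c [q d]]]].
have dFi i := differentiable_comp_coord i dF.
pose l i (p : 'rV[R]_2) := 'D_p (fun y => F y 0 i) 0.
have lE i p : l i p = p 0 0 * jac F 0 0 i + p 0 1 * jac F 0 1 i.
  by rewrite /l derive_basis // sum_I2 !jacE.
set J := jac F 0 in dJ lE.
have lO i : is_bigO 1 (l i) by exact: derive_is_bigO.
have Fl i : is_littleo 1 (fun p => F p 0 i - l i p).
  by have := diff_is_littleo (dFi i); under eq_fun do rewrite F0 mxE subr0.
have FO i : is_bigO 1 (fun p => F p 0 i).
  have E : (fun p => F p 0 i) = fun p => (F p 0 i - l i p) + l i p.
    by apply/funext => p; rewrite subrK.
  by rewrite E; apply: is_bigO_add => //; exact: is_littleo_is_bigO.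
have prod i j : is_littleo 2 (fun p => F p 0 i * F p 0 j - l i p * l j p).
  have E : (fun p => F p 0 i * F p 0 j - l i p * l j p) =
      fun p => F p 0 i * (F p 0 j - l j p) + (F p 0 i - l i p) * l j p.
    by apply/funext => p; ring.
  by rewrite E; apply: is_littleo_add; [exact: (@is_littleo_mul _ _ 1 1)|exact: (@is_littleo_mulr _ _ 1 1)].
have step1 : is_littleo 2 (fun p => h (F p) - quad a b c (F p)).
  exact: is_littleo_comp q.
pose A := a * J 0 0 ^+ 2 + 2 * b * (J 0 0 * J 0 1) + c * J 0 1 ^+ 2.
pose B := a * (J 0 0 * J 1 0) + b * (J 0 0 * J 1 1 + J 1 0 * J 0 1) + c * (J 0 1 * J 1 1).
pose C := a * J 1 0 ^+ 2 + 2 * b * (J 1 0 * J 1 1) + c * J 1 1 ^+ 2.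
exists A, B, C; split.
  have E : (fun p => h (F p) - quad A B C p) = fun p => (h (F p) - quad a b c (F p)) +
     (a * (F p 0 0 * F p 0 0 - l 0 p * l 0 p) +
      2 * b * (F p 0 0 * F p 0 1 - l 0 p * l 1 p) +
      c * (F p 0 1 * F p 0 1 - l 1 p * l 1 p)).
    by apply/funext => p; rewrite !lE /quad /A /B /C; ring.
  rewrite /qform E; apply: is_littleo_add => //.
  have t k i j : is_littleo 2 (fun p => k * (F p 0 i * F p 0 j - l i p * l j p)).
    by apply: (@is_littleo_mul _ _ 0 2) => //; exact: is_bigO_cst.
  by apply: is_littleo_add; [apply: is_littleo_add|]; exact: t.
rewrite (_ : _ * _ = (\det J) ^+ 2 * (s * (a * c - b ^+ 2))).
  by rewrite mulr_gt0 // exprn_even_gt0.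
by rewrite det_mx2 /A /B /C; ring.
Qed.

Lemma norm_scale_le m (p : 'rV[R]_m) (t : R) : 0 <= t <= 1 -> `|t *: p| <= `|p|.
Proof. by move=> /andP[t0 t1]; rewrite normrZ ger0_norm // ler_piMl. Qed.

Lemma segment_ball m d (p : 'rV[R]_m) (t : R) : ball 0 d p -> 0 <= t <= 1 ->
  ball 0 d (0 + t *: p).
Proof.
move=> /ballP pd t01; apply/ballP; rewrite add0r; apply: le_lt_trans pd.
exact: norm_scale_le.
Qed.

Lemma ler_norm_prod (x y n k e : R) : 0 <= e -> `|x| <= n -> `|y| <= e * k -> k <= n ->
  `|x * y| <= e * n ^+ 2.
Proof.
move=> e0 xn yk kn; rewrite normrM expr2 mulrCA ler_pM //.
by apply: (le_trans yk); rewrite ler_wpM2l.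
Qed.

(** The partial derivatives of the error are o(|p|) because those of h are differentiable at 0; the
    mean value theorem between 0 and p gains one more order. *)
Lemma taylor2 (U : set 'rV[R]_2) (h : 'rV[R]_2 -> R) : open U -> U 0 -> smooth_on U h ->
  is_littleo 2 (fun p => h p - (h 0 + ('D_e0 h 0 * p 0 0 + 'D_e1 h 0 * p 0 1) +
     quad ('D_e0 ('D_e0 h) 0 / 2) ('D_e0 ('D_e1 h) 0 / 2) ('D_e1 ('D_e1 h) 0 / 2) p)).
Proof.
move=> oU U0 sh; set a := 'D_e0 ('D_e0 h) 0; set b := 'D_e0 ('D_e1 h) 0.
set c := 'D_e1 ('D_e1 h) 0; set psi := (fun p => _).
have bE : 'D_e1 ('D_e0 h) 0 = b by exact: derive_comm oU sh U0.
pose T (p : 'rV[R]_2) := h 0 + ('D_e0 h 0 * p 0 0 + 'D_e1 h 0 * p 0 1) +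
     quad (a / 2) (b / 2) (c / 2) p.
have psiE : psi = fun p => h p - T p by [].
have sx i : smooth_on U (fun p : 'rV[R]_2 => p 0 i) by exact: smooth_coord.
have sc (k : R) : smooth_on U (fun=> k) by exact: smooth_cst.
have s1 : smooth_on U (fun p : 'rV[R]_2 => 'D_e0 h 0 * p 0 0) by exact: smooth_mul.
have s2 : smooth_on U (fun p : 'rV[R]_2 => 'D_e1 h 0 * p 0 1) by exact: smooth_mul.
have q1 : smooth_on U (fun p : 'rV[R]_2 => p 0 0 ^+ 2) by exact: smooth_exp.
have q2 : smooth_on U (fun p : 'rV[R]_2 => p 0 0 * p 0 1) by exact: smooth_mul.
have q3 : smooth_on U (fun p : 'rV[R]_2 => p 0 1 ^+ 2) by exact: smooth_exp.
have t1 : smooth_on U (fun p : 'rV[R]_2 => a / 2 * p 0 0 ^+ 2) by exact: smooth_mul.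
have t2 : smooth_on U (fun p : 'rV[R]_2 => 2 * (b / 2) * (p 0 0 * p 0 1)) by exact: smooth_mul.
have t3 : smooth_on U (fun p : 'rV[R]_2 => c / 2 * p 0 1 ^+ 2) by exact: smooth_mul.
have t12 := smooth_add t1 t2; have sq := smooth_add t12 t3.
have s12 := smooth_add s1 s2; have s012 := smooth_add (sc (h 0)) s12.
have sT : smooth_on U T by exact: smooth_add s012 sq.
have DT v p : U p -> 'D_v T p = v 0 0 * ('D_e0 h 0 + p 0 0 * a + p 0 1 * b) +
    v 0 1 * ('D_e1 h 0 + p 0 0 * b + p 0 1 * c).
  move=> Up; rewrite /T /quad.
  rewrite (derive_smoothD v s012 sq Up) (derive_smoothD v (sc _) s12 Up) derive_cst0.
  rewrite (derive_smoothD v s1 s2 Up) (derive_smoothD v t12 t3 Up) (derive_smoothD v t1 t2 Up).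
  rewrite (derive_smoothZ _ v (sx 0) Up) (derive_smoothZ _ v (sx 1) Up).
  rewrite (derive_smoothZ _ v q1 Up) (derive_smoothZ _ v q2 Up) (derive_smoothZ _ v q3 Up).
  rewrite (derive_smoothM v (sx 0) (sx 1) Up) !(derive_smoothX _ v (sx _) Up) !derive_proj /=.
  by field.
have spsi : smooth_on U psi by rewrite psiE; exact: smooth_sub.
have Dpsi j : is_littleo 1 (fun p => 'D_(delta_mx 0 j) psi p).
  have dDh : differentiable ('D_(delta_mx 0 j) h) 0.
    exact: smooth_differentiable (smooth_derive _ oU sh) U0.
  apply: is_littleo_near (diff_is_littleo dDh).
  apply: (open_near oU U0) => p Up.
  have E1 := derive_smoothB (delta_mx 0 j) sh sT Up.
  have E2 := DT (delta_mx 0 j) p Up.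
  have E3 := derive_basis p dDh.
  have E4 := sum_I2 (fun k => p 0 k * 'D_(delta_mx 0 k) ('D_(delta_mx 0 j) h) 0).
  rewrite psiE E1 E2 E3 E4 {E1 E2 E3 E4 dDh}.
  move: j; apply: forall_I2.
    rewrite !mxE /= -/a bE; move: ('D_e0 h p) ('D_e0 h 0) => A B; ring.
  rewrite !mxE /= -/b -/c; move: ('D_e1 h p) ('D_e1 h 0) => A B; ring.
move=> e e0.
have e20 : 0 < e / 2 by rewrite divr_gt0.
have : \forall p \near (0 : 'rV[R]_2), forall j, `|'D_(delta_mx 0 j) psi p| <= e / 2 * `|p|.
  by apply: near_forall => j; apply: filterS (Dpsi j _ e20) => p; rewrite expr1.
move=> /(filterI (open_nbhs_nbhs (conj oU U0)))/nbhs_ballP[d /= d0 H].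
have : \forall p \near (0 : 'rV[R]_2), ball 0 d p by exact: nbhsx_ballx.
apply: filterS => p pd.
have seg (t : R) T := segment_ball (t := t) pd T.
have tI (t : R) : 0 < t < 1 -> 0 <= t <= 1 by move=> /andP[? ?]; rewrite !ltW.
have [t|t|t ht E] := @MVT_line _ _ psi 0 p.
- by move=> /tI/seg/H[Ut _]; exact: smooth_differentiable spsi Ut.
- by move=> /seg/H[Ut _]; exact: smooth_continuous spsi Ut.
have psi0 : psi 0 = 0 by rewrite psiE /T /quad !mxE; ring.
move: E; rewrite psi0 subr0 add0r => ->.
have [Ut Ht] := H _ (seg t (tI t ht)).
rewrite add0r in Ut Ht *.
have dpsi := smooth_differentiable spsi Ut.
have EB := derive_basis p dpsi.
have ES := sum_I2 (fun k => p 0 k * 'D_(delta_mx 0 k) psi (t *: p)).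
rewrite EB ES {EB ES}.
have tp := norm_scale_le p (tI t ht).
have pj j : `|p 0 j * 'D_(delta_mx 0 j) psi (t *: p)| <= e / 2 * `|p| ^+ 2.
  exact: (ler_norm_prod (ltW e20) (coord_le_norm p j) (Ht j) tp).
apply: le_trans (ler_normD _ _) _.
by rewrite [e in leRHS]splitr mulrDl; apply: lerD; exact: pj.
Qed.

(** [critical_at0] says nothing about the value at 0, hence the assumption h 0 = 0. The converse
    rests on the uniqueness of the expansion of order two; the determinant of the Hessian is four
    times that of the form. *)
Lemma critical_qform_sign s (U : set 'rV[R]_2) (h : 'rV[R]_2 -> R) : open U -> U 0 ->
  smooth_on U h -> h 0 = 0 ->
  critical_at0 h /\ 0 < s * \det (Hess h 0) <-> qform_sign s h.
Proof.
move=> oU U0 sh h0; have dh := smooth_differentiable sh U0.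
have two0 : 2 != 0 :> R by rewrite pnatr_eq0.
have [l0 E0] := ex_eq ('D_e0 h 0).
have [l1 E1] := ex_eq ('D_e1 h 0).
have [A EA] := ex_eq ('D_e0 ('D_e0 h) 0 / 2).
have [B EB] := ex_eq ('D_e0 ('D_e1 h) 0 / 2).
have [C EC] := ex_eq ('D_e1 ('D_e1 h) 0 / 2).
have H00 : Hess h 0 0 0 = 2 * A by rewrite mxE EA mulrC (divfK two0).
have H01 : Hess h 0 0 1 = 2 * B by rewrite mxE EB mulrC (divfK two0).
have H10 : Hess h 0 1 0 = 2 * B.
  by rewrite mxE EB mulrC (divfK two0); exact: derive_comm oU sh U0.
have H11 : Hess h 0 1 1 = 2 * C by rewrite mxE EC mulrC (divfK two0).
have T : is_littleo 2 (fun p => h p - (h 0 + (l0 * p 0 0 + l1 * p 0 1) + quad A B C p)).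
  by rewrite EA EB EC E0 E1; exact: taylor2 oU U0 sh.
clear EA EB EC.
have HE : \det (Hess h 0) = 4 * (A * C - B ^+ 2).
  by rewrite det_mx2 H00 H01 H10 H11; ring.
have crit : critical_at0 h <-> l0 = 0 /\ l1 = 0.
  split=> [cr|[z0 z1] v]; first by rewrite E0 E1 !deriveE.
  by rewrite -deriveE // derive_basis // sum_I2 -E0 -E1 z0 z1 !mulr0 addr0.
split=> [[/crit[z0 z1] hdet]|[a [b [c [q hdet]]]]].
  exists A, B, C; split; last by move: hdet; rewrite HE mulrCA pmulr_rgt0.
  by move: T; rewrite h0 z0 z1 /qform; under eq_fun do rewrite !mul0r !add0r.
have := is_littleo_sub q T.
have E : (fun p => h p - quad a b c p - (h p - (h 0 +
    (l0 * p 0 0 + l1 * p 0 1) + quad A B C p))) =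
  fun p => 0 + (l0 * p 0 0 + l1 * p 0 1) + quad (A - a) (B - b) (C - c) p.
  by apply/funext => p; rewrite /quad h0; ring.
rewrite E => /quad_unique[[_ D0 D1] [a0 b0 c0]].
split; first by apply/crit.
rewrite HE mulrCA pmulr_rgt0 //.
by rewrite (subr0_eq a0) (subr0_eq b0) (subr0_eq c0).
Qed.

End QuadraticForms.

(** * Second derivatives of maps *)

(** [v *m jac2 F w x] is the second derivative of F at x in the directions v and w, symmetric in v
    and w for smooth F. As a matrix acting on v it composes with [jac], and w may depend on x. *)
HB.lock Definition jac2 (R : realType) m n (F : 'rV[R]_m -> 'rV[R]_n)
    (w x : 'rV[R]_m) : 'M[R]_(m, n) :=
  \matrix_(k, j) 'D_w (fun y => jac F y k j) x.

Section SecondDerivatives.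
Context {R : realType}.

Lemma jac2E m n (F : 'rV[R]_m -> 'rV[R]_n) (w x : 'rV[R]_m) k j :
  jac2 F w x k j = 'D_w (fun y => jac F y k j) x.
Proof. by rewrite jac2.unlock mxE. Qed.

Lemma mx_lin m n (A B : 'M[R]_(m, n)) (a b : R) k j :
  (a *: A + b *: B) k j = a * A k j + b * B k j.
Proof. by rewrite !mxE. Qed.

Lemma smooth_jac m n (U : set 'rV[R]_m) (F : 'rV[R]_m -> 'rV[R]_n) k j :
  open U -> smooth_map U F -> smooth_on U (fun x => jac F x k j).
Proof. by move=> oU sF; under eq_fun do rewrite jacE; exact: smooth_derive. Qed.

Lemma smooth_jac2 m n (U : set 'rV[R]_m) (F : 'rV[R]_m -> 'rV[R]_n) w k j :
  open U -> smooth_map U F -> smooth_on U (fun x => jac2 F w x k j).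
Proof.
by move=> oU sF; under eq_fun do rewrite jac2E; apply: smooth_derive => //; exact: smooth_jac.
Qed.

Lemma smooth_mulmx m n p (U : set 'rV[R]_m) (A : 'rV[R]_m -> 'rV[R]_n)
    (B : 'rV[R]_m -> 'M[R]_(n, p)) j :
  smooth_map U A -> (forall k j, smooth_on U (fun x => B x k j)) ->
  smooth_on U (fun x => (A x *m B x) 0 j).
Proof.
move=> sA sB; under eq_fun do rewrite mxE.
by apply: smooth_sum => k; exact: smooth_mul.
Qed.

Lemma smooth_mul_jac m n (U : set 'rV[R]_m) (F : 'rV[R]_m -> 'rV[R]_n) (v : 'rV[R]_m) :
  open U -> smooth_map U F -> smooth_map U (fun x => v *m jac F x).
Proof.
by move=> oU sF j; apply: smooth_mulmx => [k|k i]; [exact: smooth_cst|exact: smooth_jac].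
Qed.

Lemma derive_smooth_sum m (U : set 'rV[R]_m) (I : finType) (h : I -> 'rV[R]_m -> R) (x v : 'rV[R]_m) :
  (forall i, smooth_on U (h i)) -> U x ->
  'D_v (fun y => \sum_i h i y) x = \sum_i 'D_v (h i) x.
Proof.
move=> sh Ux; elim: (index_enum I) => [|i r IH].
  by rewrite big_nil; under eq_fun do rewrite big_nil; exact: derive_cst0.
under eq_fun do rewrite big_cons.
have sr : smooth_on U (fun y => \sum_(j <- r) h j y) by exact: smooth_sum.
by rewrite (derive_smoothD v (sh i) sr Ux) big_cons IH.
Qed.

Lemma jac2_lin m n (U : set 'rV[R]_m) (F : 'rV[R]_m -> 'rV[R]_n) (a b : R)
    (u w x : 'rV[R]_m) :
  open U -> smooth_map U F -> U x ->
  jac2 F (a *: u + b *: w) x = a *: jac2 F u x + b *: jac2 F w x.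
Proof.
move=> oU sF Ux; apply/matrixP => k j; rewrite mx_lin !jac2E.
have dF : differentiable (fun y => jac F y k j) x.
  exact: smooth_differentiable (smooth_jac k j oU sF) Ux.
by rewrite derive_add // (derive_scale a u dF) (derive_scale b w dF).
Qed.

Lemma jac2_sym m n (U : set 'rV[R]_m) (F : 'rV[R]_m -> 'rV[R]_n) (u w x : 'rV[R]_m) :
  open U -> smooth_map U F -> U x -> u *m jac2 F w x = w *m jac2 F u x.
Proof.
move=> oU sF Ux; apply/rowP => j.
have E v v' : (v *m jac2 F v' x) 0 j = 'D_v' ('D_v (fun y => F y 0 j)) x.
  have -> : 'D_v' ('D_v (fun y => F y 0 j)) x =
      'D_v' (fun y => \sum_k v 0 k * jac F y k j) x.
    apply: (@eq_derive_on _ _ U) => // y Uy.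
    by rewrite (derive_jac v j sF Uy) mxE.
  rewrite (derive_smooth_sum (U := U)) //; last first.
    by move=> k; apply: smooth_mul; [exact: smooth_cst|exact: smooth_jac].
  rewrite mxE; apply: eq_bigr => k _.
  by rewrite (derive_smoothZ _ _ (smooth_jac k j oU sF) Ux) jac2E.
rewrite !E; exact: derive_comm oU (sF j) Ux.
Qed.

Lemma derive_mulmx m n p (U : set 'rV[R]_m) (A : 'rV[R]_m -> 'rV[R]_n)
    (B : 'rV[R]_m -> 'M[R]_(n, p)) (v x : 'rV[R]_m) j :
  smooth_map U A -> (forall k j, smooth_on U (fun x => B x k j)) -> U x ->
  'D_v (fun y => (A y *m B y) 0 j) x =
    (v *m jac A x *m B x) 0 j + \sum_k A x 0 k * 'D_v (fun y => B y k j) x.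
Proof.
move=> sA sB Ux.
have -> : (fun y => (A y *m B y) 0 j) = fun y => \sum_k A y 0 k * B y k j.
  by apply/funext => y; rewrite mxE.
have sAB k : smooth_on U (fun y => A y 0 k * B y k j) by exact: smooth_mul.
rewrite (derive_smooth_sum v sAB Ux) [in RHS]mxE -big_split /=.
apply: eq_bigr => k _.
by rewrite (derive_smoothM v (sA k) (sB k j) Ux) (derive_jac v k sA Ux) addrC [B x k j * _]mulrC.
Qed.

Lemma jac_cst m n (w : 'rV[R]_n) (x : 'rV[R]_m) : jac (fun=> w) x = 0.
Proof. by apply/matrixP => k j; rewrite jacE derive_cst0 mxE. Qed.

Lemma jac_comp m n p (U : set 'rV[R]_m) (W : set 'rV[R]_n) (d : 'rV[R]_m -> 'rV[R]_n)
    (g : 'rV[R]_n -> 'rV[R]_p) (x : 'rV[R]_m) :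
  smooth_map U d -> smooth_map W g -> U x -> W (d x) ->
  jac (fun y => g (d y)) x = jac d x *m jac g (d x).
Proof.
move=> sd sg Ux Wx; apply/matrixP => k j; rewrite jacE.
have dd : differentiable d x.
  by apply: differentiable_rV => i; exact: smooth_differentiable (sd i) Ux.
have E : 'D_(delta_mx 0 k) d x = row k (jac d x).
  apply/rowP => i; rewrite derive_coord // (derive_jac _ i sd Ux).
  by rewrite -rowE.
rewrite (derive_chain (g := fun y => g y 0 j) _ dd (smooth_differentiable (sg j) Wx)).
by rewrite E (derive_jac _ j sg Wx) -row_mul mxE.
Qed.

Lemma derive_rV m n (U : set 'rV[R]_m) (F : 'rV[R]_m -> 'rV[R]_n) (v x : 'rV[R]_m) :
  smooth_map U F -> U x -> 'D_v F x = v *m jac F x.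
Proof.
move=> sF Ux; have dF : differentiable F x.
  by apply: differentiable_rV => i; exact: smooth_differentiable (sF i) Ux.
by apply/rowP => i; rewrite derive_coord // (derive_jac _ i sF Ux).
Qed.

Lemma derive_mul_jac m n (U : set 'rV[R]_m) (F : 'rV[R]_m -> 'rV[R]_n)
    (A : 'rV[R]_m -> 'rV[R]_m) (w x : 'rV[R]_m) j :
  open U -> smooth_map U F -> smooth_map U A -> U x ->
  'D_w (fun y => (A y *m jac F y) 0 j) x =
    (w *m jac A x *m jac F x + A x *m jac2 F w x) 0 j.
Proof.
move=> oU sF sA Ux.
rewrite (derive_mulmx w j sA (fun k j => smooth_jac k j oU sF) Ux) [RHS]mxE; congr (_ + _).
by rewrite [RHS]mxE; apply: eq_bigr => k _; rewrite jac2E.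
Qed.

Lemma jac2_comp m n p (U : set 'rV[R]_m) (W : set 'rV[R]_n) (d : 'rV[R]_m -> 'rV[R]_n)
    (g : 'rV[R]_n -> 'rV[R]_p) (v w x : 'rV[R]_m) :
  open U -> open W -> smooth_map U d -> smooth_map W g ->
  (forall x, U x -> W (d x)) -> U x ->
  v *m jac2 (fun y => g (d y)) w x =
    v *m jac2 d w x *m jac g (d x) + v *m jac d x *m jac2 g (w *m jac d x) (d x).
Proof.
move=> oU oW sd sg dW Ux; apply/rowP => j.
have sgd : smooth_map U (fun y => g (d y)) by move=> i; exact: smooth_comp oW (sg i) sd dW.
have sJd k i : smooth_on U (fun y => jac d y k i) by exact: smooth_jac.
have sJg k i : smooth_on U (fun y => jac g (d y) k i).
  exact: smooth_comp oW (smooth_jac k i oW sg) sd dW.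
have sv : smooth_map U (fun=> v) by move=> i; exact: smooth_cst.
have jv : w *m jac (fun=> v) x = 0 by rewrite jac_cst mulmx0.
have E1 := derive_mul_jac w j oU sgd sv Ux.
rewrite jv mul0mx add0r in E1; rewrite -E1.
have E2 i := derive_mul_jac w i oU sd sv Ux.
have svd : smooth_map U (fun y => v *m jac d y) by move=> i; exact: smooth_mulmx.
have -> : 'D_w (fun y => (v *m jac (fun y => g (d y)) y) 0 j) x =
    'D_w (fun y => (v *m jac d y *m jac g (d y)) 0 j) x.
  apply: (@eq_derive_on _ _ U) => // y Uy.
  by rewrite (jac_comp sd sg Uy (dW y Uy)) mulmxA.
rewrite (derive_mulmx w j svd sJg Ux) [RHS]mxE; congr (_ + _).
  rewrite !mxE; apply: eq_bigr => k _; congr (_ * _).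
  by rewrite -(derive_jac w k svd Ux) E2 jv mul0mx add0r.
rewrite [RHS]mxE; apply: eq_bigr => k _; congr (_ * _); rewrite jac2E.
have dd : differentiable d x.
  by apply: differentiable_rV => i; exact: smooth_differentiable (sd i) Ux.
have dJ := smooth_differentiable (smooth_jac k j oW sg) (dW x Ux).
rewrite (derive_chain (g := fun y => jac g y k j) _ dd dJ).
by rewrite (derive_rV w sd Ux).
Qed.

End SecondDerivatives.

(** * Determinants in dimensions two and three, and linear independence *)

Section Determinants.
Context {R : realType}.

Lemma forall_I3 (P : 'I_3 -> Prop) : P 0 -> P 1 -> P 2 -> forall j, P j.
Proof.
move=> P0 P1 P2 [[|[|[|//]]] h].
- by rewrite (_ : Ordinal h = 0) //; exact/val_inj.
- by rewrite (_ : Ordinal h = 1) //; exact/val_inj.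
- by rewrite (_ : Ordinal h = 2) //; exact/val_inj.
Qed.

Lemma sum_I3 (F : 'I_3 -> R) : \sum_j F j = F 0 + F 1 + F 2.
Proof.
by rewrite !big_ord_recl big_ord0 addr0 addrA; congr (_ + F _ + F _); exact/val_inj.
Qed.

Lemma det3E (u v w : 'rV[R]_3) : det3 u v w =
  v 0 0 * (w 0 1 * u 0 2 - w 0 2 * u 0 1) +
  v 0 1 * (w 0 2 * u 0 0 - w 0 0 * u 0 2) +
  v 0 2 * (w 0 0 * u 0 1 - w 0 1 * u 0 0).
Proof.
rewrite /det3 (expand_det_row _ 1) sum_I3 /cofactor !det_mx2 !mxE.
have l10 : lift 1 (0 : 'I_2) = 0 :> 'I_3 by exact/val_inj.
have l11 : lift 1 (1 : 'I_2) = 2 :> 'I_3 by exact/val_inj.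
have l00 : lift 0 (0 : 'I_2) = 1 :> 'I_3 by exact/val_inj.
have l01 : lift 0 (1 : 'I_2) = 2 :> 'I_3 by exact/val_inj.
have l20 : lift 2 (0 : 'I_2) = 0 :> 'I_3 by exact/val_inj.
have l21 : lift 2 (1 : 'I_2) = 1 :> 'I_3 by exact/val_inj.
rewrite !l10 !l11 !l00 !l01 !l20 !l21 /=.
rewrite (_ : (1 %% 3 + 1 %% 3)%N = 2%N) // (_ : (1 %% 3 + 0)%N = 1%N) //.
by rewrite (_ : (1 %% 3 + (1 %% 3 + 1 %% 3) %% 3)%N = 3%N) //; ring.
Qed.

Lemma smooth_det3 m (U : set 'rV[R]_m) (A B C : 'rV[R]_m -> 'rV[R]_3) :
  smooth_map U A -> smooth_map U B -> smooth_map U C ->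
  smooth_on U (fun p => det3 (A p) (B p) (C p)).
Proof.
move=> sA sB sC; under eq_fun do rewrite det3E.
by apply: smooth_add; [apply: smooth_add|]; apply: smooth_mul => //;
  apply: smooth_sub; exact: smooth_mul.
Qed.

(** As B vanishes at 0, only the derivative of B contributes at first order. *)
Lemma det3_linear_part m (U : set 'rV[R]_m) (A B C : 'rV[R]_m -> 'rV[R]_3) :
  smooth_map U A -> smooth_map U B -> smooth_map U C -> U 0 -> B 0 = 0 ->
  is_littleo 1 (fun p => det3 (A p) (B p) (C p) - det3 (A 0) (p *m jac B 0) (C 0)).
Proof.
move=> sA sB sC U0 B0.
pose k i j p := C p 0 i * A p 0 j - C p 0 j * A p 0 i.
have sk i j : smooth_on U (k i j) by apply: smooth_sub; exact: smooth_mul.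
have t i j l : is_littleo 1 (fun p => k i j p * B p 0 l - k i j 0 * (p *m jac B 0) 0 l).
  under eq_fun do rewrite -(derive_jac _ l sB U0).
  apply: prod_lin; [exact: smooth_differentiable (sk i j) U0| |by rewrite B0 mxE].
  exact: smooth_differentiable (sB l) U0.
apply: is_littleo_near (is_littleo_add (is_littleo_add (t 1 2 0) (t 2 0 1)) (t 0 1 2)).
by apply: filterE => p; rewrite !det3E /k; ring.
Qed.

(** The terms y Fu + z Fw drop out, as three vectors in the span of Fu and Fw have determinant 0. In
    the applications a vanishes at the origin. *)
Lemma det3_change (Fu Fw Fuu Fuw Fww : 'rV[R]_3) (a b c d y z : R) :
  det3 (c *: Fu + d *: Fw) (a *: Fu + b *: Fw)
    (y *: Fu + z *: Fw + (a ^+ 2 *: Fuu + (2 * a * b) *: Fuw + b ^+ 2 *: Fww)) =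
  (c * b - d * a) * (b ^+ 2 * det3 Fu Fw Fww +
    (2 * a * b * det3 Fu Fw Fuw + a ^+ 2 * det3 Fu Fw Fuu)).
Proof. by rewrite !det3E !mxE; ring. Qed.

Lemma det3_mul (u v w : 'rV[R]_3) (T : 'M[R]_3) :
  det3 (u *m T) (v *m T) (w *m T) = det3 u v w * \det T.
Proof.
rewrite /det3 -det_mulmx; congr (\det _); apply/matrixP => i j; rewrite !mxE.
by move: i; apply: forall_I3; rewrite /= mxE; apply: eq_bigr => k _; rewrite !mxE.
Qed.

Lemma det3Dr (u v w w' : 'rV[R]_3) : det3 u v (w + w') = det3 u v w + det3 u v w'.
Proof. by rewrite !det3E !mxE; ring. Qed.

Definition det2 (u w : 'rV[R]_2) : R := u 0 0 * w 0 1 - u 0 1 * w 0 0.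

Lemma cramer2 (u w y : 'rV[R]_2) : det2 u w != 0 ->
  y = (det2 y w / det2 u w) *: u + (det2 u y / det2 u w) *: w.
Proof.
rewrite /det2 => D; apply: rV2P; rewrite !mxE; field; exact: D.
Qed.

Lemma det2_mul (u w : 'rV[R]_2) (J : 'M[R]_2) :
  det2 (u *m J) (w *m J) = det2 u w * \det J.
Proof. by rewrite det_mx2 /det2 !mxE !sum_I2; ring. Qed.

Definition indep2 n (x y : 'rV[R]_n) : Prop :=
  forall a b : R, a *: x + b *: y = 0 -> a = 0 /\ b = 0.

Lemma free_indep2 n (x y : 'rV[R]_n) : free [:: x; y] <-> indep2 x y.
Proof.
split=> [/freeP fr a b ab0|ind].
  have := fr (fun i => [:: a; b]`_i); rewrite !big_ord_recl big_ord0 /= addr0 => /(_ ab0) H.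
  by split; [exact: (H 0)|exact: (H 1)].
apply/freeP => k; rewrite !big_ord_recl big_ord0 /= addr0 => /ind[k0 k1].
by apply: forall_I2; [apply: etrans k0|apply: etrans k1]; congr (k _); exact/val_inj.
Qed.

Lemma indep2_det2 (u w : 'rV[R]_2) : indep2 u w <-> det2 u w != 0.
Proof.
split=> [ind|D a b ab0]; last first.
  have e i : a * u 0 i + b * w 0 i = 0 by have := congr1 (fun v : 'rV_2 => v 0 i) ab0; rewrite !mxE.
  have a0 : a * det2 u w = 0.
    by rewrite /det2 (_ : _ * _ = (a * u 0 0 + b * w 0 0) * w 0 1 - (a * u 0 1 + b * w 0 1) * w 0 0);
      [rewrite !e !mul0r subrr|ring].
  have b0 : b * det2 u w = 0.
    by rewrite /det2 (_ : _ * _ = (a * u 0 1 + b * w 0 1) * u 0 0 - (a * u 0 0 + b * w 0 0) * u 0 1);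
      [rewrite !e !mul0r subrr|ring].
  by move/eqP: a0; move/eqP: b0; rewrite !mulf_eq0 (negbTE D) !orbF => /eqP -> /eqP ->.
apply/eqP => D0.
have [w0 u0] : w 0 1 = 0 /\ - u 0 1 = 0.
  by apply: ind; apply: rV2P; rewrite !mxE; move: D0; rewrite /det2 => D0; [rewrite -[RHS]D0|]; ring.
have [w1 u1] : w 0 0 = 0 /\ - u 0 0 = 0.
  apply: ind; apply: rV2P; rewrite !mxE; first by ring.
  by move: D0; rewrite /det2 => D0; rewrite -[RHS]oppr0 -[in RHS]D0; ring.
have [/eqP] : (1 : R) = 0 /\ (0 : R) = 0; last by rewrite oner_eq0.
apply: ind; apply: rV2P; rewrite !mxE.
  by rewrite -[u 0 0]opprK u1 oppr0 mulr0 mul0r addr0.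
by rewrite -[u 0 1]opprK u0 oppr0 mulr0 mul0r addr0.
Qed.

Lemma indep2_lin n (x y : 'rV[R]_n) (c z b : R) : c != 0 -> b != 0 ->
  indep2 (c *: x) (z *: x + b *: y) <-> indep2 x y.
Proof.
move=> c0 b0; split=> ind k l kl.
  have [k0 l0] : k / c - l * z / (b * c) = 0 /\ l / b = 0.
    apply: ind; rewrite -[RHS]kl; apply/rowP => i; rewrite !mxE; field.
    by rewrite b0 c0.
  have l1 : l = 0 by apply/eqP; move/eqP: l0; rewrite mulf_eq0 invr_eq0 (negbTE b0) orbF.
  split=> //; move: k0; rewrite l1 !mul0r subr0 => /eqP.
  by rewrite mulf_eq0 invr_eq0 (negbTE c0) orbF => /eqP.
have [k0 l0] : k * c + l * z = 0 /\ l * b = 0.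
  by apply: ind; rewrite -[RHS]kl; apply/rowP => i; rewrite !mxE; ring.
have l1 : l = 0 by apply/eqP; move/eqP: l0; rewrite mulf_eq0 (negbTE b0) orbF.
split=> //; move: k0; rewrite l1 mul0r addr0 => /eqP.
by rewrite mulf_eq0 (negbTE c0) orbF => /eqP.
Qed.

End Determinants.

(** * The discriminant and its invariance *)

Section FieldChange.
Context {R : realType}.
Variables (U : set 'rV[R]_2) (f : 'rV[R]_2 -> 'rV[R]_3).
Hypotheses (oU : open U) (U0 : U 0) (sf : smooth_map U f).
Implicit Types (u w v x p : 'rV[R]_2).

Local Notation d1 v x := (v *m jac f x).
Local Notation d2 v w x := (v *m jac2 f w x).

Definition discr u w x : R := det3 (d1 u x) (d1 w x) (d2 w w x).

(** Corank one at 0 as it is used below: w spans the kernel of the differential and u completes it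
    to a basis of the plane. *)
Definition adapted u w : Prop := [/\ det2 u w != 0, d1 u 0 != 0 & d1 w 0 = 0].

Lemma smooth_d1 v : smooth_map U (fun x => d1 v x).
Proof. exact: smooth_mul_jac. Qed.

Lemma smooth_d2 v w : smooth_map U (fun x => d2 v w x).
Proof.
by move=> j; apply: smooth_mulmx => [k|k i]; [exact: smooth_cst|exact: smooth_jac2].
Qed.

Lemma jac_d1 w p : p *m jac (fun x => d1 w x) 0 = d2 w p 0.
Proof.
have sw : smooth_map U (fun=> w) by move=> i; exact: smooth_cst.
apply/rowP => j; rewrite -(derive_jac p j (smooth_d1 w) U0) (derive_mul_jac p j oU sf sw U0).
by rewrite jac_cst mulmx0 mul0mx add0r.
Qed.

Lemma d2_lin v u w (a b : R) x : U x ->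
  d2 v (a *: u + b *: w) x = a *: d2 v u x + b *: d2 v w x.
Proof. by move=> Ux; rewrite (jac2_lin _ _ _ _ oU sf Ux) mulmxDr -!scalemxAr. Qed.

Lemma det3_0 (x y : 'rV[R]_3) : det3 x 0 y = 0.
Proof. by rewrite det3E !mxE !mul0r !addr0. Qed.

(* The 1-jet of [discr] is [s * det3 Fu Fuw Fww], where [s] is the
   [u]-coordinate, so it can only be of second order if that determinant
   vanishes; this also kills the 1-jet of [det3 Fu Fw Fuw]. *)
Lemma mixed_is_littleo u w : adapted u w -> is_bigO 2 (discr u w) ->
  is_littleo 1 (fun x => det3 (d1 u x) (d1 w x) (d2 u w x)).
Proof.
move=> [D Fu0 Fw0] hO.
have lin C (sC : smooth_map U C) : is_littleo 1 (fun p =>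
    det3 (d1 u p) (d1 w p) (C p) - det3 (d1 u 0) (d2 w p 0) (C 0)).
  have := det3_linear_part (smooth_d1 u) (smooth_d1 w) sC U0 Fw0.
  by under eq_fun do rewrite jac_d1.
have dZ (s : R) p : d2 w (s *: p) 0 = s *: d2 w p 0.
  by have := d2_lin w p 0 s 0 U0; rewrite !scale0r !addr0.
have delta0 : det3 (d1 u 0) (d2 w u 0) (d2 w w 0) = 0.
  apply: (@is_littleo1_linear0 _ _ (fun p => det3 (d1 u 0) (d2 w p 0) (d2 w w 0))).
    by move=> s; rewrite dZ !det3E !mxE; ring.
  have := is_littleo_sub (is_bigO_lt hO) (lin _ (smooth_d2 w w)).
  by apply: is_littleo_near; apply: filterE => p; rewrite /discr subKr.
have l0 p : det3 (d1 u 0) (d2 w p 0) (d2 u w 0) = 0.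
  rewrite (jac2_sym u w oU sf U0).
  have -> : d2 w p 0 = d2 w ((det2 p w / det2 u w) *: u + (det2 u p / det2 u w) *: w) 0.
    by rewrite -cramer2.
  rewrite d2_lin //.
  move: delta0; rewrite !det3E !mxE.
  move: (det2 p w / _) (det2 u p / _) => s t E.
  by apply: etrans (_ : - t * 0 = 0); [rewrite -[in RHS]E; ring|rewrite mulr0].
by apply: is_littleo_near (lin _ (smooth_d2 u w)); apply: filterE => p; rewrite l0 subr0.
Qed.

Section Change.
Variables (V : set 'rV[R]_2) (d X W Z : 'rV[R]_2 -> 'rV[R]_2) (u w : 'rV[R]_2).
Hypotheses (oV : open V) (V0 : V 0) (sd : smooth_map V d) (d0 : d 0 = 0)
  (dU : forall x, V x -> U (d x)) (sX : smooth_map V X) (sW : smooth_map V W)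
  (XW : det2 (X 0) (W 0) != 0) (W0 : d1 (W 0) 0 = 0) (uw : adapted u w).

(** Two situations in one. For d = id, X = xi, W = eta and Z the derivative of eta along itself,
    this is phi. For a source diffeomorphism d, with X and W the images of u and w under its
    differential and Z its second derivative along w, it is the discriminant of f o d. In both, Z
    only adds to the third vector a value of df, which the determinant does not see. *)
Definition discr_along x : R :=
  det3 (d1 (X x) (d x)) (d1 (W x) (d x)) (d1 (Z x) (d x) + d2 (W x) (W x) (d x)).

Let a x := det2 (W x) w / det2 u w.
Let b x := det2 u (W x) / det2 u w.
Let c x := det2 (X x) w / det2 u w.
Let e x := det2 u (X x) / det2 u w.
Let K x := c x * b x - e x * a x.
Let E1 x := det3 (d1 u x) (d1 w x) (d2 u w x).
Let E2 x := det3 (d1 u x) (d1 w x) (d2 u u x).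

Let D : det2 u w != 0. Proof. by case: uw. Qed.

Let sdet2 (A B : 'rV[R]_2 -> 'rV[R]_2) : smooth_map V A -> smooth_map V B ->
  smooth_on V (fun x => det2 (A x) (B x) / det2 u w).
Proof.
move=> sA sB; apply: smooth_mul; last exact: smooth_cst.
by apply: smooth_sub; exact: smooth_mul.
Qed.

Let scst v : smooth_map V (fun=> v).
Proof. by move=> j; exact: smooth_cst. Qed.

Let sa : smooth_on V a. Proof. exact: sdet2. Qed.
Let sb : smooth_on V b. Proof. exact: sdet2. Qed.
Let sc : smooth_on V c. Proof. exact: sdet2. Qed.
Let se : smooth_on V e. Proof. exact: sdet2. Qed.
Let sK : smooth_on V K. Proof. by apply: smooth_sub; exact: smooth_mul. Qed.

Let d1_coord y x : d1 y x = (det2 y w / det2 u w) *: d1 u x + (det2 u y / det2 u w) *: d1 w x.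
Proof. by rewrite {1}(cramer2 y D) mulmxDl -!scalemxAl. Qed.

Let a0 : a 0 = 0.
Proof.
move: W0; rewrite d1_coord; case: uw => _ u0 ->; rewrite scaler0 addr0 => /eqP.
by rewrite scaler_eq0 (negbTE u0) orbF => /eqP.
Qed.

Let KE x : K x = det2 (X x) (W x) / det2 u w.
Proof. by rewrite /K /a /b /c /e; move: D; rewrite /det2 => D'; field. Qed.

Let K0 : K 0 != 0.
Proof. by rewrite KE mulf_neq0 ?invr_neq0. Qed.

Let cb0 : c 0 * b 0 != 0.
Proof. by have := K0; rewrite /K a0 mulr0 subr0. Qed.

(** The functions a, E1 o d and E2 o d all vanish at 0, so [rest] is O(2) unconditionally and its
    last term is O(3); all of it is o(2) as soon as E1 o d is o(1). *)
Let rest x := K x * (2 * a x * b x * E1 (d x) + a x ^+ 2 * E2 (d x)).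

Let phiE x : V x -> discr_along x = K x * b x ^+ 2 * discr u w (d x) + rest x.
Proof.
move=> Vx; have Udx := dU Vx; rewrite /discr_along.
have -> : d2 (W x) (W x) (d x) = a x ^+ 2 *: d2 u u (d x) +
    (2 * a x * b x) *: d2 u w (d x) + b x ^+ 2 *: d2 w w (d x).
  have EW := cramer2 (W x) D; rewrite -/(a x) -/(b x) in EW.
  rewrite {2}EW d2_lin // !(jac2_sym (W x) _ oU sf Udx) EW !d2_lin //.
  rewrite -(jac2_sym u w oU sf Udx).
  by apply/rowP => j; rewrite !mxE; ring.
rewrite (d1_coord (X x)) (d1_coord (W x)) (d1_coord (Z x)) -/(a x) -/(b x) -/(c x) -/(e x).
by rewrite det3_change /rest /K /discr /E1 /E2; ring.
Qed.

Let is_bigO0 g : smooth_on V g -> is_bigO 0 g.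
Proof. by move=> sg; apply: continuous_is_bigO; exact: smooth_continuous sg V0. Qed.

Let sd12 A B C C' : smooth_on V (fun x => det3 (d1 A (d x)) (d1 B (d x)) (d2 C C' (d x))).
Proof.
exact: smooth_comp oU (smooth_det3 (smooth_d1 A) (smooth_d1 B) (smooth_d2 C C')) sd dU.
Qed.

Let aO : is_bigO 1 a.
Proof. exact: diff_is_bigO (smooth_differentiable sa V0) a0. Qed.

Let cst2 : @is_bigO R 2 0 (fun=> 2). Proof. exact: is_bigO_cst. Qed.

Let E2O : is_bigO 1 (fun x => E2 (d x)).
Proof.
apply: diff_is_bigO; first exact: smooth_differentiable (sd12 _ _ _ _) V0.
by rewrite d0 /E2; case: uw => _ _ ->; exact: det3_0.
Qed.

Let E1O : is_bigO 1 (fun x => E1 (d x)).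
Proof.
apply: diff_is_bigO; first exact: smooth_differentiable (sd12 _ _ _ _) V0.
by rewrite d0 /E1; case: uw => _ _ ->; exact: det3_0.
Qed.

Let restO : is_bigO 2 rest.
Proof.
apply: (@is_bigO_mul _ _ 0 2); [exact: is_bigO0|apply: is_bigO_add].
  apply: (@is_bigO_mul _ _ 1 1) => //; apply: (@is_bigO_mul _ _ 1 0); last exact: is_bigO0.
  exact: (@is_bigO_mul _ _ 0 1).
under eq_fun do rewrite expr2 -mulrA; apply: (@is_bigO_mul _ _ 1 1) => //.
by apply: (@is_bigO_mul _ _ 0 1) => //; exact: is_bigO0.
Qed.

Let resto : is_littleo 1 (fun x => E1 (d x)) -> is_littleo 2 rest.
Proof.
move=> oE; apply: (@is_littleo_mul _ _ 0 2); [exact: is_bigO0|apply: is_littleo_add].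
  apply: (@is_littleo_mul _ _ 1 1) => //; apply: (@is_bigO_mul _ _ 1 0); last exact: is_bigO0.
  exact: (@is_bigO_mul _ _ 0 1).
apply: is_bigO_lt; under eq_fun do rewrite expr2 -mulrA; apply: (@is_bigO_mul _ _ 1 2) => //.
exact: (@is_bigO_mul _ _ 1 1).
Qed.

Let ck x := K x * b x ^+ 2.
Let sck : smooth_on V ck. Proof. by apply: smooth_mul => //; exact: smooth_exp. Qed.
Let ck0 : ck 0 != 0.
Proof.
rewrite /ck mulf_neq0 ?expf_neq0 //; apply: contraNneq cb0 => ->; rewrite mulr0 //.
Qed.
Let cck : {for 0, continuous ck}. Proof. exact: smooth_continuous sck V0. Qed.

Lemma qform_sign_change s : \det (jac d 0) != 0 -> qform_sign s (discr u w) -> qform_sign s discr_along.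
Proof.
move=> dJ qh.
have dd : differentiable d 0.
  by apply: differentiable_rV => j; exact: smooth_differentiable (sd j) V0.
have oE := is_littleo_comp dd d0 (mixed_is_littleo uw (qform_sign_is_bigO qh)).
have := qform_sign_add (resto oE) (qform_sign_mul cck ck0 (qform_sign_comp dd d0 dJ qh)).
by apply: qform_sign_near; apply: (open_near oV V0) => x Vx; rewrite phiE.
Qed.

(** Here the discriminant of the constant fields is not known in advance to be O(2), as
    [mixed_is_littleo] requires. This is obtained from the unconditional O(2) bound on [rest], and
    only then is [rest] seen to be o(2). *)
Lemma qform_sign_change_id s : (forall x, d x = x) -> qform_sign s discr_along -> qform_sign s (discr u w).
Proof.
move=> did qp.
have dE : d = id by apply/funext => x; exact: did.
have cki : {for 0, continuous (fun x => (ck x)^-1)} by exact: continuousV.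
have hE : \forall x \near (0 : 'rV[R]_2), (ck x)^-1 * (discr_along x - rest x) = discr u w x.
  have nk : \forall x \near (0 : 'rV[R]_2), ck x != 0 by exact: cvgr_neq0 cck ck0.
  apply: filterS2 nk (open_near oV V0 phiE) => x kx ->.
  by rewrite addrK mulKf // did.
have ho : is_bigO 2 (discr u w).
  have [C C0 HC] : is_bigO 2 (fun x => (ck x)^-1 * (discr_along x - rest x)).
    apply: (@is_bigO_mul _ _ 0 2); first exact: continuous_is_bigO.
    by apply: is_bigO_sub => //; exact: qform_sign_is_bigO qp.
  by exists C => //; apply: filterS2 hE HC => x ->.
have oE : is_littleo 1 (fun x => E1 (d x)) by rewrite dE; exact: mixed_is_littleo uw ho.
apply: (qform_sign_near hE); apply: qform_sign_mul => //; first by rewrite invr_neq0.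
by apply: qform_sign_add => //; exact: is_littleo_opp (resto oE).
Qed.

(** At 0 the kernel direction W has no component along u, hence is a multiple of w, and the two
    vectors change by an invertible triangular matrix. *)
Lemma indep2_change :
  indep2 (d1 (X 0) 0) (d1 (Z 0) 0 + d2 (W 0) (W 0) 0) <-> indep2 (d1 u 0) (d2 w w 0).
Proof.
have [_ _ w0] := uw.
have EW := cramer2 (W 0) D; rewrite -/(a 0) -/(b 0) a0 scale0r add0r in EW.
rewrite (d1_coord (X 0)) (d1_coord (Z 0)) w0 !scaler0 !addr0 -/(c 0).
have -> : d2 (W 0) (W 0) 0 = b 0 ^+ 2 *: d2 w w 0.
  have dZ v p (s : R) : d2 v (s *: p) 0 = s *: d2 v p 0.
    by have := d2_lin v p 0 s 0 U0; rewrite !scale0r !addr0.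
  by rewrite EW dZ -scalemxAl scalerA.
by move: cb0; rewrite mulf_eq0 negb_or => /andP[c0 b0]; apply: indep2_lin => //; rewrite expf_neq0.
Qed.

End Change.

End FieldChange.

(** * Invariance under changes of source and target coordinates *)

Section Invariance.
Context {R : realType}.

Lemma map_germP m n (f : 'rV[R]_m -> 'rV[R]_n) : map_germ f <->
  exists U : set 'rV[R]_m, [/\ open U, U 0, smooth_map U f & f 0 = 0].
Proof.
split=> [[[U [oU U0] CU] f0]|[U [oU U0 sU f0]]].
  by exists U; split=> //; exact/(Ck_smooth f oU).
by split=> //; exists U => //; exact/(Ck_smooth f oU).
Qed.

Lemma smooth_map_continuous m n (U : set 'rV[R]_m) (f : 'rV[R]_m -> 'rV[R]_n) x :
  smooth_map U f -> U x -> {for x, continuous f}.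
Proof.
move=> sf Ux; apply: differentiable_continuous; apply: differentiable_rV => j.
exact: smooth_differentiable (sf j) Ux.
Qed.

Lemma map_germ_near m n (f : 'rV[R]_m -> 'rV[R]_n) (P : 'rV[R]_n -> Prop) : map_germ f ->
  (\forall y \near (0 : 'rV[R]_n), P y) -> \forall x \near (0 : 'rV[R]_m), P (f x).
Proof.
move=> /map_germP[U [oU U0 sU f0]] HP.
by have := smooth_map_continuous sU U0; rewrite /prop_for /continuous_at f0 => /(_ _ HP).
Qed.

Lemma near0_ball m (P : 'rV[R]_m -> Prop) : (\forall x \near (0 : 'rV[R]_m), P x) ->
  exists2 r : R, 0 < r & forall x, ball 0 r x -> P x.
Proof. by move=> /nbhs_ballP[r /= r0 H]; exists r. Qed.

Lemma near_neq0 m (U : set 'rV[R]_m) (h : 'rV[R]_m -> R) x : smooth_on U h -> U x ->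
  h x != 0 -> \forall y \near x, h y != 0.
Proof. by move=> sh Ux h0; exact: cvgr_neq0 (smooth_continuous sh Ux) h0. Qed.

Lemma near0_open m (P : 'rV[R]_m -> Prop) : (\forall x \near (0 : 'rV[R]_m), P x) ->
  exists V : set 'rV[R]_m, [/\ open V, V 0 & forall x, V x -> P x].
Proof.
move=> /near0_ball[r r0 H]; exists (ball 0 r); split=> //; first exact: ball_open.
exact: ballxx.
Qed.

Lemma smooth_map_comp m n p (V : set 'rV[R]_m) (U : set 'rV[R]_n)
    (d : 'rV[R]_m -> 'rV[R]_n) (f : 'rV[R]_n -> 'rV[R]_p) :
  open U -> smooth_map V d -> smooth_map U f -> (forall x, V x -> U (d x)) ->
  smooth_map V (fun x => f (d x)).
Proof. by move=> oU sd sf dU j; exact: smooth_comp oU (sf j) sd dU. Qed.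

Lemma smooth_map_subset m n (U V : set 'rV[R]_m) (f : 'rV[R]_m -> 'rV[R]_n) :
  V `<=` U -> smooth_map U f -> smooth_map V f.
Proof. by move=> VU sf j; exact: smooth_subset (sf j). Qed.

Lemma map_germ_comp m n p (d : 'rV[R]_m -> 'rV[R]_n) (f : 'rV[R]_n -> 'rV[R]_p) :
  map_germ d -> map_germ f -> map_germ (fun x => f (d x)).
Proof.
move=> gd /map_germP[U [oU U0 sf f0]]; have /map_germP[V [oV V0 sd d0]] := gd.
have [T [oT T0 HT]] := near0_open (filterI (open_nbhs_nbhs (conj oV V0))
  (map_germ_near gd (open_nbhs_nbhs (conj oU U0)))).
apply/map_germP; exists T; split=> //; last by rewrite d0.
apply: (smooth_map_comp oU _ sf) => [|x /HT[]//].
by apply: smooth_map_subset sd => x /HT[].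
Qed.

Lemma diffeo_comp n (d e : 'rV[R]_n -> 'rV[R]_n) :
  diffeo_germ d -> diffeo_germ e -> diffeo_germ (fun x => e (d x)).
Proof.
move=> [gd [d' [gd' dK dK']]] [ge [e' [ge' eK eK']]]; split; first exact: map_germ_comp.
exists (fun x => d' (e' x)); split; first exact: map_germ_comp.
  by apply: filterS2 dK (map_germ_near gd eK) => x h1 h2; rewrite h2 h1.
by apply: filterS2 eK' (map_germ_near ge' dK') => x h1 h2; rewrite h2 h1.
Qed.

Lemma A_equivalent_sym m n (f g : 'rV[R]_m -> 'rV[R]_n) : map_germ f -> map_germ g ->
  A_equivalent f g -> A_equivalent g f.
Proof.
move=> gf gg [ds [dt [[gs [es [ges sK sK']]] [gt [et [get tK tK']]] fg]]].
exists es, et; split.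
- by split=> //; exists ds.
- by split=> //; exists dt.
apply: filterS3 (map_germ_near ges fg) sK' (map_germ_near (map_germ_comp ges gf) tK) => x.
by move=> h1 h2 h3; rewrite -h3 h1 h2.
Qed.

Lemma A_equivalent_trans m n (f g h : 'rV[R]_m -> 'rV[R]_n) :
  A_equivalent f g -> A_equivalent g h -> A_equivalent f h.
Proof.
move=> [ds [dt [gs gt fg]]] [ds' [dt' [gs' gt' gh]]].
exists (fun x => ds' (ds x)), (fun x => dt' (dt x)); split; [exact: diffeo_comp..|].
by apply: filterS2 fg (map_germ_near gs.1 gh) => x -> ->.
Qed.

Lemma jac_eq_on m n (U : set 'rV[R]_m) (f g : 'rV[R]_m -> 'rV[R]_n) x : open U -> U x ->
  (forall y, U y -> f y = g y) -> jac f x = jac g x.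
Proof.
move=> oU Ux fg; apply/matrixP => k j; rewrite !jacE.
by apply: (@eq_derive_on _ _ U) => // y /fg ->.
Qed.

Lemma jac2_eq_on m n (U : set 'rV[R]_m) (f g : 'rV[R]_m -> 'rV[R]_n) w x : open U -> U x ->
  (forall y, U y -> f y = g y) -> jac2 f w x = jac2 g w x.
Proof.
move=> oU Ux fg; apply/matrixP => k j; rewrite !jac2E.
by apply: (@eq_derive_on _ _ U) => // y Uy; rewrite (jac_eq_on oU Uy fg).
Qed.

Lemma jac_id m (x : 'rV[R]_m) : jac id x = 1%:M.
Proof. by apply/matrixP => k j; rewrite jacE derive_proj !mxE eqxx eq_sym. Qed.

Lemma diffeo_det n (d : 'rV[R]_n -> 'rV[R]_n) : diffeo_germ d -> \det (jac d 0) != 0.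
Proof.
move=> [/map_germP[V [oV V0 sd d0]] [e [/map_germP[U [oU U0 se e0]] dK _]]].
have [W [oW W0 HW]] := near0_open dK.
have U0' : U (d 0) by rewrite d0.
have := jac_comp sd se V0 U0'.
rewrite (jac_eq_on (g := id) oW W0) // jac_id d0 => /(congr1 determinant).
rewrite det1 det_mulmx => E; apply/eqP => z; move: E; rewrite z mul0r => /eqP.
by rewrite oner_eq0.
Qed.

Lemma jac2_basis m n (U : set 'rV[R]_m) (F : 'rV[R]_m -> 'rV[R]_n) (w x : 'rV[R]_m) k j :
  open U -> smooth_map U F -> U x ->
  jac2 F w x k j = \sum_l w 0 l * jac2 F (delta_mx 0 l) x k j.
Proof.
move=> oU sF Ux; rewrite jac2E.
rewrite (derive_basis w (smooth_differentiable (smooth_jac k j oU sF) Ux)).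
by apply: eq_bigr => l _; rewrite jac2E.
Qed.

Section Target.
Variables (U : set 'rV[R]_2) (f : 'rV[R]_2 -> 'rV[R]_3).
Variables (T : set 'rV[R]_3) (g : 'rV[R]_3 -> 'rV[R]_3) (u w : 'rV[R]_2).
Hypotheses (oU : open U) (U0 : U 0) (sf : smooth_map U f) (f0 : f 0 = 0)
  (oT : open T) (sg : smooth_map T g) (fT : forall x, U x -> T (f x))
  (w0 : w *m jac f 0 = 0).

Let gf x := g (f x).
Let A x := w *m jac f x.
Let Q x := A x *m jac2 g (A x) (f x).
Let J x := jac g (f x).

Let sA : smooth_map U A. Proof. exact: smooth_mul_jac. Qed.
Let sJ k j : smooth_on U (fun x => J x k j).
Proof. exact: smooth_comp oT (smooth_jac k j oT sg) sf fT. Qed.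

Let AO k : is_bigO 1 (fun x => A x 0 k).
Proof. by apply: diff_is_bigO; [exact: smooth_differentiable (sA k) U0|rewrite /A w0 mxE]. Qed.

Let is_bigO0 h : smooth_on U h -> is_bigO 0 h.
Proof. by move=> sh; apply: continuous_is_bigO; exact: smooth_continuous sh U0. Qed.

Let QO j : is_bigO 2 (fun x => Q x 0 j).
Proof.
have [C C0 HC] : is_bigO 2 (fun x => \sum_k \sum_l A x 0 k *
    (A x 0 l * jac2 g (delta_mx 0 l) (f x) k j)).
  apply: is_bigO_sum => k; apply: is_bigO_sum => l; apply: (@is_bigO_mul _ _ 1 1) => //.
  apply: (@is_bigO_mul _ _ 1 0) => //; apply: is_bigO0.
  exact: smooth_comp oT (smooth_jac2 _ k j oT sg) sf fT.
exists C => //; apply: filterS2 (open_nbhs_nbhs (conj oU U0)) HC => x Ux.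
congr (`|_| <= _); rewrite /Q [RHS]mxE; apply: eq_bigr => k _.
by rewrite (jac2_basis _ k j oT sg (fT Ux)) mulr_sumr.
Qed.

Let PO (v : 'rV[R]_2) j : is_bigO 0 (fun x => (v *m jac f x *m J x) 0 j).
Proof. by apply: is_bigO0; apply: smooth_mulmx => //; exact: smooth_mul_jac. Qed.

Let AJO j : is_bigO 1 (fun x => (A x *m J x) 0 j).
Proof.
apply: diff_is_bigO; last by rewrite /A w0 mul0mx mxE.
by apply: smooth_differentiable U0; exact: smooth_mulmx.
Qed.

(** Q is quadratic in df(w), which vanishes at 0, and the middle vector is linear in it: these three
    small factors make [rest] O(3). *)
Let rest x := det3 (u *m jac f x *m J x) (A x *m J x) (Q x).

Let discr_target x : U x -> discr gf u w x = \det (J x) * discr f u w x + rest x.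
Proof.
move=> Ux; rewrite /discr.
rewrite (jac_comp sf sg Ux (fT Ux)) !mulmxA (jac2_comp w w oU oT sf sg fT Ux) -/(A x).
by rewrite det3Dr det3_mul mulrC.
Qed.

Let rest_o : is_littleo 2 rest.
Proof.
apply: is_bigO_lt.
have t i j k : is_bigO 3 (fun x => (A x *m J x) 0 i * (Q x 0 j * (u *m jac f x *m J x) 0 k)).
  by apply: (@is_bigO_mul _ _ 1 2) => //; apply: (@is_bigO_mul _ _ 2 0).
have t2 i j k : is_bigO 3 (fun x => (A x *m J x) 0 i *
    (Q x 0 j * (u *m jac f x *m J x) 0 k - Q x 0 k * (u *m jac f x *m J x) 0 j)).
  by under eq_fun do rewrite mulrBr; exact: is_bigO_sub.
have [C C0 HC] := is_bigO_add (is_bigO_add (t2 0 1 2) (t2 1 2 0)) (t2 2 0 1).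
by exists C => //; apply: filterS HC => x; rewrite /rest det3E.
Qed.

Lemma qform_sign_target s : \det (jac g 0) != 0 -> qform_sign s (discr gf u w) -> qform_sign s (discr f u w).
Proof.
move=> dJ qh; have sdet : smooth_on U (fun x => \det (J x)) by exact: smooth_det.
have cdet := smooth_continuous sdet U0.
have J0 : \det (J 0) != 0 by rewrite /J f0.
have cV : {for 0, continuous (fun x => (\det (J x))^-1)} by exact: continuousV.
have nJ := near_neq0 sdet U0 J0.
have := qform_sign_mul cV (invr_neq0 J0) (qform_sign_add (is_littleo_opp rest_o) qh).
apply: qform_sign_near; apply: filterS2 nJ (open_nbhs_nbhs (conj oU U0)) => x Jx Ux.
by rewrite discr_target // addrK mulKf.
Qed.

Lemma indep2_target : indep2 (u *m jac gf 0) (w *m jac2 gf w 0) ->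
  indep2 (u *m jac f 0) (w *m jac2 f w 0).
Proof.
rewrite (jac_comp sf sg U0 (fT U0)) (jac2_comp w w oU oT sf sg fT U0) w0 !mul0mx addr0 => ind.
by move=> a b E; apply: ind; rewrite mulmxA (scalemxAl a) (scalemxAl b) -mulmxDl E mul0mx.
Qed.

End Target.

(** The map dt o f1 = f2 o ds is compared with f2 through the source change and with f1 through the
    target change. One direction is enough, A-equivalence being symmetric. *)
Lemma A_equivalent_qform_sign (f1 f2 : 'rV[R]_2 -> 'rV[R]_3) (u1 w1 u2 w2 : 'rV[R]_2) s :
  map_germ f1 -> map_germ f2 -> A_equivalent f1 f2 ->
  adapted f1 u1 w1 -> adapted f2 u2 w2 ->
  (qform_sign s (discr f2 u2 w2) -> qform_sign s (discr f1 u1 w1)) /\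
  (indep2 (u2 *m jac f2 0) (w2 *m jac2 f2 w2 0) ->
   indep2 (u1 *m jac f1 0) (w1 *m jac2 f1 w1 0)).
Proof.
move=> g1 g2 [ds [dt [gs gt fg]]] a1 a2.
have /map_germP[U1 [oU1 U10 s1 f10]] := g1; have /map_germP[U2 [oU2 U20 s2 f20]] := g2.
have /map_germP[S [oS S0 ss ds0]] := gs.1; have /map_germP[T [oT T0 st dt0]] := gt.1.
have [V [oV V0 HV]] := near0_open (filterI fg (filterI (open_nbhs_nbhs (conj oU1 U10))
  (filterI (open_nbhs_nbhs (conj oS S0)) (filterI
    (map_germ_near gs.1 (open_nbhs_nbhs (conj oU2 U20)))
    (map_germ_near g1 (open_nbhs_nbhs (conj oT T0))))))).
have VU1 : V `<=` U1 by move=> x /HV[_ []].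
have VS : V `<=` S by move=> x /HV[_ [_ []]].
have VU2 x : V x -> U2 (ds x) by move=> /HV[_ [_ [_ []]]].
have VT x : V x -> T (f1 x) by move=> /HV[_ [_ [_ []]]].
have E x : V x -> dt (f1 x) = f2 (ds x) by move=> /HV[].
have sv1 := smooth_map_subset VU1 s1; have svs := smooth_map_subset VS ss.
have [D1 _ z1] := a1.
pose X x := u1 *m jac ds x; pose W x := w1 *m jac ds x; pose Z x := w1 *m jac2 ds w1 x.
have sX : smooth_map V X by exact: smooth_mul_jac.
have sW : smooth_map V W by exact: smooth_mul_jac.
have XW : det2 (X 0) (W 0) != 0 by rewrite det2_mul mulf_neq0 // diffeo_det.
have jE x : V x -> jac ds x *m jac f2 (ds x) = jac (fun y => dt (f1 y)) x.
  move=> Vx; rewrite -(jac_comp svs s2 Vx (VU2 x Vx)).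
  by apply: (jac_eq_on oV Vx) => y /E.
have j2E x : V x -> Z x *m jac f2 (ds x) + W x *m jac2 f2 (W x) (ds x) =
    w1 *m jac2 (fun y => dt (f1 y)) w1 x.
  move=> Vx; rewrite -(jac2_comp w1 w1 oV oU2 svs s2 VU2 Vx).
  by rewrite (@jac2_eq_on _ _ V (fun y => dt (f1 y)) (fun y => f2 (ds y))).
have W0 : W 0 *m jac f2 0 = 0.
  have := jE 0 V0; rewrite ds0 /W -mulmxA => ->.
  by rewrite (jac_comp sv1 st V0 (VT 0 V0)) mulmxA z1 mul0mx.
split=> [q|ind].
  apply: (qform_sign_target oV V0 sv1 f10 oT st VT z1 (diffeo_det gt)).
  have := @qform_sign_change _ _ _ oU2 U20 s2 _ _ _ _ Z _ _ oV V0 svs ds0 VU2 sX sW XW W0 a2 _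
    (diffeo_det gs) q.
  apply: qform_sign_near; apply: (open_near oV V0) => x Vx.
  by rewrite /discr_along /discr -jE // -j2E // !mulmxA.
apply: (indep2_target oV V0 sv1 oT st VT z1).
have := (@indep2_change _ _ _ oU2 U20 s2 _ _ Z _ _ XW W0 a2).2 ind.
have := j2E 0 V0; rewrite ds0 => ->.
by have := jE 0 V0; rewrite ds0 /X -mulmxA => ->.
Qed.

End Invariance.

(** * Reduction to a normal form *)

Section Diffeos.
Context {R : realType}.

Lemma diffeo_inv n (d : 'rV[R]_n -> 'rV[R]_n) : diffeo_germ d ->
  exists e, [/\ diffeo_germ e, \forall x \near (0 : 'rV[R]_n), e (d x) = x &
    \forall y \near (0 : 'rV[R]_n), d (e y) = y].
Proof.
move=> [gd [e [ge K K']]]; exists e; split=> //; split=> //; by exists d.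
Qed.

Lemma map_germ_id n : map_germ (fun x : 'rV[R]_n => x).
Proof.
apply/map_germP; exists setT; split=> //; first exact: openT.
by move=> j; exact: smooth_coord.
Qed.

Lemma diffeo_id n : diffeo_germ (fun x : 'rV[R]_n => x).
Proof.
split; first exact: map_germ_id.
by exists id; split; [exact: map_germ_id|exact: filterE|exact: filterE].
Qed.

Lemma A_equivalent_target m n (f : 'rV[R]_m -> 'rV[R]_n) dt :
  diffeo_germ dt -> A_equivalent f (fun x => dt (f x)).
Proof. by move=> gt; exists id, dt; split=> //; [exact: diffeo_id|exact: filterE]. Qed.

Lemma A_equivalent_source m n (f : 'rV[R]_m -> 'rV[R]_n) ds : map_germ f ->
  diffeo_germ ds -> A_equivalent f (fun x => f (ds x)).
Proof.
move=> gf gs; apply: A_equivalent_sym => //; first exact: map_germ_comp gs.1 gf.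
by exists ds, id; split=> //; [exact: diffeo_id|exact: filterE].
Qed.

Lemma A_equivalent_near m n (f g : 'rV[R]_m -> 'rV[R]_n) :
  (\forall x \near (0 : 'rV[R]_m), f x = g x) -> A_equivalent f g.
Proof. by move=> fg; exists id, id; split=> //; exact: diffeo_id. Qed.

Lemma jac_linear m n (M : 'M[R]_(m, n)) (x : 'rV[R]_m) : jac (fun p => p *m M) x = M.
Proof.
apply/matrixP => k j; rewrite jacE.
have s i : smooth_on [set: 'rV[R]_m] (fun p => p 0 i * M i j).
  by apply: smooth_mul; [exact: smooth_coord|exact: smooth_cst].
have -> : (fun p : 'rV[R]_m => (p *m M) 0 j) = fun p => \sum_i p 0 i * M i j.
  by apply/funext => p; rewrite mxE.
rewrite (derive_smooth_sum _ s) // (bigD1 k) //= big1 => [|i ik].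
  under eq_fun do rewrite mulrC; rewrite (derive_smoothZ (U := setT)) //.
    by rewrite derive_proj !mxE !eqxx mulr1 addr0.
  exact: smooth_coord.
under eq_fun do rewrite mulrC; rewrite (derive_smoothZ (U := setT)) //.
  by rewrite derive_proj !mxE (negbTE ik) andbF mulr0.
exact: smooth_coord.
Qed.

Lemma smooth_linear m n (U : set 'rV[R]_m) (M : 'M[R]_(m, n)) :
  smooth_map U (fun p => p *m M).
Proof.
move=> j; apply: smooth_mulmx => [i|i k]; [exact: smooth_coord|exact: smooth_cst].
Qed.

Lemma jac2_linear m n (M : 'M[R]_(m, n)) (w x : 'rV[R]_m) : jac2 (fun p => p *m M) w x = 0.
Proof.
apply/matrixP => k j; rewrite jac2E.
have -> : (fun y => jac (fun p => p *m M) y k j) = fun=> M k j.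
  by apply/funext => y; rewrite jac_linear.
by rewrite derive_cst0 mxE.
Qed.

Lemma diffeo_linear n (M : 'M[R]_n) : M \in unitmx -> diffeo_germ (fun p => p *m M).
Proof.
move=> uM.
have g (A : 'M[R]_n) : map_germ (fun p => p *m A).
  apply/map_germP; exists setT; split=> //; first exact: openT.
    exact: smooth_linear.
  exact: mul0mx.
split=> //; exists (fun p => p *m invmx M); split=> //.
  by apply: filterE => x; rewrite mulmxK.
by apply: filterE => x; rewrite mulmxKV.
Qed.

(** Since c does not depend on the i-th coordinate, adding c back along that axis is an explicit
    inverse. *)
Lemma diffeo_shear n (U : set 'rV[R]_n) (c : 'rV[R]_n -> R) i : open U -> U 0 ->
  smooth_on U c -> c 0 = 0 -> (forall y t, c (y + t *: delta_mx 0 i) = c y) ->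
  diffeo_germ (fun y => y - c y *: delta_mx 0 i).
Proof.
move=> oU U0 sc c0 ci.
have g (s : R) : map_germ (fun y => y + (s * c y) *: delta_mx 0 i).
  apply/map_germP; exists U; split=> // [j|]; last by rewrite c0 mulr0 scale0r addr0.
  have -> : (fun x : 'rV[R]_n => (x + (s * c x) *: delta_mx 0 i) 0 j) =
      fun x => x 0 j + s * c x * (delta_mx 0 i : 'rV[R]_n) 0 j.
    by apply/funext => x; rewrite !mxE.
  apply: smooth_add; first exact: smooth_coord.
  by apply: smooth_mul; [apply: smooth_mul => //|]; exact: smooth_cst.
have -> : (fun y => y - c y *: delta_mx 0 i) = fun y => y + (-1 * c y) *: delta_mx 0 i.
  by apply/funext => y; rewrite mulN1r scaleNr.
split=> //; exists (fun y => y + (1 * c y) *: delta_mx 0 i); split=> //.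
  by apply: filterE => x; rewrite ci -addrA -scalerDl -mulrDl addNr mul0r scale0r addr0.
by apply: filterE => x; rewrite ci -addrA -scalerDl -mulrDl subrr mul0r scale0r addr0.
Qed.

End Diffeos.

(** * Coordinates in which the map is (x, y^2, y b(x, y^2)) *)

Section NormalForm.
Context {R : realType}.
Local Notation e0 := (delta_mx 0 0 : 'rV[R]_2).
Local Notation e1 := (delta_mx 0 1 : 'rV[R]_2).

Lemma row_mul_delta n p (k : 'I_n) (A : 'M[R]_(n, p)) j : ((delta_mx 0 k : 'rV_n) *m A) 0 j = A k j.
Proof. by rewrite -rowE mxE. Qed.

Lemma diffeo_pt (U : set 'rV[R]_2) (a b : 'rV[R]_2 -> R) : open U -> U 0 ->
  smooth_on U a -> smooth_on U b -> a 0 = 0 -> b 0 = 0 ->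
  (forall v, 'D_v a 0 = 0 -> 'D_v b 0 = 0 -> v = 0) -> diffeo_germ (fun p => pt (a p) (b p)).
Proof.
move=> oU U0 sa sb a0 b0 inj.
apply: (inverse_function oU U0 (smooth_pt sa sb)).
  by rewrite a0 b0; apply: rV2P; rewrite mxE ?mxE.
move=> v H; apply: inj.
  by have := H 0; under eq_fun do rewrite pt0.
by have := H 1; under eq_fun do rewrite pt1.
Qed.

Section Straighten.
Variables (U : set 'rV[R]_2) (F : 'rV[R]_2 -> 'rV[R]_3).
Hypotheses (oU : open U) (U0 : U 0) (sF : smooth_map U F) (F0 : F 0 = 0)
  (F00 : jac F 0 0 0 = 1) (F10 : jac F 0 1 0 = 0) (F01 : jac F 0 0 1 = 0)
  (F11 : jac F 0 1 1 = 0) (F111 : jac2 F e1 0 1 1 = 1).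

(** The Jacobian determinant of the first two components. Its zero set is where these two components
    form a singular map; taking it as the coordinate y places this curve on y = 0. *)
Let m p := jac F p 0 0 * jac F p 1 1 - jac F p 1 0 * jac F p 0 1.

Let sJ k j : smooth_on U (fun p => jac F p k j). Proof. exact: smooth_jac. Qed.
Let sm : smooth_on U m. Proof. by apply: smooth_sub; exact: smooth_mul. Qed.

Let Dm v : 'D_v m 0 = jac2 F v 0 1 1.
Proof.
rewrite /m (derive_smoothB v (smooth_mul (sJ 0 0) (sJ 1 1)) (smooth_mul (sJ 1 0) (sJ 0 1)) U0).
rewrite (derive_smoothM v (sJ 0 0) (sJ 1 1) U0) (derive_smoothM v (sJ 1 0) (sJ 0 1) U0).
by rewrite F00 F10 F01 F11 !mul0r mul1r !addr0 subr0 jac2E.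
Qed.

Let Da v : 'D_v (fun p => F p 0 0) 0 = v 0 0.
Proof. by rewrite (derive_jac v 0 sF U0) mxE sum_I2 F00 F10 mulr1 mulr0 addr0. Qed.

Let dsigma : diffeo_germ (fun p => pt (F p 0 0) (m p)).
Proof.
apply: (diffeo_pt oU U0) => //; [by rewrite F0 mxE| |].
  by rewrite /m F00 F10 F01 F11 mulr0 mul0r subrr.
move=> v; rewrite Da Dm => v0.
rewrite (jac2_basis _ _ _ oU sF U0) sum_I2 v0 mul0r add0r F111 mulr1 => v1.
by apply: rV2P; rewrite mxE.
Qed.

(** In the coordinates (F_0, m) the second component G has a y-derivative that vanishes on y = 0,
    the singular curve. Hadamard's lemma therefore applies twice to G(x, y) - G(x, 0) and extracts
    the factor y^2. *)
Lemma straighten : exists k (r : R) (c : 'rV[R]_2 -> R) (u : 'rV[R]_2 -> R),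
  [/\ diffeo_germ k, 0 < r, smooth_on (ball 0 r) c, smooth_on (ball 0 r) u & 0 < u 0] /\
  (c 0 = 0 /\ forall p, ball 0 r p ->
    F (k p) 0 0 = p 0 0 /\ F (k p) 0 1 = c (pt (p 0 0) 0) + p 0 1 ^+ 2 * u p).
Proof.
have [k [dk _ sk]] := diffeo_inv dsigma.
have /map_germP[V [oV V0 sV k0]] := dk.1.
have nU : \forall p \near (0 : 'rV[R]_2), U p /\ jac F p 0 0 != 0.
  apply: filterI; first exact: open_nbhs_nbhs.
  by apply: (near_neq0 (sJ 0 0) U0); rewrite F00 oner_eq0.
have [r r0 Hr] := near0_ball (filterI sk (filterI (open_nbhs_nbhs (conj oV V0))
  (map_germ_near dk.1 nU))).
pose B : set 'rV[R]_2 := ball 0 r.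
have oB : open B by exact: ball_open.
have B0 : B 0 by exact: ballxx.
have skB : smooth_map B k by apply: smooth_map_subset sV => p /Hr[_ []].
have kU p : B p -> U (k p) by move=> /Hr[_ [_ []]].
have kn p : B p -> jac F (k p) 0 0 != 0 by move=> /Hr[_ [_ []]].
have kE0 p : B p -> F (k p) 0 0 = p 0 0.
  by move=> /Hr[/(congr1 (fun q : 'rV_2 => q 0 0)) + _]; rewrite pt0.
have kE1 p : B p -> m (k p) = p 0 1.
  by move=> /Hr[/(congr1 (fun q : 'rV_2 => q 0 1)) + _]; rewrite pt1.
pose G p := F (k p) 0 1.
have sG : smooth_on B G by exact: smooth_comp oU (sF 1) skB kU.
have sJk i j : smooth_on B (fun p => jac F (k p) i j).
  exact: smooth_comp oU (sJ i j) skB kU.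
have sjk i j : smooth_on B (fun p => jac k p i j) by exact: smooth_jac.
have sFk : smooth_map B (fun p => F (k p)) by exact: smooth_map_comp oU skB sF kU.
have D1 j p : B p -> 'D_e1 (fun p => F (k p) 0 j) p =
    jac k p 1 0 * jac F (k p) 0 j + jac k p 1 1 * jac F (k p) 1 j.
  move=> Bp; rewrite (derive_jac e1 j sFk Bp) row_mul_delta.
  by rewrite (jac_comp skB sF Bp (kU p Bp)) mxE sum_I2.
have rel0 p : B p -> jac k p 1 0 * jac F (k p) 0 0 + jac k p 1 1 * jac F (k p) 1 0 = 0.
  move=> Bp; rewrite -D1 //.
  have -> : 'D_e1 (fun p => F (k p) 0 0) p = 'D_e1 (fun p : 'rV[R]_2 => p 0 0) p.
    by apply: (@eq_derive_on _ _ B) => // y; exact: kE0.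
  by rewrite derive_proj mxE.
(* [rel0] eliminates the entry [jac k p 1 0] and leaves the minor m, which is y in the new
   coordinates. *)
have rel p : B p -> jac F (k p) 0 0 * 'D_e1 G p = jac k p 1 1 * p 0 1.
  move=> Bp; rewrite D1 // -kE1 // /m.
  have := rel0 p Bp.
  move: (jac k p 1 0) (jac k p 1 1) (jac F (k p) 0 0) (jac F (k p) 0 1) (jac F (k p) 1 0)
    (jac F (k p) 1 1) => a b x y z w E.
  by transitivity (b * (x * w - z * y) + y * (a * x + b * z)); [ring|rewrite E mulr0 addr0].
have G1 p : B p -> p 0 1 = 0 -> 'D_e1 G p = 0.
  move=> Bp p1; have /eqP := rel p Bp; rewrite p1 mulr0 mulf_eq0 (negbTE (kn p Bp)) /=.
  by move/eqP.
have b0 : jac k 0 1 1 = 1.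
  have a0 : jac k 0 1 0 = 0.
    by have := rel0 0 B0; rewrite k0 F00 F10 mulr0 mulr1 addr0.
  have smk : smooth_map U (fun p => pt (F p 0 0) (m p)) by exact: smooth_pt.
  have := jac_comp skB smk B0 (kU 0 B0); rewrite k0.
  rewrite (jac_eq_on (g := id) oB B0); last by move=> p /Hr[].
  have J11 : jac (fun p => pt (F p 0 0) (m p)) 0 1 1 = 1.
    by rewrite jacE; under eq_fun do rewrite pt1; rewrite Dm F111.
  rewrite jac_id => E; have := congr1 (fun A : 'M[R]_2 => A 1 1) E.
  by rewrite /= mxE [RHS]mxE sum_I2 a0 J11 mul0r add0r mulr1 eqxx => <-.
have DDG : 'D_e1 ('D_e1 G) 0 = 1.
  have sDG : smooth_on B ('D_e1 G) by exact: smooth_derive.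
  have M1 := derive_smoothM e1 (sJk 0 0) sDG B0.
  have M2 := derive_smoothM e1 (sjk 1 1) (smooth_coord B 1) B0.
  have ME : 'D_e1 (fun p => jac F (k p) 0 0 * 'D_e1 G p) 0 =
      'D_e1 (fun p => jac k p 1 1 * p 0 1) 0.
    by apply: (@eq_derive_on _ _ B) => // p Bp; exact: rel.
  move: ME; rewrite M1 M2 (G1 0 B0) ?mxE // k0 F00 b0 derive_proj !mxE eqxx.
  by rewrite !mul0r !mul1r !addr0.
pose P (p : 'rV[R]_2) : 'rV[R]_2 := pt (p 0 0) 0.
have PB p : B p -> B (P p).
  move=> /ballP pr; apply/ballP; apply: le_lt_trans pr.
  apply: norm_rV_le => //; apply: forall_I2; first by rewrite pt0 coord_le_norm.
  by rewrite pt1 normr0.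
have sP : smooth_map B P by apply: smooth_pt; [exact: smooth_coord|exact: smooth_cst].
have sc : smooth_on B (fun p => G (P p)) by exact: smooth_comp oB sG sP PB.
have sGm : smooth_on B (fun p => G p - G (P p)) by exact: smooth_sub.
have [|q sq Hq] := @hadamard _ _ 1 r (fun p => G p - G (P p)) sGm.
  by move=> x Bx x1; rewrite /P -[in G (pt _ _)]x1 -pt_eta subrr.
have GP0 p : B p -> 'D_e1 (fun p => G (P p)) p = 0.
  move=> Bp; rewrite (derive_comp2 (f := fun p => p 0 0) (g := fun=> 0) e1 oB sG
    (smooth_coord B 0) (smooth_cst B 0) Bp (PB p Bp)).
  by rewrite derive_proj derive_cst0 mxE /= !mul0r addr0.
have q0 p : B p -> p 0 1 = 0 -> q p = 0.
  move=> Bp p1; rewrite (Hq p Bp).2 // (derive_smoothB e1 sG sc Bp) G1 // sub0r.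
  by rewrite GP0 // oppr0.
have [|u su Hu] := @hadamard _ _ 1 r q sq; first exact: q0.
have GE p : B p -> G p = G (P p) + p 0 1 ^+ 2 * u p.
  move=> Bp; rewrite -[LHS](subrK (G (P p))) (Hq p Bp).1 (Hu p Bp).1 mulrA addrC.
  by rewrite -expr2.
exists k, r, G, u; split; last first.
  split; first by rewrite /G k0 F0 mxE.
  by move=> p Bp; split; [exact: kE0|exact: GE].
split=> //.
(* The y-derivative of y^2 u is y W, so the second derivative of G at 0, which is 1, equals W 0 = 2
   u 0; whence u 0 > 0. *)
pose W (p : 'rV[R]_2) := p 0 1 * 'D_e1 u p + 2 * u p.
have sD : smooth_on B ('D_e1 u) by exact: smooth_derive.
have s1 : smooth_on B (fun p : 'rV[R]_2 => p 0 1) by exact: smooth_coord.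
have s11 : smooth_on B (fun p : 'rV[R]_2 => p 0 1 ^+ 2) by exact: smooth_exp.
have sW : smooth_on B W.
  by apply: smooth_add; apply: smooth_mul => //; exact: smooth_cst.
have DGW p : B p -> 'D_e1 G p = p 0 1 * W p.
  move=> Bp; have -> : 'D_e1 G p = 'D_e1 (fun p => G (P p) + p 0 1 ^+ 2 * u p) p.
    exact: (@eq_derive_on _ _ B).
  rewrite (derive_smoothD e1 sc (smooth_mul s11 su) Bp) GP0 //.
  rewrite (derive_smoothM e1 s11 su Bp) (derive_smoothX 2 e1 s1 Bp) derive_proj mxE eqxx /W.
  by rewrite /=; ring.
have := DDG; have -> : 'D_e1 ('D_e1 G) 0 = 'D_e1 (fun p : 'rV[R]_2 => p 0 1 * W p) 0.
  by apply: (@eq_derive_on _ _ B).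
rewrite (derive_smoothM e1 s1 sW B0) derive_proj /W !mxE !mul0r !add0r eqxx mulr1 => u2.
by lra.
Qed.

End Straighten.

Definition row3 (x y z : R) : 'rV[R]_3 := \row_(j < 3) [:: x; y; z]`_j.

Lemma row3_0 x y z : row3 x y z 0 0 = x. Proof. by rewrite mxE. Qed.
Lemma row3_1 x y z : row3 x y z 0 1 = y. Proof. by rewrite mxE. Qed.
Lemma row3_2 x y z : row3 x y z 0 2 = z. Proof. by rewrite mxE. Qed.

Lemma rV3P (p q : 'rV[R]_3) : p 0 0 = q 0 0 -> p 0 1 = q 0 1 -> p 0 2 = q 0 2 -> p = q.
Proof. by move=> h0 h1 h2; apply/rowP; exact: forall_I3. Qed.

Lemma smooth_row3 m (U : set 'rV[R]_m) a b c : smooth_on U a -> smooth_on U b ->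
  smooth_on U c -> smooth_map U (fun x => row3 (a x) (b x) (c x)).
Proof.
move=> sa sb sc; apply: forall_I3.
- by under eq_fun do rewrite row3_0.
- by under eq_fun do rewrite row3_1.
- by under eq_fun do rewrite row3_2.
Qed.

(** The new second coordinate is y sqrt(u), which is smooth because u > 0 near 0; x, and with it
    c(x), is unchanged. *)
Lemma normalize_square (F : 'rV[R]_2 -> 'rV[R]_3) (r : R) (c u : 'rV[R]_2 -> R) : 0 < r ->
  smooth_on (ball 0 r) c -> smooth_on (ball 0 r) u -> 0 < u 0 ->
  (forall p, ball 0 r p -> F p 0 0 = p 0 0 /\ F p 0 1 = c (pt (p 0 0) 0) + p 0 1 ^+ 2 * u p) ->
  exists k, diffeo_germ k /\ \forall p \near (0 : 'rV[R]_2),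
    F (k p) 0 0 = p 0 0 /\ F (k p) 0 1 = c (pt (p 0 0) 0) + p 0 1 ^+ 2.
Proof.
move=> r0 sc su u0 HF.
have B0 : ball (0 : 'rV[R]_2) r 0 by exact: ballxx.
have npos : \forall p \near (0 : 'rV[R]_2), ball 0 r p /\ 0 < u p.
  apply: filterI; first by apply: open_nbhs_nbhs; split; [exact: ball_open|].
  exact: cvgr_gt (smooth_continuous su B0) _ u0.
have [V [oV V0 HV]] := near0_open npos.
have suV : smooth_on V u by apply: smooth_subset su => p /HV[].
have sq : smooth_on V (fun p => Num.sqrt (u p)) by apply: smooth_sqrt => // p /HV[].
have s1 : smooth_on V (fun p : 'rV[R]_2 => p 0 1) by exact: smooth_coord.
have [|k [dk _ kK]] := @diffeo_inv _ _ (fun p => pt (p 0 0) (p 0 1 * Num.sqrt (u p))).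
  apply: (diffeo_pt oV V0) => //.
  - exact: smooth_coord.
  - exact: smooth_mul.
  - by rewrite mxE.
  - by rewrite mxE mul0r.
  - move=> v; rewrite derive_proj (derive_smoothM v s1 sq V0) derive_proj => v0.
    rewrite mxE mul0r add0r => /eqP; rewrite mulf_eq0 sqrtr_eq0 leNgt u0 /= => /eqP v1.
    by apply: rV2P; rewrite mxE.
exists k; split=> //; apply: filterS2 kK (map_germ_near dk.1 npos) => p pk [Bk uk].
have E0 : k p 0 0 = p 0 0 by have := congr1 (fun q : 'rV_2 => q 0 0) pk; rewrite pt0.
have E1 : k p 0 1 * Num.sqrt (u (k p)) = p 0 1.
  by have := congr1 (fun q : 'rV_2 => q 0 1) pk; rewrite pt1.
have [-> ->] := HF _ Bk; rewrite E0; split=> //.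
by rewrite -E1 exprMn sqr_sqrtr // ltW.
Qed.

Definition normal_form (b : 'rV[R]_2 -> R) (p : 'rV[R]_2) : 'rV[R]_3 :=
  row3 (p 0 0) (p 0 1 ^+ 2) (p 0 1 * b (pt (p 0 0) (p 0 1 ^+ 2))).

(** The odd part of h in y vanishes on y = 0 and its quotient by y is even; Whitney's theorem is
    applied to the even part and to this quotient. *)
Lemma odd_even_split (r : R) (h : 'rV[R]_2 -> R) : 0 < r -> smooth_on (ball 0 r) h ->
  h 0 = 0 -> exists2 d, 0 < d & exists a b, [/\ smooth_on (ball 0 d) a,
    smooth_on (ball 0 d) b, a 0 = 0 & \forall p \near (0 : 'rV[R]_2),
    h p = a (pt (p 0 0) (p 0 1 ^+ 2)) + p 0 1 * b (pt (p 0 0) (p 0 1 ^+ 2))].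
Proof.
move=> r0 sh h0; pose B : set 'rV[R]_2 := ball 0 r.
have oB : open B by exact: ball_open.
pose N (p : 'rV[R]_2) : 'rV[R]_2 := pt (p 0 0) (- p 0 1).
have NB p : B p -> B (N p).
  move=> /ballP pr; apply/ballP; apply: le_lt_trans pr.
  apply: norm_rV_le => //; apply: forall_I2; first by rewrite pt0 coord_le_norm.
  by rewrite pt1 normrN coord_le_norm.
have sN : smooth_map B N.
  by apply: smooth_pt; [|apply: smooth_opp]; exact: smooth_coord.
have shN : smooth_on B (fun p => h (N p)) by exact: smooth_comp oB sh sN NB.
have N_pt x y : N (pt x y) = pt x (- y) by rewrite /N pt0 pt1.
have half g1 : smooth_on B g1 -> smooth_on B (fun p => 2^-1 * g1 p).
  by move=> s; apply: smooth_mul => //; exact: smooth_cst.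
pose e p := 2^-1 * (h p + h (N p)); pose o p := 2^-1 * (h p - h (N p)).
have se : smooth_on B e by apply: half; exact: smooth_add.
have so : smooth_on B o by apply: half; exact: smooth_sub.
have ev : even_fun r e.
  by split=> // x y _; rewrite /e !N_pt opprK addrC.
have [|q sq Hq] := @hadamard _ _ 1 r o so.
  move=> p _ p1; rewrite /o (_ : N p = p) ?subrr ?mulr0 //.
  by rewrite /N p1 oppr0 -p1 -pt_eta.
have qv : even_fun r q.
  split=> // x y Bxy; have [->|y0] := eqVneq y 0; first by rewrite oppr0.
  have B' : B (pt x (- y)) by rewrite -N_pt; exact: NB.
  have := (Hq _ B').1; have := (Hq _ Bxy).1; rewrite /o !N_pt opprK !pt1 => E1 E2.
  by apply: (mulfI y0); rewrite -E1 -[LHS]opprK -mulNr -E2; ring.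
have [d1 d10 [a sa Ha]] := even_factor r0 ev.
have [d2 d20 [b sb Hb]] := even_factor r0 qv.
have d0 : 0 < Num.min d1 d2 by rewrite lt_min d10.
exists (Num.min d1 d2) => //; exists a, b; split.
- by apply: smooth_subset sa => p /ballP pd; apply/ballP; rewrite (lt_le_trans pd) // ge_min lexx.
- by apply: smooth_subset sb => p /ballP pd; apply/ballP; rewrite (lt_le_trans pd) // ge_min lexx orbT.
- have := nbhs_singleton Ha.
  have -> : pt ((0 : 'rV[R]_2) 0 0) ((0 : 'rV[R]_2) 0 1 ^+ 2) = 0.
    by apply: rV2P; rewrite !mxE ?expr0n.
  by move=> <-; rewrite /e (_ : N 0 = 0) ?h0 ?addr0 ?mulr0 //; apply: rV2P; rewrite !mxE ?oppr0.
have nB : \forall p \near (0 : 'rV[R]_2), B p.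
  by apply: open_nbhs_nbhs; split => //; exact: ballxx.
apply: filterS3 nB Ha Hb => p Bp <- <-; rewrite -(Hq p Bp).1 /e /o.
by field.
Qed.
Lemma pt00 : pt 0 0 = 0 :> 'rV[R]_2.
Proof. by apply: rV2P; rewrite !mxE. Qed.

Lemma pt_square_ball d : 0 < d -> exists2 r, 0 < r &
  forall p : 'rV[R]_2, ball 0 r p -> ball 0 d (pt (p 0 0) (p 0 1 ^+ 2)).
Proof.
move=> d0; exists (Num.min d 1); first by rewrite lt_min d0 ltr01.
move=> p /ballP; rewrite lt_min => /andP[pd p1]; apply/ballP.
apply: le_lt_trans pd; apply: norm_rV_le => //; apply: forall_I2.
  by rewrite pt0 coord_le_norm.
rewrite pt1 normrX expr2; apply: le_trans (coord_le_norm p 1).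
by rewrite ler_piMl // (le_trans (coord_le_norm p 1)) // ltW.
Qed.

Section NormalFormGerm.
Variables (d : R) (b : 'rV[R]_2 -> R).
Hypotheses (d0 : 0 < d) (sb : smooth_on (ball 0 d) b).

Lemma smooth_pt_square (g : 'rV[R]_2 -> R) : smooth_on (ball 0 d) g ->
  exists2 r, 0 < r & 
    smooth_on (ball 0 r) (fun p : 'rV[R]_2 => g (pt (p 0 0) (p 0 1 ^+ 2))).
Proof.
move=> sg; have [r r0 Hr] := pt_square_ball d0; exists r => //.
apply: (@smooth_comp R 2 2 _ (ball 0 d) g (fun p => pt (p 0 0) (p 0 1 ^+ 2))) => //.
  exact: ball_open.
by apply: smooth_pt; [exact: smooth_coord|apply: smooth_exp; exact: smooth_coord].
Qed.

Lemma smooth_normal_form : exists2 r, 0 < r & smooth_map (ball 0 r) (normal_form b).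
Proof.
have [r r0 sr] := smooth_pt_square sb; exists r => //.
apply: smooth_row3; [exact: smooth_coord|apply: smooth_exp; exact: smooth_coord|].
by apply: smooth_mul => //; exact: smooth_coord.
Qed.

Lemma map_germ_normal_form : map_germ (normal_form b).
Proof.
have [r r0 sr] := smooth_normal_form.
apply/map_germP; exists (ball 0 r); split=> //; [exact: ball_open|exact: ballxx|].
by apply: rV3P; rewrite !mxE /= ?expr0n ?mul0r.
Qed.

Lemma jac_normal_form v : v *m jac (normal_form b) 0 = row3 (v 0 0) 0 (v 0 1 * b 0).
Proof.
have [r r0 sr] := smooth_normal_form; have [r' r'0 sb'] := smooth_pt_square sb.
have B0 : ball (0 : 'rV[R]_2) r 0 by exact: ballxx.
have B'0 : ball (0 : 'rV[R]_2) r' 0 by exact: ballxx.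
have s1 : smooth_on (ball 0 r') (fun p : 'rV[R]_2 => p 0 1) by exact: smooth_coord.
apply: rV3P; rewrite -(derive_jac v _ sr B0) ?row3_0 ?row3_1 ?row3_2.
- by under eq_fun do rewrite row3_0; rewrite derive_proj.
- under eq_fun do rewrite row3_1.
  by rewrite (derive_smoothX 2 v s1 B'0) mxE mulr0 mul0r.
under eq_fun do rewrite row3_2.
rewrite (derive_smoothM v s1 sb' B'0) derive_proj !mxE mul0r add0r expr0n pt00.
by rewrite mulrC.
Qed.

End NormalFormGerm.

Lemma A_equivalent_kernel m n (f g : 'rV[R]_m -> 'rV[R]_n) (w : 'rV[R]_m) :
  map_germ f -> map_germ g -> A_equivalent f g -> w != 0 -> w *m jac f 0 = 0 ->
  exists2 v : 'rV[R]_m, v != 0 & v *m jac g 0 = 0.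
Proof.
move=> gf gg [ds [dt [gs gt fg]]] w0 wf.
have /map_germP[U1 [oU1 U10 s1 f10]] := gf; have /map_germP[U2 [oU2 U20 s2 f20]] := gg.
have /map_germP[S [oS S0 ss ds0]] := gs.1; have /map_germP[T [oT T0 st dt0]] := gt.1.
exists (w *m jac ds 0).
  apply: contra_neq w0 => E.
  have u : jac ds 0 \in unitmx by rewrite unitmxE unitfE diffeo_det.
  by rewrite -[w](mulmxK u) E mul0mx.
have [V [oV V0 HV]] := near0_open fg.
have := jac_eq_on oV V0 HV.
rewrite (jac_comp s1 st U10) ?f10 // (jac_comp ss s2 S0) ?ds0 // => E.
by rewrite -mulmxA -E mulmxA wf mul0mx.
Qed.

(** A and B are completed by their cross product C, for which det3 A B C = |C|^2 in the Euclidean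
    norm; if C = 0, then A and B are dependent. *)
Lemma exists_frame (A B : 'rV[R]_3) : indep2 A B -> exists2 T : 'M[R]_3, T \in unitmx &
  A *m T = delta_mx 0 0 /\ B *m T = delta_mx 0 1.
Proof.
move=> ind.
pose C := row3 (A 0 1 * B 0 2 - A 0 2 * B 0 1) (A 0 2 * B 0 0 - A 0 0 * B 0 2)
  (A 0 0 * B 0 1 - A 0 1 * B 0 0).
pose M : 'M[R]_3 := \matrix_(i < 3) [:: A; B; C]`_i.
have uM : M \in unitmx.
  rewrite unitmxE unitfE; apply/eqP; rewrite -/(det3 A B C) => D.
  have {D} : C 0 0 ^+ 2 + C 0 1 ^+ 2 + C 0 2 ^+ 2 = 0.
    by rewrite -[RHS]D det3E row3_0 row3_1 row3_2; ring.
  move/eqP; rewrite !paddr_eq0 ?addr_ge0 ?sqr_ge0 // !sqrf_eq0.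
  rewrite row3_0 row3_1 row3_2 => /andP[/andP[/eqP c0 /eqP c1] /eqP c2].
  have Ai i : B 0 i *: A + (- A 0 i) *: B = 0.
    move: i; apply: forall_I3; apply: rV3P; rewrite !mxE; try ring.
    + by rewrite -[RHS]oppr0 -[in RHS]c2; ring.
    + by rewrite -[RHS]c1; ring.
    + by rewrite -[RHS]c2; ring.
    + by rewrite -[RHS]oppr0 -[in RHS]c0; ring.
    + by rewrite -[RHS]oppr0 -[in RHS]c1; ring.
    + by rewrite -[RHS]c0; ring.
  have [/eqP] : (1 : R) = 0 /\ (0 : R) = 0; last by rewrite oner_eq0.
  apply: (ind); rewrite scale1r scale0r addr0; apply/rowP => i; rewrite mxE.
  by have [_ /eqP] := ind _ _ (Ai i); rewrite oppr_eq0 => /eqP.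
exists (invmx M); first by rewrite unitmx_inv.
have rE k : row k M *m invmx M = delta_mx 0 k by rewrite rowE mulmxK.
by split; [rewrite -(rE 0)|rewrite -(rE 1)]; congr (_ *m _); rewrite rowK.
Qed.

Lemma frame_change (f : 'rV[R]_2 -> 'rV[R]_3) (u w : 'rV[R]_2) : map_germ f ->
  adapted f u w -> indep2 (u *m jac f 0) (w *m jac2 f w 0) ->
  exists g, [/\ map_germ g, A_equivalent f g, jac g 0 0 0 = 1 /\ jac g 0 1 0 = 0,
    jac g 0 0 1 = 0 /\ jac g 0 1 1 = 0 & jac2 g e1 0 1 1 = 1].
Proof.
move=> gf [D _ w0] /exists_frame[T uT [AT BT]].
pose M : 'M[R]_2 := \matrix_(i < 2) [:: u; w]`_i.
have uM : M \in unitmx.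
  by rewrite unitmxE unitfE det_mx2 !mxE.
have e0M : e0 *m M = u by rewrite -rowE rowK.
have e1M : e1 *m M = w by rewrite -rowE rowK.
have dM := diffeo_linear uM; have dT := diffeo_linear uT.
pose h p := f (p *m M); pose g p := h p *m T.
have gh : map_germ h by exact: map_germ_comp dM.1 gf.
have gg : map_germ g by exact: map_germ_comp gh dT.1.
have /map_germP[U [oU U0 sf f0]] := gf; have /map_germP[V [oV V0 sh h0]] := gh.
have [S [oS S0 HS]] := near0_open (map_germ_near dM.1 (open_nbhs_nbhs (conj oU U0))).
have JhE v : v *m jac h 0 = v *m M *m jac f 0.
  by rewrite (jac_comp (smooth_linear S M) sf S0) ?mul0mx // jac_linear mulmxA.
have JgE v : v *m jac g 0 = v *m M *m jac f 0 *m T.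
  rewrite (jac_comp sh (smooth_linear setT T) V0) // jac_linear.
  by rewrite mulmxA JhE.
have J2hE : e1 *m jac2 h e1 0 = w *m jac2 f w 0.
  rewrite (jac2_comp e1 e1 oS oU (smooth_linear S M) sf HS S0) jac2_linear.
  by rewrite mulmx0 mul0mx add0r jac_linear mul0mx e1M.
have J2gE : e1 *m jac2 g e1 0 = delta_mx 0 1.
  rewrite (jac2_comp e1 e1 oV (@openT _) sh (smooth_linear setT T) _ V0) // jac2_linear.
  by rewrite mulmx0 addr0 jac_linear J2hE BT.
exists g; split=> //.
- apply: (A_equivalent_trans (A_equivalent_source gf dM)).
  have E := A_equivalent_target h dT.
  exact: E.
- split; rewrite -row_mul_delta JgE ?e0M ?e1M ?AT ?w0 ?mul0mx ?mxE //.
- split; rewrite -row_mul_delta JgE ?e0M ?e1M ?AT ?w0 ?mul0mx ?mxE //.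
by rewrite -row_mul_delta J2gE mxE.
Qed.

Lemma A_equivalent_normal_form (f : 'rV[R]_2 -> 'rV[R]_3) (u w : 'rV[R]_2) : map_germ f ->
  adapted f u w -> indep2 (u *m jac f 0) (w *m jac2 f w 0) ->
  exists d b, [/\ 0 < d, smooth_on (ball 0 d) b, b 0 = 0 & A_equivalent f (normal_form b)].
Proof.
move=> gf fuw ind; have [D _ w0] := fuw.
have [g [gg fg [g00 g10] [g01 g11] g111]] := frame_change gf fuw ind.
have /map_germP[U [oU U0 sg g0]] := gg.
have [k [r [c [v [[dk r0 sc sv v0] [c0 Hk]]]]]] :=
  straighten oU U0 sg g0 g00 g10 g01 g11 g111.
have [k2 [dk2 Hk2]] := normalize_square r0 sc sv v0 Hk.
pose G p := g (k (k2 p)).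
have gG : map_germ G by exact: map_germ_comp dk2.1 (map_germ_comp dk.1 gg).
have fG : A_equivalent f G.
  apply: (A_equivalent_trans fg); apply: (A_equivalent_source gg).
  exact: (diffeo_comp dk2 dk).
have /map_germP[V [oV V0 sG G0]] := gG.
have [r3 r30 HV] := near0_ball (open_nbhs_nbhs (conj oV V0)).
have [||d d0 [a [b [sa sb a0 Hab]]]] := @odd_even_split r3 (fun p => G p 0 2) r30.
- exact: smooth_subset (sG 2).
- by rewrite G0 mxE.
have eb : A_equivalent f (normal_form b).
  have norm_pt (x : 'rV[R]_3) y : `|y| <= `|x| -> `|pt (x 0 0) y| <= `|x|.
    move=> yx; apply: norm_rV_le => //; apply: forall_I2; first by rewrite pt0 coord_le_norm.
    by rewrite pt1.
  (* Two shears of the target: [t1] removes c(x) from the second component, [t2] then removes the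
     even part a(x, y^2) from the third. *)
  have t1 : diffeo_germ (fun y : 'rV[R]_3 => y - c (pt (y 0 0) 0) *: delta_mx 0 1).
    apply: (@diffeo_shear _ _ (ball 0 r)); [exact: ball_open|exact: ballxx| | |].
    - apply: (@smooth_comp R 3 2 _ (ball 0 r) c (fun y => pt (y 0 0) 0)) => //.
      + exact: ball_open.
      + by apply: smooth_pt; [exact: smooth_coord|exact: smooth_cst].
      + move=> y /ballP yr; apply/ballP; apply: le_lt_trans yr.
        by apply: norm_pt; rewrite normr0.
    - by rewrite mxE pt00.
    - by move=> y t; rewrite !mxE /= mulr0 addr0.
  have t2 : diffeo_germ (fun y : 'rV[R]_3 => y - a (pt (y 0 0) (y 0 1)) *: delta_mx 0 2).
    apply: (@diffeo_shear _ _ (ball 0 d)); [exact: ball_open|exact: ballxx| | |].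
    - apply: (@smooth_comp R 3 2 _ (ball 0 d) a (fun y => pt (y 0 0) (y 0 1))) => //.
      + exact: ball_open.
      + by apply: smooth_pt; exact: smooth_coord.
      + move=> y /ballP yr; apply/ballP; apply: le_lt_trans yr.
        by apply: norm_pt; rewrite coord_le_norm.
    - by rewrite !mxE pt00.
    - by move=> y t; rewrite !mxE /= mulr0 !addr0.
  apply: (A_equivalent_trans fG); apply: (A_equivalent_trans (A_equivalent_target G t1)).
  apply: (A_equivalent_trans (A_equivalent_target _ t2)); apply: A_equivalent_near.
  apply: filterS2 Hk2 Hab => p [h0 h1] h2; rewrite -/(G p) in h0 h1 h2 *.
  apply: rV3P; rewrite !mxE /= ?h0 ?h1 ?h2 ?mulr0 ?mulr1 ?subr0 //.
  - by ring.
  - by rewrite [c _ + _]addrC addrK addrAC subrr add0r.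
exists d, b; split=> //.
(* A-equivalence preserves the existence of a kernel vector at 0, and the differential of the normal
   form sends v to (v_0, 0, v_1 b(0)); this forces b(0) = 0. *)
have w0' : w != 0.
  by apply: contra_neq D => ->; rewrite /det2 !mxE !mulr0 subrr.
have [q q0] := A_equivalent_kernel gf (map_germ_normal_form d0 sb) eb w0' w0.
rewrite (jac_normal_form d0 sb) => E.
have qE : q 0 0 = 0 by have := congr1 (fun x : 'rV_3 => x 0 0) E; rewrite row3_0 mxE.
have /eqP : q 0 1 * b 0 = 0 by have := congr1 (fun x : 'rV_3 => x 0 2) E; rewrite row3_2 mxE.
rewrite mulf_eq0 => /orP[/eqP q1|/eqP//].
by case/eqP: q0; apply: rV2P; rewrite mxE.
Qed.

End NormalForm.

(** * The 2-jet of the discriminant of a normal form *)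

Section NormalFormJet.
Context {R : realType}.
Local Notation e0 := (delta_mx 0 0 : 'rV[R]_2).
Local Notation e1 := (delta_mx 0 1 : 'rV[R]_2).

Section Hfun.
(* The derivatives of [b] are named, lest unification compare them. *)
Variables (d r : R) (b bz bzz : 'rV[R]_2 -> R).
Hypotheses (sb : smooth_on (ball 0 d) b) (sbz : smooth_on (ball 0 d) bz)
  (sbzz : smooth_on (ball 0 d) bzz)
  (bzE : forall p, ball 0 d p -> 'D_e1 b p = bz p)
  (bzzE : forall p, ball 0 d p -> 'D_e1 bz p = bzz p).
Let B : set 'rV[R]_2 := ball 0 r.
Let sq (g : 'rV[R]_2 -> R) (p : 'rV[R]_2) := g (pt (p 0 0) (p 0 1 ^+ 2)).
Hypothesis rd : forall p, B p -> ball 0 d (pt (p 0 0) (p 0 1 ^+ 2)).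

Let oD : open (ball (0 : 'rV[R]_2) d). Proof. exact: ball_open. Qed.
Let oB : open B. Proof. exact: ball_open. Qed.
Let s0 : smooth_on B (fun p => p 0 0). Proof. exact: smooth_coord. Qed.
Let s1 : smooth_on B (fun p => p 0 1). Proof. exact: smooth_coord. Qed.
Let s11 : smooth_on B (fun p => p 0 1 ^+ 2). Proof. exact: smooth_exp. Qed.

Lemma smooth_sq g : smooth_on (ball 0 d) g -> smooth_on B (sq g).
Proof.
move=> sg.
apply: (@smooth_comp R 2 2 _ (ball 0 d) g (fun p => pt (p 0 0) (p 0 1 ^+ 2))) => //.
exact: smooth_pt.
Qed.

Lemma derive_sq g v p : smooth_on (ball 0 d) g -> B p ->
  'D_v (sq g) p = v 0 0 * sq ('D_e0 g) p + 2 * p 0 1 * v 0 1 * sq ('D_e1 g) p.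
Proof.
move=> sg Bp; rewrite /sq.
rewrite (derive_comp2 (f := fun p => p 0 0) (g := fun p => p 0 1 ^+ 2) v
  oD sg s0 s11 Bp (rd Bp)).
by rewrite derive_proj (derive_smoothX 2 v s1 Bp) derive_proj expr1.
Qed.

Lemma derive_sq1 g gz p : smooth_on (ball 0 d) g ->
  (forall p, ball 0 d p -> 'D_e1 g p = gz p) -> B p ->
  'D_e1 (sq g) p = 2 * p 0 1 * sq gz p.
Proof.
move=> sg gE Bp; rewrite derive_sq // !mxE /= mul0r add0r mulr1.
by rewrite /sq gE //; exact: rd.
Qed.

Let N := normal_form b.
Let sN : smooth_map B N.
Proof. by apply: smooth_row3 => //; apply: smooth_mul => //; exact: smooth_sq. Qed.

Let jacN p : B p -> exists z, forall v, v *m jac N p = row3 (v 0 0) (2 * p 0 1 * v 0 1)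
  (p 0 1 * (v 0 0 * z + 2 * p 0 1 * v 0 1 * sq bz p) + sq b p * v 0 1).
Proof.
move=> Bp; exists (sq ('D_e0 b) p) => v; apply: rV3P; rewrite -(derive_jac v _ sN Bp) ?row3_0 ?row3_1 ?row3_2.
- by under eq_fun do rewrite row3_0; rewrite derive_proj.
- under eq_fun do rewrite row3_1.
  by rewrite (derive_smoothX 2 v s1 Bp) derive_proj expr1.
under eq_fun do rewrite row3_2.
by rewrite (derive_smoothM v s1 (smooth_sq sb) Bp) derive_proj derive_sq // [in sq ('D_e1 b) p]/sq bzE //; exact: rd.
Qed.

Lemma jac2_normal_form p : B p -> e1 *m jac2 N e1 p =
  row3 0 2 (6 * p 0 1 * sq bz p + 4 * p 0 1 ^+ 3 * sq bzz p).
Proof.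
move=> Bp.
have sc : smooth_map B (fun=> e1) by move=> i; exact: smooth_cst.
have E j : (e1 *m jac2 N e1 p) 0 j = 'D_e1 (fun y => (e1 *m jac N y) 0 j) p.
  rewrite (derive_mul_jac e1 j oB sN sc Bp).
  by rewrite jac_cst mulmx0 mul0mx add0r.
have e10 : e1 0 0 = 0 by rewrite mxE.
have e11 : e1 0 1 = 1 by rewrite mxE.
apply: rV3P; rewrite E ?row3_0 ?row3_1 ?row3_2.
- have -> : 'D_e1 (fun y => (e1 *m jac N y) 0 0) p = 'D_e1 (fun=> 0) p.
    by apply: (@eq_derive_on _ _ B) => // y /jacN[z ->]; rewrite row3_0 e10.
  exact: derive_cst0.
- have -> : 'D_e1 (fun y => (e1 *m jac N y) 0 1) p = 'D_e1 (fun y : 'rV[R]_2 => 2 * y 0 1) p.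
    by apply: (@eq_derive_on _ _ B) => // y /jacN[z ->]; rewrite row3_1 e11 mulr1.
  by rewrite (derive_smoothZ 2 e1 s1 Bp) derive_proj e11 mulr1.
have -> : 'D_e1 (fun y => (e1 *m jac N y) 0 2) p =
    'D_e1 (fun y : 'rV[R]_2 => 2 * (y 0 1 ^+ 2 * sq bz y) + sq b y) p.
  by apply: (@eq_derive_on _ _ B) => // y /jacN[z ->]; rewrite row3_2 e10 e11; ring.
have sz := smooth_sq sbz; have s11z := smooth_mul s11 sz.
have s211z : smooth_on B (fun y => 2 * (y 0 1 ^+ 2 * sq bz y)).
  by apply: smooth_mul => //; exact: smooth_cst.
rewrite (derive_smoothD e1 s211z (smooth_sq sb) Bp) (derive_smoothZ 2 e1 s11z Bp).
rewrite (derive_smoothM e1 s11 sz Bp) (derive_smoothX 2 e1 s1 Bp) derive_proj.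
rewrite (derive_sq1 sb bzE Bp) (derive_sq1 sbz bzzE Bp) e11 expr1.
by ring.
Qed.

Lemma discr_normal_form p : B p -> discr N e0 e1 p =
  - 2 * sq b p + 8 * (p 0 1 ^+ 2 * sq bz p) + 8 * (p 0 1 ^+ 4 * sq bzz p).
Proof.
move=> Bp; rewrite /discr jac2_normal_form //; have [z zE] := jacN Bp.
by rewrite !zE det3E !row3_0 !row3_1 !row3_2 !mxE /=; ring.
Qed.

Hypothesis r0 : 0 < r.
Let B0 : B 0. Proof. exact: ballxx. Qed.

Let is_bigO0 g : smooth_on B g -> is_bigO 0 g.
Proof. by move=> sg; apply: continuous_is_bigO; exact: smooth_continuous sg B0. Qed.

Let is_littleo0 g : smooth_on (ball 0 d) g -> is_littleo 0 (fun p => sq g p - g 0).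
Proof.
move=> sg; apply: cvg0_is_littleo.
  apply: (@smooth_continuous _ _ B) => //.
  by apply: smooth_sub; [exact: smooth_sq|exact: smooth_cst].
by rewrite /sq !mxE expr0n pt00 subrr.
Qed.

Let xO i j : is_bigO 2 (fun p : 'rV[R]_2 => p 0 i * p 0 j).
Proof. by apply: (@is_bigO_mul _ _ 1 1); exact: coord_is_bigO. Qed.

Let y4 : is_bigO 4 (fun p : 'rV[R]_2 => p 0 1 * p 0 1 * (p 0 1 * p 0 1)).
Proof. exact: (@is_bigO_mul _ _ 2 2). Qed.

(** At second order the term -2 b contributes -2 (b1(0) x^2 + b2(0) y^2), as z stands for y^2, and 8
    y^2 b_z contributes 8 b2(0) y^2; hence 6 = 8 - 2. The remaining term is of order four. *)
Lemma qform_normal_form (b1 b2 : 'rV[R]_2 -> R) :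
  smooth_on (ball 0 d) b1 -> smooth_on (ball 0 d) b2 ->
  (forall p, ball 0 d p -> b p = p 0 0 ^+ 2 * b1 p + p 0 1 * b2 p) ->
  qform (discr N e0 e1) (- 2 * b1 0) 0 (6 * b2 0).
Proof.
move=> sb1 sb2 bE.
have D0 : ball (0 : 'rV[R]_2) d 0 by have := rd B0; rewrite !mxE expr0n pt00.
have bz0 : bz 0 = b2 0.
  rewrite -bzE //.
  have -> : 'D_e1 b 0 = 'D_e1 (fun p : 'rV[R]_2 => p 0 0 ^+ 2 * b1 p + p 0 1 * b2 p) 0.
    by apply: (@eq_derive_on _ _ (ball 0 d)).
  have t0 : smooth_on (ball 0 d) (fun p : 'rV[R]_2 => p 0 0) by exact: smooth_coord.
  have t1 : smooth_on (ball 0 d) (fun p : 'rV[R]_2 => p 0 1) by exact: smooth_coord.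
  have t00 : smooth_on (ball 0 d) (fun p : 'rV[R]_2 => p 0 0 ^+ 2) by exact: smooth_exp.
  rewrite (derive_smoothD e1 (smooth_mul t00 sb1) (smooth_mul t1 sb2) D0).
  rewrite (derive_smoothM e1 t00 sb1 D0) (derive_smoothM e1 t1 sb2 D0).
  rewrite (derive_smoothX 2 e1 t0 D0) !derive_proj !mxE eqxx expr1 expr0n /=.
  by rewrite !(mul0r, mulr0, mulr1, add0r).
pose g (p : 'rV[R]_2) := - 2 * (p 0 0 * p 0 0 * (sq b1 p - b1 0)) +
  (- 2 * (p 0 1 * p 0 1 * (sq b2 p - b2 0)) + (8 * (p 0 1 * p 0 1 * (sq bz p - bz 0)) +
   8 * (p 0 1 * p 0 1 * (p 0 1 * p 0 1) * sq bzz p))).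
have og : is_littleo 2 g.
  have cst (k : R) (f : 'rV[R]_2 -> R) : is_littleo 2 f -> is_littleo 2 (fun p => k * f p).
    by move=> hf; apply: (@is_littleo_mul _ _ 0 2) => //; exact: is_bigO_cst.
  have t i j f : smooth_on (ball 0 d) f -> is_littleo 2 (fun p => p 0 i * p 0 j * (sq f p - f 0)).
    by move=> sf; apply: (@is_littleo_mul _ _ 2 0) => //; exact: is_littleo0.
  apply: is_littleo_add; first by apply: cst; exact: t.
  apply: is_littleo_add; first by apply: cst; exact: t.
  apply: is_littleo_add; first by apply: cst; exact: t.
  apply: cst; apply: is_bigO_lt; apply: (@is_bigO_le _ _ _ 4) => //.
  by apply: (@is_bigO_mul _ _ 4 0) => //; apply: is_bigO0; exact: smooth_sq.
apply: is_littleo_near og; apply: (open_near oB B0) => p Bp.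
rewrite discr_normal_form // [sq b p]bE; last exact: rd.
rewrite /g /quad pt0 pt1 bz0 -/(sq b1 p) -/(sq b2 p).
by move: (sq b1 p) (sq b2 p) (sq bz p) (sq bzz p) (b1 0) (b2 0) => ? ? ? ? ? ?; ring.
Qed.

(** The linear part of the discriminant is -2 c1(0) x, the terms in z = y^2 being of order two. *)
Lemma normal_form_linear_part c : qform_sign c (discr N e0 e1) ->
  forall (c1 b2 : 'rV[R]_2 -> R), smooth_on (ball 0 d) c1 -> smooth_on (ball 0 d) b2 ->
  (forall p, ball 0 d p -> b p = p 0 0 * c1 p + p 0 1 * b2 p) -> c1 0 = 0.
Proof.
move=> /qform_sign_is_bigO hO c1 b2 sc1 sb2 bE.
have h1 := is_bigO_lt hO.
pose g (p : 'rV[R]_2) := - 2^-1 * discr N e0 e1 p - (p 0 1 * p 0 1 * (sq b2 p - 4 * sq bz p -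
   4 * (p 0 1 ^+ 2 * sq bzz p)) + p 0 0 * (sq c1 p - c1 0)).
have og : is_littleo 1 g.
  apply: is_littleo_sub; first by apply: (@is_littleo_mul _ _ 0 1) => //; exact: is_bigO_cst.
  apply: is_littleo_add; last by apply: (@is_littleo_mul _ _ 1 0); [exact: coord_is_bigO|exact: is_littleo0].
  apply: is_bigO_lt; apply: (@is_bigO_mul _ _ 2 0) => //; apply: is_bigO0.
  have cst (k : R) (f : 'rV[R]_2 -> R) : smooth_on B f -> smooth_on B (fun p => k * f p).
    by apply: smooth_mul; exact: smooth_cst.
  apply: smooth_sub; last by apply: cst; apply: smooth_mul => //; exact: smooth_sq.
  by apply: smooth_sub; [exact: smooth_sq|apply: cst; exact: smooth_sq].
have e00 : e0 0 0 = 1 by rewrite mxE.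
rewrite -[LHS]mul1r -e00; apply: (@is_littleo1_linear0 _ _ (fun p : 'rV[R]_2 => p 0 0 * c1 0) e0).
  by move=> s /=; rewrite [X in X * _ = _]mxE mulrA.
apply: is_littleo_near og; apply: (open_near oB B0) => p Bp.
rewrite /g discr_normal_form // [sq b p]bE; last exact: rd.
rewrite pt0 pt1 -/(sq c1 p) -/(sq b2 p).
by move: (sq c1 p) (sq b2 p) (sq bz p) (sq bzz p) (c1 0) => ? ? ? ? ?; field.
Qed.

End Hfun.

(** Hadamard's lemma in z, then in x on the axis z = 0; the coefficient of x so found vanishes at 0,
    which permits a second division by x. The determinant of the form is -12 b1(0) b2(0), whence the
    sign. *)
Lemma normal_form_decomposition (d s : R) (b : 'rV[R]_2 -> R) : 0 < d ->
  smooth_on (ball 0 d) b -> b 0 = 0 -> qform_sign s (discr (normal_form b) e0 e1) ->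
  exists b1 b2, [/\ smooth_on (ball 0 d) b1, smooth_on (ball 0 d) b2, s * (b1 0 * b2 0) < 0 &
    forall p, ball 0 d p -> b p = p 0 0 ^+ 2 * b1 p + p 0 1 * b2 p].
Proof.
move=> d0 sb b0 qh; pose D : set 'rV[R]_2 := ball 0 d.
have oD : open D by exact: ball_open.
have D0 : D 0 by exact: ballxx.
have [r r0 rd] := pt_square_ball d0.
have sbz : smooth_on D ('D_e1 b) by exact: smooth_derive.
have sbzz : smooth_on D ('D_e1 ('D_e1 b)) by exact: smooth_derive.
pose P (p : 'rV[R]_2) : 'rV[R]_2 := pt (p 0 0) 0.
have PD p : D p -> D (P p).
  move=> /ballP pr; apply/ballP; apply: le_lt_trans pr.
  apply: norm_rV_le => //; apply: forall_I2; first by rewrite pt0 coord_le_norm.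
  by rewrite pt1 normr0.
have sP : smooth_map D P by apply: smooth_pt; [exact: smooth_coord|exact: smooth_cst].
have sPg g : smooth_on D g -> smooth_on D (fun p => g (P p)).
  by move=> sg; exact: smooth_comp oD sg sP PD.
have [|b2 sb2 Hb2] := @hadamard _ _ 1 d (fun p => b p - b (P p)) (smooth_sub sb (sPg _ sb)).
  by move=> x Bx x1; rewrite /P -[in b (pt _ _)]x1 -pt_eta subrr.
have P0 (p : 'rV[R]_2) : p 0 0 = 0 -> P p = 0 by move=> p0; rewrite /P p0 pt00.
have [|c sc Hc] := @hadamard _ _ 0 d (fun p => b (P p)) (sPg _ sb).
  by move=> x _ /P0 ->.
have bE p : D p -> b p = p 0 0 * c (P p) + p 0 1 * b2 p.
  move=> Dp; rewrite -(Hb2 p Dp).1; have := (Hc _ (PD p Dp)).1.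
  by rewrite /P !pt0 => <-; rewrite addrC subrK.
have c0 : c 0 = 0.
  have := normal_form_linear_part sb sbz sbzz (fun _ _ => erefl) (fun _ _ => erefl) rd r0 qh
    (sPg _ sc) sb2 bE.
  by rewrite P0 // mxE.
have [|b1 sb1 Hb1] := @hadamard _ _ 0 d (fun p => c (P p)) (sPg _ sc).
  by move=> x _ /P0 ->.
have bE2 p : D p -> b p = p 0 0 ^+ 2 * b1 p + p 0 1 * b2 p.
  by move=> Dp; rewrite bE // (Hb1 p Dp).1 mulrA expr2.
exists b1, b2; split=> //.
have := qform_normal_form sb sbz sbzz (fun _ _ => erefl) (fun _ _ => erefl) rd r0 sb1 sb2 bE2.
have [x [y [z [qxyz dxyz]]]] := qh => /(is_littleo_sub qxyz) q0.
have /quad_unique[_ [ex ey ez]] : is_littleo 2 (fun p : 'rV[R]_2 => 0 + (0 * p 0 0 + 0 * p 0 1) +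
    quad (- 2 * b1 0 - x) (0 - y) (6 * b2 0 - z) p).
  by apply: is_littleo_near q0; apply: filterE => p; rewrite /quad; ring.
move: dxyz; rewrite -(subr0_eq ex) -(subr0_eq ey) -(subr0_eq ez).
rewrite [X in 0 < X](_ : _ = - 12 * (s * (b1 0 * b2 0))); last by ring.
by rewrite mulNr oppr_gt0 pmulr_rlt0.
Qed.

Definition CMM (e : R) (p : 'rV[R]_2) : 'rV[R]_3 :=
  row3 (p 0 0) (p 0 1 ^+ 2) (p 0 1 * (p 0 0 ^+ 2 + e * p 0 1 ^+ 2)).

Lemma CMM_plusE : @CMM_plus R = CMM 1.
Proof. by apply/funext => p; rewrite /CMM mul1r. Qed.

Lemma CMM_minusE : @CMM_minus R = CMM (-1).
Proof. by apply/funext => p; rewrite /CMM mulN1r. Qed.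

Let bC (e : R) (q : 'rV[R]_2) := q 0 0 ^+ 2 * 1 + q 0 1 * e.

Let CMM_normal_form e : CMM e = normal_form (bC e).
Proof. by apply/funext => p; rewrite /normal_form /bC pt0 pt1 mulr1 [_ * e]mulrC. Qed.

Let sbC e : smooth_on (ball 0 1) (bC e).
Proof.
apply: smooth_add; apply: smooth_mul; try exact: smooth_cst; last exact: smooth_coord.
by apply: smooth_exp; exact: smooth_coord.
Qed.

Lemma map_germ_CMM e : map_germ (CMM e).
Proof. by rewrite CMM_normal_form; exact: map_germ_normal_form ltr01 (sbC e). Qed.

Lemma adapted_normal_form d (b : 'rV[R]_2 -> R) : 0 < d -> smooth_on (ball 0 d) b ->
  b 0 = 0 -> adapted (normal_form b) e0 e1.
Proof.
move=> d0 sb b0; have J := jac_normal_form d0 sb; split.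
- by rewrite /det2 !mxE /= mulr1 mulr0 subr0 oner_eq0.
- rewrite J; apply/eqP => /(congr1 (fun x : 'rV_3 => x 0 0)).
  by rewrite row3_0 !mxE => /eqP; rewrite oner_eq0.
by rewrite J b0 mulr0; apply: rV3P; rewrite ?row3_0 ?row3_1 ?row3_2 !mxE.
Qed.

Lemma adapted_CMM e : adapted (CMM e) e0 e1.
Proof.
rewrite CMM_normal_form; apply: adapted_normal_form ltr01 (sbC e) _.
by rewrite /bC !mxE expr0n /= !mul0r addr0.
Qed.

Lemma qform_sign_CMM (e s : R) : s * e < 0 -> qform_sign s (discr (CMM e) e0 e1).
Proof.
move=> se; exists (- 2 * 1), 0, (6 * e); split; last first.
  rewrite [X in 0 < X](_ : _ = - 12 * (s * e)); last by ring.
  by rewrite mulNr oppr_gt0 pmulr_rlt0.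
have oD : open (ball (0 : 'rV[R]_2) 1) by exact: ball_open.
have sbz : smooth_on (ball 0 1) ('D_e1 (bC e)) by exact: smooth_derive.
have sbzz : smooth_on (ball 0 1) ('D_e1 ('D_e1 (bC e))) by exact: smooth_derive.
have [r r0 rd] := pt_square_ball (@ltr01 R).
rewrite CMM_normal_form.
exact: (qform_normal_form (sbC e) sbz sbzz (fun _ _ => erefl) (fun _ _ => erefl) rd r0
  (smooth_cst _ 1) (smooth_cst _ e) (fun _ _ => erefl)).
Qed.

Lemma indep2_CMM e : indep2 (e0 *m jac (CMM e) 0) (e1 *m jac2 (CMM e) e1 0).
Proof.
have oD : open (ball (0 : 'rV[R]_2) 1) by exact: ball_open.
have sbz : smooth_on (ball 0 1) ('D_e1 (bC e)) by exact: smooth_derive.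
have sbzz : smooth_on (ball 0 1) ('D_e1 ('D_e1 (bC e))) by exact: smooth_derive.
have [r r0 rd] := pt_square_ball (@ltr01 R).
rewrite CMM_normal_form (jac_normal_form ltr01 (sbC e)).
rewrite (jac2_normal_form (sbC e) sbz (fun _ _ => erefl) (fun _ _ => erefl) rd);
  last exact: ballxx.
move=> x y E.
have := congr1 (fun v : 'rV_3 => v 0 0) E; have := congr1 (fun v : 'rV_3 => v 0 1) E.
rewrite !mxE /= => /eqP; rewrite mulr0 add0r mulf_eq0 pnatr_eq0 orbF => /eqP ->.
by rewrite mulr1 mul0r addr0 => ->.
Qed.

End NormalFormJet.

(** * Recognition of the models *)

Section Recognition.
Context {R : realType}.
Local Notation e0 := (delta_mx 0 0 : 'rV[R]_2).
Local Notation e1 := (delta_mx 0 1 : 'rV[R]_2).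

(* [x^2 b1 + z b2] becomes [x^2 + e z] after multiplication by [e / b2] and the
   substitution [x sqrt (e b1 / b2)]. *)
Lemma normal_form_CMM (d e : R) (b b1 b2 : 'rV[R]_2 -> R) : 0 < d ->
  smooth_on (ball 0 d) b1 -> smooth_on (ball 0 d) b2 -> e ^+ 2 = 1 -> 0 < e * (b1 0 * b2 0) ->
  (forall p, ball 0 d p -> b p = p 0 0 ^+ 2 * b1 p + p 0 1 * b2 p) ->
  A_equivalent (normal_form b) (CMM e).
Proof.
move=> d0 sb1 sb2 e2 eb bE; have D0 : ball (0 : 'rV[R]_2) d 0 by exact: ballxx.
have sc (k : R) W : smooth_on W (fun _ : 'rV[R]_2 => k) by exact: smooth_cst.
have s12 : smooth_on (ball 0 d) (fun p => e * (b1 p * b2 p)).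
  by apply: smooth_mul => //; exact: smooth_mul.
have npos : \forall p \near (0 : 'rV[R]_2), ball 0 d p /\ 0 < e * (b1 p * b2 p).
  apply: filterI; first by apply: open_nbhs_nbhs; split; [exact: ball_open|].
  exact: cvgr_gt (smooth_continuous s12 D0) _ eb.
have [r r0 Hr] := near0_ball npos.
pose B : set 'rV[R]_2 := ball 0 r.
have oB : open B by exact: ball_open.
have B0 : B 0 by exact: ballxx.
have Bd : B `<=` ball 0 d by move=> p /Hr[].
have b2n p : B p -> b2 p != 0.
  by move=> /Hr[_]; apply: contraTneq => ->; rewrite !mulr0 ltxx.
have sv : smooth_on B (fun p => (b2 p)^-1).
  by apply: smooth_inv => //; exact: smooth_subset sb2.
pose t p := e * (b2 p)^-1.
have st : smooth_on B t by apply: smooth_mul.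
pose s p := Num.sqrt (b1 p * t p).
have pos p : B p -> 0 < b1 p * t p.
  move=> Bp; have [_ h] := Hr p Bp; have b2p := b2n p Bp.
  rewrite -(@pmulr_lgt0 _ (b2 p ^+ 2)) ?exprn_even_gt0 //.
  by rewrite [X in 0 < X](_ : _ = e * (b1 p * b2 p)) // /t; field.
have ss : smooth_on B s.
  by apply: smooth_sqrt => //; apply: smooth_mul => //; exact: smooth_subset sb1.
have s_sq p : B p -> s p ^+ 2 = b1 p * t p by move=> Bp; rewrite sqr_sqrtr // ltW // pos.
have tb2 p : B p -> t p * b2 p = e by move=> Bp; rewrite /t mulfVK // b2n.
have s0 : s 0 != 0 by rewrite gt_eqF // sqrtr_gt0 pos.
have t0 : t 0 != 0.
  by apply: contraTneq (pos 0 B0) => ->; rewrite mulr0 ltxx.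
have [r' r'0 Hr'] := pt_square_ball r0.
pose B' : set 'rV[R]_2 := ball 0 r'.
have oB' : open B' by exact: ball_open.
have B'0 : B' 0 by exact: ballxx.
have x0 W : smooth_on W (fun p : 'rV[R]_2 => p 0 0) by exact: smooth_coord.
have x1 W : smooth_on W (fun p : 'rV[R]_2 => p 0 1) by exact: smooth_coord.
have ssq : smooth_on B' (fun p => s (pt (p 0 0) (p 0 1 ^+ 2))).
  apply: (@smooth_comp R 2 2 _ B s (fun p => pt (p 0 0) (p 0 1 ^+ 2))) => //.
  by apply: smooth_pt => //; exact: smooth_exp.
have dds : diffeo_germ (fun p : 'rV[R]_2 => pt (p 0 0 * s (pt (p 0 0) (p 0 1 ^+ 2))) (p 0 1)).
  apply: (diffeo_pt oB' B'0) => //.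
  - exact: smooth_mul.
  - by rewrite mxE mul0r.
  - by rewrite mxE.
  - move=> v; rewrite derive_proj (derive_smoothM v (x0 B') ssq B'0) derive_proj.
    rewrite !mxE expr0n pt00 mul0r add0r => /eqP; rewrite mulf_eq0 (negbTE s0) => /eqP v0 v1.
    by apply: rV2P; rewrite mxE.
pose C : set 'rV[R]_3 := ball 0 r.
have oC : open C by exact: ball_open.
have C0 : C 0 by exact: ballxx.
have CB y : C y -> B (pt (y 0 0) (y 0 1)).
  move=> /ballP yr; apply/ballP; apply: le_lt_trans yr.
  by apply: norm_rV_le => //; apply: forall_I2; rewrite ?pt0 ?pt1 coord_le_norm.
have y_ i : smooth_on C (fun y : 'rV[R]_3 => y 0 i) by exact: smooth_coord.
have sC g : smooth_on B g -> smooth_on C (fun y : 'rV[R]_3 => g (pt (y 0 0) (y 0 1))).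
  move=> sg; apply: (@smooth_comp R 3 2 _ B g (fun y => pt (y 0 0) (y 0 1))) => //.
  exact: smooth_pt.
(* The source map multiplies x by s(x, y^2). On the image of the normal form y^2 is the second
   coordinate, so the target can multiply the first coordinate by the same factor. *)
pose dt (y : 'rV[R]_3) := row3 (y 0 0 * s (pt (y 0 0) (y 0 1))) (y 0 1)
  (y 0 2 * t (pt (y 0 0) (y 0 1))).
have ddt : diffeo_germ dt.
  apply: (inverse_function oC C0).
  - by apply: smooth_row3 => //; apply: smooth_mul => //; exact: sC.
  - by apply: rV3P; rewrite /dt ?row3_0 ?row3_1 ?row3_2 !mxE ?mul0r.
  - move=> v H.
    have := H 0; rewrite /dt; under eq_fun do rewrite row3_0.
    rewrite (derive_smoothM v (y_ 0) (sC _ ss) C0) derive_proj !mxE mul0r add0r pt00 => /eqP.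
    rewrite mulf_eq0 (negbTE s0) => /eqP v0.
    have := H 1; rewrite /dt; under eq_fun do rewrite row3_1.
    rewrite derive_proj => v1.
    have := H 2; rewrite /dt; under eq_fun do rewrite row3_2.
    rewrite (derive_smoothM v (y_ 2) (sC _ st) C0) derive_proj !mxE mul0r add0r pt00 => /eqP.
    rewrite mulf_eq0 (negbTE t0) => /eqP v2.
    by apply: rV3P; rewrite mxE.
exists (fun p : 'rV[R]_2 => pt (p 0 0 * s (pt (p 0 0) (p 0 1 ^+ 2))) (p 0 1)), dt; split=> //.
apply: (open_near oB' B'0) => p /Hr' Bp.
rewrite /dt /normal_form /CMM !row3_0 !row3_1 !row3_2 !pt0 !pt1.
apply: rV3P; rewrite ?row3_0 ?row3_1 ?row3_2 //.
rewrite bE ?pt0 ?pt1; last exact: Bd.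
rewrite exprMn s_sq // -(tb2 _ Bp).
by move: (b1 _) (b2 _) (t _) => ? ? ?; ring.
Qed.

(* If [Fww = l Fu] at 0, then along [s w] the function [discr] is
   [det3 Fu (Fw - s l Fu) (Fww - l Fu)], which is of third order. *)
Lemma qform_sign_indep2 (f : 'rV[R]_2 -> 'rV[R]_3) (u w : 'rV[R]_2) : map_germ f ->
  adapted f u w -> qform_sign 1 (discr f u w) -> indep2 (u *m jac f 0) (w *m jac2 f w 0).
Proof.
move=> /map_germP[U [oU U0 sf f0]] [D u0 w0] [a [b [c [q abc]]]].
rewrite mul1r in abc.
pose Fu x := u *m jac f x; pose Fw x := w *m jac f x; pose Fww x := w *m jac2 f w x.
case: (pselect (exists l, Fww 0 = l *: Fu 0)) => [[l El]|nl]; last first.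
  move=> x y E; have y0 : y = 0.
    apply: contrapT => /eqP y0; apply: nl; exists (- x / y).
    apply/rowP => i; have := congr1 (fun v : 'rV_3 => v 0 i) E; rewrite /Fww /Fu !mxE.
    move=> h; apply: (mulfI y0); rewrite mulrA mulrCA divff // mulr1.
    by rewrite mulNr; apply/eqP; rewrite -addr_eq0 addrC; apply/eqP.
  split=> //; move: E; rewrite y0 scale0r addr0 => /eqP.
  by rewrite scaler_eq0 (negbTE u0) orbF => /eqP.
exfalso.
(* The line through w is parametrized by R^1 as a space of row vectors, so that the calculus of
   orders applies to restrictions to it. *)
pose L (z : 'rV[R]_1) : 'rV[R]_2 := z 0 0 *: w.
have LE z i : L z 0 i = z 0 0 * w 0 i by rewrite mxE.
have sL : smooth_map setT L.
  by move=> i; under eq_fun do rewrite LE; apply: smooth_mul; [exact: smooth_coord|exact: smooth_cst].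
have L0 : L 0 = 0 by rewrite /L mxE scale0r.
have gL : map_germ L by apply/map_germP; exists setT; split=> //; exact: openT.
have [V [oV V0 LU]] := near0_open (map_germ_near gL (open_nbhs_nbhs (conj oU U0))).
have sLV : smooth_map V L by exact: smooth_map_subset sL.
have sFuL : smooth_map V (fun z => Fu (L z)).
  by apply: (smooth_map_comp oU sLV) => //; exact: smooth_mul_jac.
have sFwL : smooth_map V (fun z => Fw (L z)).
  by apply: (smooth_map_comp oU sLV) => //; exact: smooth_mul_jac.
have sFwwL : smooth_map V (fun z => Fww (L z)).
  by apply: (smooth_map_comp oU sLV) => //; exact: smooth_d2.
(* A is o(1), since the derivative of Fw along w at 0 is Fww 0 = l Fu 0, and C is O(1) by the choice
   of l. Their products are o(2), so the quadratic part of the discriminant vanishes at w. *)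
pose A z := Fw (L z) - (z 0 0 * l) *: Fu (L z).
pose C z := Fww (L z) - l *: Fu (L z).
have z1 : smooth_on V (fun z : 'rV[R]_1 => z 0 0) by exact: smooth_coord.
have cst (k : R) : smooth_on V (fun _ : 'rV[R]_1 => k) by exact: smooth_cst.
have zl : smooth_on V (fun z : 'rV[R]_1 => z 0 0 * l) by exact: smooth_mul.
have dL z : 'D_z L 0 = L z.
  apply/rowP => i; rewrite derive_coord; last first.
    by apply: differentiable_rV => j; exact: smooth_differentiable (sLV j) V0.
  under eq_fun do rewrite LE mulrC.
  by rewrite (derive_smoothZ _ _ z1 V0) derive_proj LE mulrC.
have AO j : is_littleo 1 (fun z => A z 0 j).
  have AE z : A z 0 j = Fw (L z) 0 j - z 0 0 * l * Fu (L z) 0 j by rewrite !mxE.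
  have s1 := sFwL j; have s2 := smooth_mul zl (sFuL j).
  have sA : smooth_on V (fun z => A z 0 j).
    by under eq_fun do rewrite AE; exact: smooth_sub.
  have A0 : A 0 0 j = 0 by rewrite AE L0 /Fw w0 !mxE !mul0r subrr.
  have DA z : 'D_z (fun z => A z 0 j) 0 = 0.
    have -> : (fun z => A z 0 j) = fun z => Fw (L z) 0 j - z 0 0 * l * Fu (L z) 0 j.
      by apply/funext => y; rewrite AE.
    rewrite (derive_smoothB z s1 s2 V0) (derive_smoothM z zl (sFuL j) V0).
    have -> : 'D_z (fun z : 'rV[R]_1 => z 0 0 * l) 0 = z 0 0 * l.
      by under eq_fun do rewrite mulrC; rewrite (derive_smoothZ _ _ z1 V0) derive_proj mulrC.
    have dLz : differentiable L 0.
      by apply: differentiable_rV => i; exact: smooth_differentiable (sLV i) V0.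
    have dFw : differentiable (fun y => Fw y 0 j) (L 0).
      by rewrite L0; exact: smooth_differentiable (smooth_mul_jac w oU sf j) U0.
    rewrite (derive_chain (g := fun y => Fw y 0 j) z dLz dFw) dL L0.
    rewrite (derive_jac _ _ (smooth_mul_jac w oU sf) U0) (jac_d1 oU U0 sf).
    have -> : w *m jac2 f (L z) 0 = z 0 0 *: Fww 0.
      have := d2_lin oU sf w w 0 (z 0 0) 0 U0.
      by rewrite !scale0r !addr0.
    by rewrite El !mxE; ring.
  have := diff_is_littleo (smooth_differentiable sA V0).
  by apply: is_littleo_near; apply: filterE => z; rewrite DA A0 !subr0.
have CO j : is_bigO 1 (fun z => C z 0 j).
  have CE z : C z 0 j = Fww (L z) 0 j - l * Fu (L z) 0 j by rewrite !mxE.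
  apply: diff_is_bigO; last by rewrite /C L0 El subrr mxE.
  apply: (smooth_differentiable _ V0); under eq_fun do rewrite CE.
  by apply: smooth_sub => //; exact: smooth_mul.
have PO j : is_bigO 0 (fun z => Fu (L z) 0 j).
  by apply: continuous_is_bigO; exact: smooth_continuous (sFuL j) V0.
have hL z : discr f u w (L z) = det3 (Fu (L z)) (A z) (C z).
  by rewrite /discr -/(Fu (L z)) -/(Fw (L z)) -/(Fww (L z)) !det3E !mxE; ring.
have oh : is_littleo 2 (fun z => discr f u w (L z)).
  have t i j k : is_littleo 2 (fun z => A z 0 i * (C z 0 j * Fu (L z) 0 k - C z 0 k * Fu (L z) 0 j)).
    apply: (@is_littleo_mulr _ _ 1 1) => //.
    by apply: is_bigO_sub; apply: (@is_bigO_mul _ _ 1 0).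
  apply: is_littleo_near (is_littleo_add (is_littleo_add (t 0 1 2) (t 1 2 0)) (t 2 0 1)).
  by apply: filterE => z; rewrite hL det3E.
have dLz : differentiable L 0.
  by apply: differentiable_rV => i; exact: smooth_differentiable (sLV i) V0.
have oq := is_littleo_sub oh (is_littleo_comp dLz L0 q).
pose Q := a * w 0 0 ^+ 2 + 2 * b * (w 0 0 * w 0 1) + c * w 0 1 ^+ 2.
have [_ _ Q0] : [/\ (0 : R) = 0, (0 : R) = 0 & Q = 0].
  apply: (@is_littleo2_poly0 R 1 (fun z => quad a b c (L z)) (const_mx 1)).
    by move=> s; rewrite /quad !LE !mxE /Q; ring.
  by apply: is_littleo_near oq; apply: filterE => z; rewrite subKr.
(* Completing the square in a Q = 0 gives a sum of two nonnegative terms, so both vanish and w =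
   0. *)
have aQ : (a * w 0 0 + b * w 0 1) ^+ 2 + (a * c - b ^+ 2) * w 0 1 ^+ 2 = 0.
  by transitivity (a * Q); [rewrite /Q; ring|rewrite Q0 mulr0].
have n1 := sqr_ge0 (a * w 0 0 + b * w 0 1).
have n2 := mulr_ge0 (ltW abc) (sqr_ge0 (w 0 1)).
move/eqP: aQ; rewrite (paddr_eq0 n1 n2).
rewrite sqrf_eq0 mulf_eq0 (gt_eqF abc) sqrf_eq0 /= => /andP[/eqP h0 /eqP w1].
have a0 : a != 0.
  by apply: contraTneq abc => ->; rewrite mul0r sub0r oppr_gt0 -leNgt sqr_ge0.
have w00 : w 0 0 = 0.
  by move/eqP: h0; rewrite w1 mulr0 addr0 mulf_eq0 (negbTE a0) => /eqP.
by move: D; rewrite /det2 w1 w00 !mulr0 subrr eqxx.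
Qed.

(* [s] is the sign of the determinant of the Hessian; the model has [e = -s]. *)
Lemma A_equivalent_CMM (f : 'rV[R]_2 -> 'rV[R]_3) (u w : 'rV[R]_2) (s : R) :
  map_germ f -> adapted f u w -> s ^+ 2 = 1 ->
  A_equivalent f (CMM (- s)) <->
  qform_sign s (discr f u w) /\ indep2 (u *m jac f 0) (w *m jac2 f w 0).
Proof.
move=> gf fuw s2; have gC := @map_germ_CMM R (- s).
split=> [fC|[qh ind]].
  have [h1 h2] := A_equivalent_qform_sign s gf gC fC fuw (adapted_CMM (- s)).
  split; [apply: h1|exact/h2/indep2_CMM].
  by apply: qform_sign_CMM; rewrite mulrN -expr2 s2 oppr_lt0.
have [d [b [d0 sb b0 fb]]] := A_equivalent_normal_form gf fuw ind.
have gb := map_germ_normal_form d0 sb.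
have [h1 _] := A_equivalent_qform_sign s gb gf (A_equivalent_sym gf gb fb)
  (adapted_normal_form d0 sb b0) fuw.
have [b1 [b2 [sb1 sb2 sb12 bE]]] := normal_form_decomposition d0 sb b0 (h1 qh).
apply: (A_equivalent_trans fb); apply: (normal_form_CMM d0 sb1 sb2) => //.
  by rewrite sqrrN.
by rewrite mulNr oppr_gt0.
Qed.

End Recognition.

(** * From arbitrary fields to constant ones, and the theorem *)

Section VectorFields.
Context {R : realType}.
Variables (U : set 'rV[R]_2) (f : 'rV[R]_2 -> 'rV[R]_3) (xi eta : 'rV[R]_2 -> 'rV[R]_2).
Hypotheses (oU : open U) (U0 : U 0) (sf : smooth_map U f) (sxi : smooth_map U xi)
  (seta : smooth_map U eta).

Lemma vf_deriveE zeta x : U x -> vf_derive zeta f x = zeta x *m jac f x.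
Proof. exact: derive_rV. Qed.

Let sDf : smooth_map U (fun x => eta x *m jac f x).
Proof. by move=> j; apply: smooth_mulmx => // k i; exact: smooth_jac. Qed.

(** The first term is the derivative of f along the field obtained by differentiating eta along
    itself; it is the Z-term of [discr_along]. *)
Lemma vf_derive2E x : U x -> vf_derive eta (vf_derive eta f) x =
  eta x *m jac eta x *m jac f x + eta x *m jac2 f (eta x) x.
Proof.
move=> Ux; have sv : smooth_map U (vf_derive eta f).
  move=> j; apply: (@smooth_eq_on _ _ _ (fun x => (eta x *m jac f x) 0 j)) => //.
  by move=> y Uy; rewrite vf_deriveE.
rewrite {1}/vf_derive (derive_rV _ sv Ux).
rewrite (jac_eq_on (g := fun y => eta y *m jac f y) oU Ux) => [|y]; last exact: vf_deriveE.
apply/rowP => j; rewrite -(derive_jac (eta x) j sDf Ux).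
by rewrite (derive_mul_jac (eta x) j oU sf seta Ux).
Qed.

(** If the differential at 0 also killed xi 0, it would vanish on a basis, against rank one. *)
Lemma adapted_fields : \rank ('J f (0 : 'rV[R]_2)) = 1%N -> 'd f (0 : 'rV[R]_2) (eta 0) = 0 ->
  free [:: xi 0; eta 0] -> adapted f (xi 0) (eta 0).
Proof.
move=> rk ker /free_indep2/indep2_det2 D.
have df : differentiable f 0.
  by apply: differentiable_rV => i; exact: smooth_differentiable (sf i) U0.
have JE v : v *m jac f 0 = 'd f (0 : 'rV[R]_2) v by rewrite -(derive_rV v sf U0) deriveE.
have w0 : eta 0 *m jac f 0 = 0 by rewrite JE.
split=> //; apply/eqP => u0.
suff J0 : 'J f (0 : 'rV[R]_2) = 0 by move: rk; rewrite J0 mxrank0.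
apply/row_matrixP => i; rewrite row0 rowE mul_rV_lin1 -JE.
by rewrite [X in X *m _](cramer2 _ D) mulmxDl -!scalemxAl u0 w0 !scaler0 addr0.
Qed.

Let phi x := det3 (vf_derive xi f x) (vf_derive eta f x) (vf_derive eta (vf_derive eta f) x).

Let phiE x : U x ->
  phi x = discr_along f id xi eta (fun y => eta y *m jac eta y) x.
Proof. by move=> Ux; rewrite /phi /discr_along !vf_deriveE // vf_derive2E. Qed.

Let sphi : smooth_on U phi.
Proof.
apply: (@smooth_eq_on _ _ _ (discr_along f id xi eta (fun y => eta y *m jac eta y))) => //.
  by move=> x Ux; rewrite phiE.
apply: smooth_det3.
- by move=> j; apply: smooth_mulmx => // k i; exact: smooth_jac.
- exact: sDf.
move=> j; apply: (@smooth_eq_on _ _ _ (fun x => (eta x *m jac (fun y => eta y *m jac f y) x) 0 j)) => //.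
  by move=> x Ux; rewrite -(derive_jac _ j sDf Ux) (derive_mul_jac _ j oU sf seta Ux).
by apply: smooth_mulmx => // k i; exact: smooth_jac.
Qed.

Hypothesis fields : adapted f (xi 0) (eta 0).

Let XW : det2 (xi 0) (eta 0) != 0. Proof. by case: fields. Qed.
Let W0 : eta 0 *m jac f 0 = 0. Proof. by case: fields. Qed.

(** The fields are replaced by their values at 0: near the origin [phi] is [discr_along] with d =
    id, and the two implications are the two lemmas on a change of fields. *)
Lemma critical_discr s : critical_at0 phi /\ 0 < s * \det (Hess phi 0) <->
  qform_sign s (discr f (xi 0) (eta 0)).
Proof.
have phi0 : phi 0 = 0 by rewrite /phi (vf_deriveE eta U0) W0 det3_0.
have sid : smooth_map U id by move=> i; exact: smooth_coord.
have near : \forall x \near (0 : 'rV[R]_2),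
    phi x = discr_along f id xi eta (fun y => eta y *m jac eta y) x.
  exact: (open_near oU U0 phiE).
rewrite (critical_qform_sign s oU U0 sphi phi0); split=> [q|q].
  have := qform_sign_near near q.
  by apply: (qform_sign_change_id oU U0 sf oU U0 sid) => //.
have jid : \det (jac (id : 'rV[R]_2 -> 'rV[R]_2) 0) != 0.
  by rewrite jac_id det1 oner_eq0.
have := @qform_sign_change _ _ _ oU U0 sf _ _ _ _ (fun y => eta y *m jac eta y) _ _ oU U0 sid
  erefl (fun _ => id) sxi seta XW W0 fields s jid q.
by apply: qform_sign_near; apply: filterS near => x ->.
Qed.

Lemma free_discr : free [:: vf_derive xi f 0; vf_derive eta (vf_derive eta f) 0] <->
  indep2 (xi 0 *m jac f 0) (eta 0 *m jac2 f (eta 0) 0).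
Proof.
rewrite free_indep2 vf_deriveE // vf_derive2E //.
exact: (@indep2_change _ _ _ oU U0 sf _ _ (fun y => eta y *m jac eta y) _ _ XW W0 fields).
Qed.

End VectorFields.

Theorem theorem2p2 (R : realType) (f : 'rV[R]_2 -> 'rV[R]_3)
    (xi eta : 'rV[R]_2 -> 'rV[R]_2)
    (f_germ : map_germ f)
    (f_corank1 : \rank ('J f (0 : 'rV[R]_2)) = 1%N)
    (xi_smooth : smooth_near0 xi)
    (eta_smooth : smooth_near0 eta)
    (eta_ker : 'd f (0 : 'rV[R]_2) (eta 0) = 0)
    (xi_eta_free : free [:: xi 0; eta 0]) :
  let phi : 'rV[R]_2 -> R := fun x =>
    det3 (vf_derive xi f x) (vf_derive eta f x)
         (vf_derive eta (vf_derive eta f) x) in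
  (A_equivalent f (@CMM_minus R) <->
     critical_at0 phi /\ 0 < \det (Hess phi 0)) /\
  (A_equivalent f (@CMM_plus R) <->
     [/\ critical_at0 phi, \det (Hess phi 0) < 0
       & free [:: vf_derive xi f 0; vf_derive eta (vf_derive eta f) 0]]).
Proof.
move=> phi.
have /map_germP[U1 [oU1 U10 sf1 _]] := f_germ.
have [U2 [oU2 U20] CU2] := xi_smooth; have [U3 [oU3 U30] CU3] := eta_smooth.
pose U := U1 `&` (U2 `&` U3).
have oU : open U by apply: openI => //; exact: openI.
have U0 : U 0 by [].
have sf : smooth_map U f by apply: smooth_map_subset sf1 => x [].
have sxi : smooth_map U xi.
  by apply: smooth_map_subset ((Ck_smooth xi oU2).1 CU2) => x [_ []].
have seta : smooth_map U eta.
  by apply: smooth_map_subset ((Ck_smooth eta oU3).1 CU3) => x [_ []].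
have ad := adapted_fields U0 sf f_corank1 eta_ker xi_eta_free.
have crit s := critical_discr oU U0 sf sxi seta ad s; rewrite -/phi in crit.
have fr := free_discr oU U0 sf seta ad.
have one : 1 ^+ 2 = 1 :> R by rewrite expr1n.
have mone : (-1) ^+ 2 = 1 :> R by rewrite sqrrN expr1n.
have Am := A_equivalent_CMM f_germ ad one.
have Ap := A_equivalent_CMM f_germ ad mone; rewrite opprK in Ap.
have c1 := crit 1; have cm := crit (-1); rewrite mul1r in c1; rewrite mulN1r oppr_gt0 in cm.
split.
  rewrite CMM_minusE Am c1; split=> [[]//|q]; split=> //.
  exact: qform_sign_indep2 f_germ ad q.
rewrite CMM_plusE Ap -cm -fr.
by split=> [[[? ?] ?]|[? ? ?]].
Qed.
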